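(* Let $k$ be a field, let $A$ be a standard $k$-algebra of representation-finite type, and let $\Lambda$ be its Auslander algebra. Then $$\dim_k HH^2(\Lambda)\ \ge\ \#\{M\in\mathrm{ind}\,A:\ \tau_AM= M\}.$$
   Context: $A$ is a finite-dimensional $k$-algebra of representation-finite type: up to isomorphism there are only finitely many indecomposable $A$-modules $X_1,\dots,X_m$. With $X=\bigoplus_iX_i$, the algebra $\Lambda=\mathrm{End}_A(X)$ is the Auslander algebra of $A$. The algebra $A$ is standard if $\Lambda$ is isomorphic to the quotient of the path algebra $k\Gamma_A$ of the Auslander-Reiten quiver $\Gamma_A$ of $A$ by the ideal generated by the mesh relations (one for each non-projective indecomposable: the sum of all paths of length two through the mesh from $\tau_AM$ to $M$). $\mathrm{ind}\,A$ is the subcategory of finitely generated left $A$-modules with one representative from each isomorphism class of indecomposable modules. $\tau_A=D\mathrm{Tr}$ is the Auslander-Reiten translate, and $\tau_AM=M$ is understood up to isomorphism (modules being identified with their representatives in $\mathrm{ind}\,A$). $HH^2(\Lambda)=\mathrm{Ext}^2_{\Lambda^e}(\Lambda,\Lambda)$, with $\Lambda^e=\Lambda\otimes_k\Lambda^{op}$. *)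

(* Defs.v *)
From HB Require Import structures.
From mathcomp Require Import all_boot all_algebra all_field.
From mathcomp Require Import finmap.
From mathcomp Require Import boolp.
From mathcomp.multinomials Require Import monalg.

Set Implicit Arguments.
Unset Strict Implicit.
Unset Printing Implicit Defensive.

Import GRing.Theory.

Local Open Scope ring_scope.

(* The opposite algebra: the library puts the converse ring structure on A^c;
   here it becomes an falgType. Left A^c-modules are right A-modules. *)
Section ConverseFalgebra.
Variables (k : fieldType) (A : falgType k).

HB.instance Definition _ := GRing.Lmodule.on A^c.

Fact conv_scalerAl (a : k) (u v : A^c) : a *: (u * v : A^c) = (a *: u : A^c) * v :> A^c.
Proof. exact: (scalerAr a (v : A) (u : A)). Qed.
HB.instance Definition _ := GRing.Lmodule_isLalgebra.Build k A^c conv_scalerAl.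

Fact conv_scalerAr (a : k) (u v : A^c) : a *: (u * v : A^c) = u * (a *: v : A^c) :> A^c.
Proof. exact: (scalerAl a (v : A) (u : A)). Qed.
HB.instance Definition _ := GRing.Lalgebra_isAlgebra.Build k A^c conv_scalerAr.

HB.instance Definition _ := Vector.on A^c.

Definition opalg : falgType k := A^c.
End ConverseFalgebra.

(* Finitely generated left modules over a finite-dimensional algebra, i.e.
   vector spaces of finite dimension with a k-bilinear action. *)
Record fdmod (k : fieldType) (A : falgType k) := FdMod {
  mod_space :> vectType k;
  mact : A -> mod_space -> mod_space;
  mact_linl : forall v, linear (mact^~ v);
  mact_linr : forall a, linear (mact a);
  mact1 : forall v, mact 1 v = v;
  mactM : forall a b v, mact (a * b) v = mact a (mact b v)
}.
Arguments mact {k A f} a v.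

Section Modules.
Variables (k : fieldType) (A : falgType k).
Implicit Types M N P : fdmod A.

HB.instance Definition _ M (a : A) := GRing.isLinear.Build k M M *:%R
  (mact a) (@mact_linr k A M a).

Definition mactl M (v : M) (a : A) : M := mact a v.
HB.instance Definition _ M (v : M) := GRing.isLinear.Build k A M *:%R
  (mactl v) (@mact_linl k A M v).

Definition is_hom M N (f : 'Hom(M, N)) : Prop :=
  forall a v, f (mact a v) = mact a (f v).

(* Hom_A(M, N) as a subspace of Hom_k(M, N): see homsP. It is cut out by the
   commutation with a basis of A. *)
Definition comm_defect M N (a : A) (f : 'Hom(M, N)) : 'Hom(M, N) :=
  ((f \o linfun (mact a)) - (linfun (mact a) \o f))%VF.

Fact comm_defect_linear M N a : linear (@comm_defect M N a).
Proof.
move=> c f g; apply/lfunP=> v; rewrite /comm_defect.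
by do !rewrite lfunE /=; rewrite linearP scalerBr opprD addrACA.
Qed.
HB.instance Definition _ M N a := GRing.isLinear.Build k 'Hom(M, N) 'Hom(M, N)
  *:%R (@comm_defect M N a) (@comm_defect_linear M N a).

Definition homs M N : {vspace 'Hom(M, N)} :=
  (\bigcap_(i < \dim {:A}) lker (linfun (comm_defect (vbasis {:A})`_i)))%VS.

Lemma homsP M N (f : 'Hom(M, N)) : reflect (is_hom f) (f \in homs M N).
Proof.
have defE a v : comm_defect a f v = f (mact a v) - mact a (f v).
  by rewrite /comm_defect; do !rewrite lfunE /=.
apply: (iffP idP) => [fM a v | fM]; last first.
  rewrite memvE; apply/subv_bigcapP => i _; rewrite -memvE memv_ker lfunE /=.
  by apply/eqP/lfunP=> v; rewrite defE fM subrr lfunE.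
have fMi (i : 'I_(\dim {:A})) w :
    f (mact (vbasis {:A})`_i w) = mact (vbasis {:A})`_i (f w).
  move: fM; rewrite memvE => /subv_bigcapP/(_ i isT); rewrite -memvE memv_ker.
  rewrite lfunE /= => /eqP/lfunP/(_ w); rewrite defE lfunE /=.
  by move/eqP; rewrite subr_eq0 => /eqP.
have actE (L : fdmod A) (w : L) : mact a w =
    \sum_i coord (vbasis {:A}) i a *: mact (vbasis {:A})`_i w.
  rewrite {1}(coord_vbasis (memvf a)) -/(mactl w _) linear_sum.
  by apply: eq_bigr => i _; rewrite linearZ.
rewrite !actE linear_sum; apply: eq_bigr => i _.
by rewrite linearZ /= fMi.
Qed.

Definition mod_iso M N : Prop :=
  exists f : 'Hom(M, N), [/\ is_hom f, lker f = 0%VS & limg f = fullv].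

Definition is_submod M (U : {vspace M}) : Prop :=
  forall a v, v \in U -> mact a v \in U.

Definition indecomposable M : Prop :=
  (exists v : M, v != 0) /\
  forall U V : {vspace M}, is_submod U -> is_submod V ->
    (U + V)%VS = fullv -> (U :&: V)%VS = 0%VS -> U = 0%VS \/ V = 0%VS.

Definition projective P : Prop :=
  forall M N (g : 'Hom(M, N)) (f : 'Hom(P, N)),
    is_hom g -> limg g = fullv -> is_hom f ->
  exists2 h : 'Hom(P, M), is_hom h & (g \o h)%VF = f.

Definition split_mono M N (f : 'Hom(M, N)) : Prop :=
  exists2 g : 'Hom(N, M), is_hom g & (g \o f)%VF = \1%VF.

Definition split_epi M N (f : 'Hom(M, N)) : Prop :=
  exists2 g : 'Hom(N, M), is_hom g & (f \o g)%VF = \1%VF.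

Definition irreducible_hom M N (f : 'Hom(M, N)) : Prop :=
  [/\ is_hom f, ~ split_mono f, ~ split_epi f &
   forall (L : fdmod A) (g : 'Hom(M, L)) (h : 'Hom(L, N)),
     is_hom g -> is_hom h -> f = (h \o g)%VF -> split_mono g \/ split_epi h].

(* f : P -> M induces a projective cover of its image W. *)
Definition proj_cover_of (P M : fdmod A) (f : 'Hom(P, M)) (W : {vspace M}) :
  Prop :=
  [/\ projective P, is_hom f, limg f = W &
   forall U : {vspace P}, is_submod U -> (U + lker f)%VS = fullv -> U = fullv].

(* P1 -f-> P0 -g-> M -> 0 is a minimal projective presentation. *)
Definition min_presentation (P1 P0 M : fdmod A) (f : 'Hom(P1, P0)) (g : 'Hom(P0, M)) :=
  proj_cover_of g fullv /\ proj_cover_of f (lker g).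

Definition is_coker M N (f : 'Hom(M, N)) (C : fdmod A) (q : 'Hom(N, C)) : Prop :=
  [/\ is_hom q, limg q = fullv & lker q = limg f].

(* M is the direct sum of the family X, with injections inj and projections
   prj. *)
Definition is_direct_sum (m : nat) (X : 'I_m -> fdmod A) M : Prop :=
  exists (inj : forall i, 'Hom(X i, M)) (prj : forall i, 'Hom(M, X i)),
  [/\ forall i, is_hom (inj i), forall i, is_hom (prj i),
      forall i, (prj i \o inj i)%VF = \1%VF,
      forall i j, i != j -> (prj j \o inj i)%VF = 0
    & \sum_i (inj i \o prj i)%VF = \1%VF].

Section Submodule.
Variables (M : fdmod A) (U : {vspace M}) (sU : is_submod U).

Definition sub_act (a : A) (w : subvs_of U) : subvs_of U :=
  Subvs (sU a (subvsP w)).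

Fact sub_act_linl w : linear (sub_act^~ w).
Proof. by move=> c x y; apply: val_inj; rewrite /= mact_linl. Qed.

Fact sub_act_linr a : linear (sub_act a).
Proof. by move=> c x y; apply: val_inj; rewrite /= linearP. Qed.

Fact sub_act1 w : sub_act 1 w = w.
Proof. by apply: val_inj; rewrite /= mact1. Qed.

Fact sub_actM a b w : sub_act (a * b) w = sub_act a (sub_act b w).
Proof. by apply: val_inj; rewrite /= mactM. Qed.

Definition submod : fdmod A := @FdMod k A (subvs_of U) sub_act
  sub_act_linl sub_act_linr sub_act1 sub_actM.
End Submodule.

Lemma ker_submod M N (f : 'Hom(M, N)) : is_hom f -> is_submod (lker f).
Proof.
by move=> fM a v; rewrite !memv_ker fM => /eqP->; rewrite linear0.
Qed.

Fact regular_linl (v : A) : linear ( *%R^~ v).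
Proof. by move=> c x y; rewrite mulrDl scalerAl. Qed.

Fact regular_linr (a : A) : linear ( *%R a).
Proof. by move=> c x y; rewrite mulrDr scalerAr. Qed.

Definition regular : fdmod A := @FdMod k A A *%R
  regular_linl regular_linr (@mul1r A) (fun a b v => esym (mulrA a b v)).

Section FreeModule.
Variable n : nat.
Implicit Type x : {ffun 'I_n -> A}.

Definition free_act (a : A) x : {ffun 'I_n -> A} := [ffun i => a * x i].

Fact free_act_linl x : linear (free_act^~ x).
Proof. by move=> c a b; apply/ffunP=> i; rewrite !ffunE mulrDl scalerAl. Qed.

Fact free_act_linr a : linear (free_act a).
Proof. by move=> c x y; apply/ffunP=> i; rewrite !ffunE mulrDr scalerAr. Qed.

Fact free_act1 x : free_act 1 x = x.
Proof. by apply/ffunP=> i; rewrite ffunE mul1r. Qed.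

Fact free_actM a b x : free_act (a * b) x = free_act a (free_act b x).
Proof. by apply/ffunP=> i; rewrite !ffunE mulrA. Qed.

Definition free_mod : fdmod A := @FdMod k A {ffun 'I_n -> A} free_act
  free_act_linl free_act_linr free_act1 free_actM.
End FreeModule.

(* The free module on a k-basis of M, with its surjection onto M and the
   kernel of that surjection. *)
Definition free_cover M : fdmod A := free_mod (\dim {:M}).

Definition free_fun M (x : free_cover M) : M :=
  \sum_(i < \dim {:M}) mact (x i) (vbasis {:M})`_i.

Fact free_fun_linear M : linear (@free_fun M).
Proof.
move=> c x y; rewrite /free_fun scaler_sumr -big_split /=.
by apply: eq_bigr => i _; rewrite !ffunE mact_linl.
Qed.
HB.instance Definition _ M := GRing.isLinear.Build k (free_cover M) M *:%R
  (@free_fun M) (@free_fun_linear M).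

Definition free_map M : 'Hom(free_cover M, M) := linfun (@free_fun M).

Lemma free_map_hom M : is_hom (free_map M).
Proof.
move=> a x; rewrite !lfunE /= /free_fun linear_sum /=.
by apply: eq_bigr => i _; rewrite ffunE mactM.
Qed.

Definition syzygy M : fdmod A := submod (ker_submod (@free_map_hom M)).

(* The free resolution of M obtained by iterating free_cover,
     ... -> res M 2 -> res M 1 -> res M 0 -> M -> 0,
   where the last map is free_map M. *)
Definition res M n : fdmod A := free_cover (iter n syzygy M).

Definition res_d M n : 'Hom(res M n.+1, res M n) :=
  (linfun vsval \o free_map (iter n.+1 syzygy M))%VF.

Definition precomp (M N L : fdmod A) (d : 'Hom(M, N)) (f : 'Hom(N, L)) :
  'Hom(M, L) := (f \o d)%VF.

Fact precomp_linear (M N L : fdmod A) d : linear (@precomp M N L d).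
Proof.
by move=> c f g; apply/lfunP=> v; rewrite /precomp; do !rewrite lfunE /=.
Qed.
HB.instance Definition _ (M N L : fdmod A) (d : 'Hom(M, N)) :=
  GRing.isLinear.Build k 'Hom(N, L) 'Hom(M, L) *:%R
    (@precomp M N L d) (@precomp_linear M N L d).

(* Cocycles and coboundaries of the complex Hom_A(res M, N), and the dimension
   over k of its cohomology Ext^n_A(M, N). *)
Definition ext_cocycles M N n : {vspace 'Hom(res M n, N)} :=
  (homs (res M n) N :&: lker (linfun (precomp (res_d M n))))%VS.

Definition ext_coboundaries M N n : {vspace 'Hom(res M n, N)} :=
  match n with
  | 0 => 0%VS
  | n'.+1 => (linfun (precomp (res_d M n')) @: homs (res M n') N)%VS
  end.

Definition ext_dim n M N : nat :=
  \dim (ext_cocycles M N n) - \dim (ext_coboundaries M N n).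

End Modules.

Lemma linear_lincomb (k : fieldType) (U V : lmodType k) (f : U -> V) n
    (c : 'I_n -> k) (u : 'I_n -> U) :
  linear f -> f (\sum_i c i *: u i) = \sum_i c i *: f (u i).
Proof.
move=> fl; pose mf := GRing.isLinear.Build k U V *:%R f fl.
pose fL : {linear U -> V} := HB.pack f mf.
transitivity (\sum_i fL (c i *: u i)); first exact: (linear_sum fL).
by apply: eq_bigr => i _; exact: (linearZ_LR fL).
Qed.

(* The tensor product of two algebras, on coordinate matrices with respect to
   bases of A and B: the entry (i, j) of the matrix of a tensor is its
   coordinate on e_i (x) f_j. *)
Definition tensalg (k : fieldType) (A B : falgType k) : Type :=
  'M[k]_(\dim {:A}, \dim {:B}).

Section Tensor.
Variables (k : fieldType) (A B : falgType k).

HB.instance Definition _ := Vector.on (tensalg A B).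

Definition tens (a : A) (b : B) : tensalg A B :=
  \matrix_(i, j) (coord (vbasis {:A}) i a * coord (vbasis {:B}) j b).

(* The linear map A (x) B -> V induced by a bilinear map f : A -> B -> V. *)
Definition tens_lift (V : lmodType k) (f : A -> B -> V) (x : tensalg A B) : V :=
  \sum_i \sum_j x i j *: f (vbasis {:A})`_i (vbasis {:B})`_j.

Lemma tens_lift_linear (V : lmodType k) (f : A -> B -> V) :
  linear (tens_lift f).
Proof.
move=> c x y; rewrite /tens_lift scaler_sumr -big_split /=.
apply: eq_bigr => i _; rewrite scaler_sumr -big_split /=.
by apply: eq_bigr => j _; rewrite !mxE scalerDl scalerA.
Qed.

Lemma tens_liftE (V : lmodType k) (f : A -> B -> V) a b :
  (forall b', linear (f^~ b')) -> (forall a', linear (f a')) ->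
  tens_lift f (tens a b) = f a b.
Proof.
move=> fl fr.
rewrite [in RHS](coord_vbasis (memvf a)) (linear_lincomb _ _ (fl b)) /tens_lift.
apply: eq_bigr => i _.
rewrite [in RHS](coord_vbasis (memvf b)) (linear_lincomb _ _ (fr _)).
by rewrite scaler_sumr; apply: eq_bigr => j _; rewrite mxE scalerA.
Qed.

Lemma tens_linl b : linear (tens^~ b).
Proof.
by move=> c x y; apply/matrixP=> i j; rewrite !mxE linearP mulrDl mulrA.
Qed.

Lemma tens_linr a : linear (tens a).
Proof.
move=> c x y; apply/matrixP=> i j; rewrite !mxE linearP mulrDr.
by rewrite mulrCA.
Qed.

Lemma tens_decomp (x : tensalg A B) :
  x = \sum_i \sum_j x i j *: tens (vbasis {:A})`_i (vbasis {:B})`_j.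
Proof.
have fA : free (vbasis {:A}) := basis_free (vbasisP _).
have fB : free (vbasis {:B}) := basis_free (vbasisP _).
apply/matrixP=> i j; rewrite summxE (bigD1 i) //= summxE (bigD1 j) //=.
rewrite !mxE !coord_free // !eqxx !mulr1 !big1 ?addr0 // => [i'|j'] ne.
  rewrite summxE big1 // => j' _.
  by rewrite !mxE !coord_free // (negbTE ne) mul0r mulr0.
by rewrite !mxE !coord_free // (negbTE ne) !mulr0.
Qed.

Lemma tens_ext (V : lmodType k) (f g : tensalg A B -> V) :
  linear f -> linear g -> (forall a b, f (tens a b) = g (tens a b)) -> f =1 g.
Proof.
move=> fl gl fg x.
have lift0 (h : tensalg A B -> V) : linear h ->
    h x = \sum_i \sum_j x i j *: h (tens (vbasis {:A})`_i (vbasis {:B})`_j).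
  move=> hl; rewrite {1}(tens_decomp x).
  transitivity (\sum_i 1 *: h (\sum_j x i j *:
      tens (vbasis {:A})`_i (vbasis {:B})`_j)).
    rewrite -(linear_lincomb _ _ hl); congr h.
    by apply: eq_bigr => i _; rewrite scale1r.
  by apply: eq_bigr => i _; rewrite scale1r (linear_lincomb _ _ hl).
rewrite (lift0 f fl) (lift0 g gl).
by apply: eq_bigr => i _; apply: eq_bigr => j _; rewrite fg.
Qed.

Definition tens_mul (x y : tensalg A B) : tensalg A B :=
  tens_lift (fun a b => tens_lift (fun a' b' => tens (a * a') (b * b')) y) x.

Lemma tens_mul_linl y : linear (tens_mul^~ y).
Proof. exact: tens_lift_linear. Qed.

Lemma tens_mul_linr x : linear (tens_mul x).
Proof.
move=> c y z; rewrite /tens_mul /tens_lift scaler_sumr -big_split /=.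
apply: eq_bigr => i _; rewrite scaler_sumr -big_split /=.
apply: eq_bigr => j _.
rewrite -!/(tens_lift (fun a' b' => tens (_ * a') (_ * b')) _).
by rewrite tens_lift_linear scalerDr !scalerA mulrC.
Qed.

Lemma tens_mulE a b a' b' :
  tens_mul (tens a b) (tens a' b') = tens (a * a') (b * b').
Proof.
have tl a1 b1 : tens_lift (fun a'' b'' => tens (a1 * a'') (b1 * b''))
    (tens a' b') = tens (a1 * a') (b1 * b').
  apply: tens_liftE => [b2|a2] c x y.
    by rewrite mulrDr -scalerAr tens_linl.
  by rewrite mulrDr -scalerAr tens_linr.
rewrite /tens_mul tens_liftE; first exact: tl.
  by move=> b1 c x y; rewrite !tl mulrDl -scalerAl tens_linl.
by move=> a1 c x y; rewrite !tl mulrDl -scalerAl tens_linr.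
Qed.

Fact tens_mulA : associative tens_mul.
Proof.
move=> x y z; move: x; apply: tens_ext => [c u v|c u v|a b].
- by rewrite tens_mul_linl.
- by rewrite !tens_mul_linl.
move: y; apply: tens_ext => [c u v|c u v|a' b'].
- by rewrite tens_mul_linl tens_mul_linr.
- by rewrite tens_mul_linr tens_mul_linl.
move: z; apply: tens_ext => [c u v|c u v|a'' b''].
- by rewrite !tens_mul_linr.
- by rewrite tens_mul_linr.
by rewrite !tens_mulE !mulrA.
Qed.

Fact tens_mul1 : left_id (tens 1 1) tens_mul.
Proof.
apply: tens_ext => [c u v|c u v|a b]; rewrite ?tens_mul_linr //.
by rewrite tens_mulE !mul1r.
Qed.

Fact tens_1mul : right_id (tens 1 1) tens_mul.
Proof.
apply: tens_ext => [c u v|c u v|a b]; rewrite ?tens_mul_linl //.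
by rewrite tens_mulE !mulr1.
Qed.

Fact tens_mulDl : left_distributive tens_mul +%R.
Proof.
by move=> x y z; have := tens_mul_linl z 1 x y; rewrite !scale1r.
Qed.

Fact tens_mulDr : right_distributive tens_mul +%R.
Proof.
by move=> x y z; have := tens_mul_linr x 1 y z; rewrite !scale1r.
Qed.

Fact tens1_neq0 : tens 1 1 != 0.
Proof.
have nz (C : falgType k) : exists i, coord (vbasis {:C}) i 1 != 0.
  apply/existsP; apply: contraT; rewrite negb_exists => /forallP C0.
  have := oner_neq0 C; rewrite (coord_vbasis (memvf (1 : C))) big1 ?eqxx //.
  by move=> i _; move/eqP: (negbNE (C0 i)) => ->; rewrite scale0r.
have [[i Ai] [j Bj]] := (nz A, nz B).
apply/eqP=> /matrixP/(_ i j)/eqP; rewrite !mxE.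
by rewrite mulf_eq0 (negbTE Ai) (negbTE Bj).
Qed.

HB.instance Definition _ := GRing.Zmodule_isNzRing.Build (tensalg A B)
  tens_mulA tens_mul1 tens_1mul tens_mulDl tens_mulDr tens1_neq0.

Fact tens_scalerAl (c : k) (x y : tensalg A B) : c *: (x * y) = (c *: x) * y.
Proof.
have := tens_mul_linl y c x 0.
by rewrite (mul0r y : tens_mul 0 y = 0) !addr0.
Qed.
HB.instance Definition _ :=
  GRing.Lmodule_isLalgebra.Build k (tensalg A B) tens_scalerAl.

Fact tens_scalerAr (c : k) (x y : tensalg A B) : c *: (x * y) = x * (c *: y).
Proof.
have := tens_mul_linr x c y 0.
by rewrite (mulr0 x : tens_mul x 0 = 0) !addr0.
Qed.
HB.instance Definition _ :=
  GRing.Lalgebra_isAlgebra.Build k (tensalg A B) tens_scalerAr.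

HB.instance Definition _ := Algebra_isFalgebra.Build k (tensalg A B).
End Tensor.

(* The enveloping algebra L^e = L (x) L^op; it acts on L by
   (a (x) b) v = a v b, see bimod_actE. *)
Definition env_alg (k : fieldType) (L : falgType k) : falgType k :=
  tensalg L (opalg L).

Section Bimodule.
Variables (k : fieldType) (L : falgType k).

Definition bimod_act (x : env_alg L) (v : L) : L :=
  tens_lift (fun (a : L) (b : opalg L) => a * v * (b : L)) x.

Lemma bimod_actE a b v : bimod_act (tens a (b : opalg L)) v = a * v * b.
Proof.
apply: tens_liftE => [b'|a'] c x y.
  by rewrite !mulrDl -!scalerAl.
by rewrite mulrDr -scalerAr.
Qed.

Fact bimod_act_linl v : linear (bimod_act^~ v).
Proof. exact: tens_lift_linear. Qed.

Fact bimod_act_linr x : linear (bimod_act x).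
Proof.
move=> c u v; move: x; apply: tens_ext => [d x y|d x y|a b].
- by rewrite bimod_act_linl.
- by rewrite !bimod_act_linl !scalerDr !scalerA mulrC addrACA.
- by rewrite !bimod_actE mulrDr mulrDl -scalerAr -scalerAl.
Qed.

Fact bimod_act1 v : bimod_act 1 v = v.
Proof. by rewrite [LHS](bimod_actE 1 1) mul1r mulr1. Qed.

Fact bimod_actM x y v : bimod_act (x * y) v = bimod_act x (bimod_act y v).
Proof.
move: x; apply: tens_ext => [d x x'|d x x'|a b].
- by rewrite mulrDl -scalerAl bimod_act_linl.
- by rewrite bimod_act_linl.
move: y; apply: tens_ext => [d y y'|d y y'|a' b'].
- by rewrite mulrDr -scalerAr bimod_act_linl.
- by rewrite bimod_act_linl bimod_act_linr.
rewrite !bimod_actE -[tens a b * tens a' b']/(tens_mul _ _) tens_mulE.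
rewrite bimod_actE.
by rewrite -[(b * b' : opalg L)]/((b' : L) * (b : L)) !mulrA.
Qed.

Definition bimodule : fdmod (env_alg L) := @FdMod k (env_alg L) L bimod_act
  bimod_act_linl bimod_act_linr bimod_act1 bimod_actM.
End Bimodule.

(* dim_k HH^n(L), where HH^n(L) = Ext^n_{L^e}(L, L). *)
Definition HH_dim (k : fieldType) (n : nat) (L : falgType k) : nat :=
  ext_dim n (bimodule L) (bimodule L).

Section Translate.
Variables (k : fieldType) (A : falgType k).
Implicit Types M N P : fdmod A.

Lemma homs_amulr M (f : 'Hom(M, regular A)) (a : A) :
  f \in homs M (regular A) -> ((amulr a : 'Hom(regular A, regular A)) \o f)%VF
    \in homs M (regular A).
Proof.
by move=> /homsP fM; apply/homsP=> b v; do !rewrite lfunE /=; rewrite fM mulrA.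
Qed.

(* The right module Hom_A(M, A), with (f a)(v) = f(v) a. *)
Section Star.
Variable M : fdmod A.

Definition star_act (a : opalg A) (f : subvs_of (homs M (regular A))) :
  subvs_of (homs M (regular A)) := Subvs (homs_amulr (a : A) (subvsP f)).

Fact star_act_linl f : linear (star_act^~ f).
Proof.
move=> c x y; apply/val_inj/lfunP=> v; do !rewrite lfunE /=.
by rewrite mulrDr -scalerAr.
Qed.

Fact star_act_linr a : linear (star_act a).
Proof.
move=> c x y; apply/val_inj/lfunP=> v; do !rewrite lfunE /=.
by rewrite mulrDl -scalerAl.
Qed.

Fact star_act1 f : star_act 1 f = f.
Proof. by apply/val_inj/lfunP=> v; do !rewrite lfunE /=; rewrite mulr1. Qed.

Fact star_actM a b f : star_act (a * b) f = star_act a (star_act b f).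
Proof. by apply/val_inj/lfunP=> v; do !rewrite lfunE /=; rewrite mulrA. Qed.

Definition star : fdmod (opalg A) :=
  @FdMod k (opalg A) (subvs_of (homs M (regular A))) star_act
    star_act_linl star_act_linr star_act1 star_actM.
End Star.

(* Hom_A(f, A) : Hom_A(N, A) -> Hom_A(M, A), g |-> g \o f. It is meant for a
   homomorphism f, for which vsproj acts on elements of Hom_A(M, A) only. *)
Definition star_map M N (f : 'Hom(M, N)) : 'Hom(star N, star M) :=
  (linfun (vsproj (homs M (regular A))) \o
     (linfun (@precomp k A M N (regular A) f) \o linfun vsval))%VF.

(* The left module D M = Hom_k(M, k) of a right module M, with
   (a f)(v) = f(v a). *)
Section Dual.
Variable M : fdmod (opalg A).

Definition dual_act (a : A) (f : 'Hom(M, k^o)) : 'Hom(M, k^o) :=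
  (f \o linfun (mact (a : opalg A)))%VF.

Fact dual_act_linl f : linear (dual_act^~ f).
Proof.
move=> c x y; apply/lfunP=> v; rewrite /dual_act; do !rewrite lfunE /=.
by rewrite mact_linl linearP.
Qed.

Fact dual_act_linr a : linear (dual_act a).
Proof.
by move=> c x y; apply/lfunP=> v; rewrite /dual_act; do !rewrite lfunE /=.
Qed.

Fact dual_act1 f : dual_act 1 f = f.
Proof.
by apply/lfunP=> v; rewrite /dual_act; do !rewrite lfunE /=; rewrite mact1.
Qed.

Fact dual_actM a b f : dual_act (a * b) f = dual_act a (dual_act b f).
Proof.
apply/lfunP=> v; rewrite /dual_act; do !rewrite lfunE /=.
by rewrite -mactM.
Qed.

Definition dual : fdmod A := @FdMod k A 'Hom(M, k^o) dual_act
  dual_act_linl dual_act_linr dual_act1 dual_actM.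
End Dual.

(* N is isomorphic to tau_A M = D Tr M, where Tr M is the cokernel of
   Hom_A(f, A) for a minimal projective presentation P1 -f-> P0 -> M -> 0. *)
Definition is_tau M N : Prop :=
  exists (P1 P0 : fdmod A) (f : 'Hom(P1, P0)) (g : 'Hom(P0, M))
    (T : fdmod (opalg A)) (q : 'Hom(star P1, T)),
  [/\ min_presentation f g, is_coker (star_map f) q & mod_iso N (dual T)].

End Translate.

Section PathAlgebra.
Variables (k : fieldType) (V : finType) (e : rel V).

(* The path v0 -> v1 -> ... -> vn is encoded as the pair
   (v0, [:: v1; ...; vn]). *)
Definition qpath : Type := {p : V * seq V | path e p.1 p.2}.
HB.instance Definition _ := Choice.on qpath.

Definition path_alg : Type := {malg k[qpath]}.
HB.instance Definition _ := GRing.Lmodule.on path_alg.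

Definition path_elt (p : qpath) : path_alg := << p >>.

(* The basis element of a sequence of vertices, 0 if it is not a path. *)
Definition path_seq (v : V) (s : seq V) : path_alg :=
  if insub (v, s) is Some p then path_elt p else 0.

(* Paths compose like functions: pq is q followed by p. *)
Definition path_comp (p q : qpath) : path_alg :=
  let: (v, s) := val p in let: (w, t) := val q in
  if v == last w t then path_seq w (t ++ s) else 0.

(* The linear map kQ -> W induced by a function f on paths. *)
Definition path_lift (W : lmodType k) (f : qpath -> W) (x : path_alg) : W :=
  \sum_(p <- msupp x) x@_p *: f p.

Definition path_mul (x y : path_alg) : path_alg :=
  path_lift (fun p => path_lift (fun q => path_comp p q) y) x.

Definition path_one : path_alg := \sum_v path_seq v [::].

Lemma path_lift_linear (W : lmodType k) (f : qpath -> W) :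
  linear (path_lift f).
Proof.
have liftE (d : {fset qpath}) (x : path_alg) : fsubset (msupp x) d ->
    path_lift f x = \sum_(p <- d) x@_p *: f p.
  move=> xd; rewrite /path_lift; apply: big_fset_incl => // p _ px.
  by rewrite (mcoeff_outdom px) scale0r.
move=> c x y; pose d := fsetU (msupp x) (msupp y).
have dx : fsubset (msupp x) d by exact: fsubsetUl.
have dy : fsubset (msupp y) d by exact: fsubsetUr.
have dxy : fsubset (msupp (c *: x + y : {malg k[qpath]})) d.
  apply: (fsubset_trans (msuppD_le _ _)).
  by apply: fsetSU; exact: msuppZ_le.
rewrite (liftE _ _ dx) (liftE _ _ dy) (liftE _ _ dxy) scaler_sumr -big_split /=.
by apply: eq_bigr => p _; rewrite mcoeffD mcoeffZ scalerDl scalerA.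
Qed.

Lemma path_liftE (W : lmodType k) (f : qpath -> W) p :
  path_lift f (path_elt p) = f p.
Proof. by rewrite /path_lift msuppU oner_eq0 big_seq_fset1 mcoeffUU scale1r. Qed.

Lemma path_ext (W : lmodType k) (f g : path_alg -> W) : linear f -> linear g ->
  (forall v s, f (path_seq v s) = g (path_seq v s)) -> f =1 g.
Proof.
move=> fl gl fg x.
have lift0 (h : path_alg -> W) : linear h ->
    h x = \sum_(p <- msupp x) x@_p *: h (path_elt p).
  move=> hl; rewrite {1}(monalgE x).
  elim: (enum_fset (msupp x)) => [|p r IHr].
    rewrite !big_nil; have := hl (-1) 0 0.
    by rewrite scaleN1r addNr => ->; rewrite scaleN1r addNr.
  rewrite !big_cons -IHr -hl; congr (h (_ + _)).
  by apply/malgP=> q; rewrite mcoeffZ !mcoeffU mulr_natr.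
rewrite (lift0 f fl) (lift0 g gl); apply: eq_bigr => -[[v s] vs] _.
have := fg v s; rewrite /path_seq (insubT (fun p => path e p.1 p.2) vs).
by move=> fgE; congr (_ *: _); exact: fgE.

Qed.

Lemma path_mul_linl y : linear (path_mul^~ y).
Proof. exact: path_lift_linear. Qed.

Lemma path_mul_linr x : linear (path_mul x).
Proof.
move=> c y z; rewrite /path_mul {1 3 4}/path_lift scaler_sumr -big_split /=.
by apply: eq_bigr => p _; rewrite path_lift_linear scalerDr !scalerA mulrC.
Qed.

Fact path_mulDl : left_distributive path_mul +%R.
Proof. by move=> x y z; have := path_mul_linl z 1 x y; rewrite !scale1r. Qed.

Fact path_mulDr : right_distributive path_mul +%R.
Proof. by move=> x y z; have := path_mul_linr x 1 y z; rewrite !scale1r. Qed.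

Lemma path_mul0 x : path_mul x 0 = 0.
Proof. by apply: (addrI (path_mul x 0)); rewrite -path_mulDr !addr0. Qed.

Lemma path_0mul x : path_mul 0 x = 0.
Proof. by apply: (addrI (path_mul 0 x)); rewrite -path_mulDl !addr0. Qed.

Lemma path_mul_seq v s w t : path_mul (path_seq v s) (path_seq w t) =
  if v == last w t then path_seq w (t ++ s) else 0.
Proof.
rewrite {1 2}/path_seq; case: insubP => [p /= vs pE|/= vs]; last first.
  rewrite path_0mul; case: eqP => // vE; rewrite /path_seq insubF //=.
  by rewrite cat_path -vE (negbTE vs) andbF.
case: insubP => [q /= wt qE|/= wt]; last first.
  rewrite path_mul0; case: eqP => // vE; rewrite /path_seq insubF //=.
  by rewrite cat_path (negbTE wt).
rewrite /path_mul !path_liftE /path_comp.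
by case: p q pE qE => [p pP] [q qP] /= -> ->.
Qed.

Fact path_mulA : associative path_mul.
Proof.
move=> x y z; move: x; apply: path_ext => [c u v|c u v|v s].
- by rewrite path_mul_linl.
- by rewrite !path_mul_linl.
move: y; apply: path_ext => [c u w|c u w|w t].
- by rewrite path_mul_linl path_mul_linr.
- by rewrite path_mul_linr path_mul_linl.
move: z; apply: path_ext => [c u u'|c u u'|u r].
- by rewrite !path_mul_linr.
- by rewrite path_mul_linr.
rewrite !path_mul_seq.
case: (w =P last u r) => [->|ne]; case: (v =P _) => [->|ne'];
  rewrite ?path_mul0 ?path_0mul ?path_mul_seq ?last_cat ?eqxx ?catA //.
- by case: eqP.
- by case: eqP.
Qed.

Fact path_1mul : left_id path_one path_mul.
Proof.
apply: path_ext => [c u v|c u v|w t]; rewrite ?path_mul_linr //.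
rewrite /path_one (big_morph (path_mul^~ _)
  (fun x y => path_mulDl x y _) (path_0mul _)).
rewrite (bigD1 (last w t)) //= path_mul_seq eqxx cats0 big1 ?addr0 // => v ne.
by rewrite path_mul_seq (negbTE ne).
Qed.

Fact path_mul1 : right_id path_one path_mul.
Proof.
apply: path_ext => [c u v|c u v|v s]; rewrite ?path_mul_linl //.
rewrite /path_one (big_morph (path_mul _)
  (path_mulDr _) (path_mul0 _)).
rewrite (bigD1 v) //= path_mul_seq eqxx cat0s big1 ?addr0 // => w ne.
by rewrite path_mul_seq /= eq_sym (negbTE ne).
Qed.

HB.instance Definition _ := GRing.Zmodule_isPzRing.Build path_alg
  path_mulA path_1mul path_mul1 path_mulDl path_mulDr.
End PathAlgebra.

(* The two-sided ideal generated by the elements satisfying G. *)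
Definition in_ideal (R : pzRingType) (G : R -> Prop) (x : R) : Prop :=
  forall I : R -> Prop,
    I 0 -> (forall y z, I y -> I z -> I (y + z)) ->
    (forall a y b, I y -> I (a * y * b)) ->
    (forall y, G y -> I y) -> I x.

Section Auslander.
Variables (k : fieldType) (A : falgType k) (m : nat) (X : 'I_m -> fdmod A).

(* X_1, ..., X_m are representatives of the isomorphism classes of
   indecomposable A-modules; such a family exists if and only if A is of
   representation-finite type. *)
Definition is_ind : Prop :=
  [/\ forall i, indecomposable (X i),
      forall i j, mod_iso (X i) (X j) -> i = j
    & forall M : fdmod A, indecomposable M -> exists i, mod_iso M (X i)].

(* L is isomorphic to End_A of the direct sum of the X_i, with the composition
   of functions as product. *)
Definition is_auslander_algebra (L : falgType k) : Prop :=
  exists (M : fdmod A) (phi : 'Hom(L, 'Hom(M, M))),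
  [/\ is_direct_sum X M, lker phi = 0%VS, limg phi = homs M M,
      phi 1 = \1%VF & forall a b, phi (a * b) = (phi a \o phi b)%VF].

(* The Auslander-Reiten quiver: the vertex i : 'I_m stands for X i, and there
   is one arrow for each pair related by an irreducible map. Recording
   multiplicities would not change is_standard: they are 1 when A is of
   representation-finite type and each End_A(X i) has residue field k. *)
Definition ar_arrow : rel 'I_m :=
  fun i j => `[< exists f : 'Hom(X i, X j), irreducible_hom f >].

Definition mesh (j i : 'I_m) : path_alg k ar_arrow :=
  \sum_(l | ar_arrow j l && ar_arrow l i) path_seq k ar_arrow j [:: l; i].

Definition mesh_relation (x : path_alg k ar_arrow) : Prop :=
  exists i j, [/\ ~ projective (X i), is_tau (X i) (X j) & x = mesh j i].

(* L is isomorphic to the path algebra of the Auslander-Reiten quiver modulo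
   the mesh relations. *)
Definition is_standard (L : falgType k) : Prop :=
  exists phi : {rmorphism path_alg k ar_arrow -> L},
  [/\ scalable phi, forall y, exists x, phi x = y
    & forall x, phi x = 0 <-> in_ideal mesh_relation x].

Definition tau_fixed : {set 'I_m} := [set i | `[< is_tau (X i) (X i) >]].

End Auslander.

(* Main.v *)
From HB Require Import structures.
Require Import Defs.
From mathcomp Require Import all_boot all_algebra all_field.
From mathcomp Require Import finmap boolp.
From mathcomp.multinomials Require Import monalg.

Set Implicit Arguments.
Unset Strict Implicit.
Unset Printing Implicit Defensive.

Import GRing.Theory.

Local Open Scope ring_scope.

(** Let B be the path algebra of the Auslander-Reiten quiver, phi : B -> L the
given surjection, I its kernel, e_v in L the image of the trivial path at v
and J the ideal of L spanned by the images of the paths of positive length.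
The mesh relations are homogeneous of degree 2, so I is homogeneous and lies
in degrees at least 2; as L has finite dimension, J is nilpotent
(rad_nilpotent), and e_v L e_v = k e_v + e_v J e_v is local.

If X_i is isomorphic to its translate, there is a mesh relation mesh(i, i),
and the class attached to it is the infinitesimal deformation of L that
replaces the relation mesh(i, i) = 0 by mesh(i, i) = epsilon e_i. Concretely,
let h : I -> L be a homomorphism of B-bimodules with h(mesh(i, i)) = e_i that
kills the other meshes, and s a linear section of phi; then f(a, b) = h(s(a)
s(b) - s(ab)) is a Hochschild 2-cocycle. If a combination of these cocycles
with coefficients c_i is the coboundary of g, then D(x) = sum_i c_i h_i(x -
s(phi(x))) + g(phi(x)) is a derivation B -> L. A derivation sends mesh(i, i),
a sum of products of two arrows, into J, while D(mesh(i, i)) = c_i e_i; hence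
c_i = 0 (HH2_mesh). That independent Hochschild classes bound the dimension of
Ext^2 from below is HH2_lower_bound: it compares the free resolution that
defines Ext with the bar resolution.

The existence of h rests on L having global dimension at most 2. Let X be the
sum of the X_i. A map L^n -> L of left modules comes from a map X -> X^n, and
its kernel is Hom(C, X), where C is the cokernel of X -> X^n. As the X_i are
all the indecomposables, C is a summand of a power of X; so the kernel is
projective (end_syz_projective). For the map given by the arrows that leave u,
the kernel is generated by the meshes that start at u, and minimally so
because arrows are independent modulo J^2. Minimal generators of a projective
module satisfy no relations (mesh_exact). A relation between multiples of
meshes in B can then be rewritten with one more arrow on the right, as often
as one wants, so that the value that h should give to it lies in every power
of J (lift_rel_uniq0).

It remains to see that mesh(i, i) is not an empty sum, for then it would be 0
and h could not exist. The isomorphism of L with the quotient of B need not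
take e_v to the projection of X onto X_v, but the images Y_v of the e_v on X
are a permutation of the X_i (vertex_split, vertex_split_inj). If no nonempty
mesh ends at v, then Y_v is projective (proj_of_no_mesh); if a mesh ends at v,
then X_v is not projective. As the two families have the same number of
projective members, a nonempty mesh ends at each v with X_v not projective
(nonprojective_has_mesh). For a tau-fixed X_i, this mesh starts at i because
the translate is unique up to isomorphism (is_tau_uniq). *)

(** * Dimension shifting for Ext^2 *)

Lemma linfun_exists (k : fieldType) (U V : vectType k) (f : U -> V) :
  linear f -> exists F : 'Hom(U, V), forall x, F x = f x.
Proof.
move=> fl; pose mf := GRing.isLinear.Build k U V *:%R f fl.
pose fL : {linear U -> V} := HB.pack f mf.
by exists (linfun fL) => x; rewrite lfunE.
Qed.

Lemma scalable_of_linear (k : fieldType) (U V : lmodType k) (f : U -> V) :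
  linear f -> forall c x, f (c *: x) = c *: f x.
Proof.
move=> fl c x; have f0 : f 0 = 0.
  by have := fl (-1) 0 0; rewrite scaleN1r oppr0 addr0 scaleN1r addNr.
by rewrite -[c *: x]addr0 fl f0 addr0.
Qed.

Lemma dim_quotient_ge (k : fieldType) (U : vectType k) (V W : {vspace U}) n
    (t : 'I_n -> U) :
  (W <= V)%VS -> (forall i, t i \in V) ->
  (forall c : 'I_n -> k, \sum_i c i *: t i \in W -> forall i, c i = 0) ->
  (n <= \dim V - \dim W)%N.
Proof.
move=> WV tV tW.
pose s := [tuple t i | i < n].
have sE (i : 'I_n) : s`_i = t i by rewrite -tnth_nth tnth_mktuple.
have fs : free s.
  apply/freeP => c; rewrite (eq_bigr (fun i => c i *: t i)); last first.
    by move=> i _; rewrite sE.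
  by move=> e; apply: tW; rewrite e mem0v.
have sWV : (W + <<s>> <= V)%VS.
  rewrite subv_add WV; apply/span_subvP => x /tnthP[i ->].
  by rewrite tnth_mktuple.
have dWs : (W :&: <<s>> = 0)%VS.
  apply/eqP; rewrite -subv0; apply/subvP => x; rewrite memv_cap => /andP[xW xs].
  rewrite memv0; move: xW; rewrite (coord_span xs).
  rewrite (eq_bigr (fun i => coord s i x *: t i)); last first.
    by move=> i _; rewrite sE.
  by move/tW => c0; rewrite big1 // => i _; rewrite c0 scale0r.
have := dimvS sWV; rewrite dimv_disjoint_sum // (eqP fs) size_tuple.
by move=> le; rewrite leq_subRL ?dimvS.
Qed.

Section ActionLinear.
Variables (k : fieldType) (A : falgType k) (M : fdmod A).
Implicit Types (a b : A) (v : M).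

Lemma mactDl a b v : mact (a + b) v = mact a v + mact b v.
Proof. by have := mact_linl v 1 a b; rewrite !scale1r. Qed.

Lemma mactZl c a v : mact (c *: a) v = c *: mact a v.
Proof. exact: scalable_of_linear (mact_linl v) c a. Qed.

Lemma mact0l v : mact 0 v = 0.
Proof. by rewrite -[X in mact X](scale0r 0) mactZl scale0r. Qed.

Lemma mactNl a v : mact (- a) v = - mact a v.
Proof. by rewrite -scaleN1r mactZl scaleN1r. Qed.

Lemma mactDr a u v : mact a (u + v) = mact a u + mact a v.
Proof. exact: linearD. Qed.

Lemma mact0r a : mact a (0 : M) = 0.
Proof. exact: linear0. Qed.
End ActionLinear.

Section FreeCover.
Variables (k : fieldType) (A : falgType k) (M : fdmod A).

Lemma free_mapE (x : free_cover M) :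
  free_map M x = \sum_i mact (x i) (vbasis {:M})`_i.
Proof. by rewrite lfunE. Qed.

Lemma free_map_coord (w : M) :
  free_map M [ffun i => coord (vbasis {:M}) i w *: (1 : A)] = w.
Proof.
rewrite free_mapE [RHS](coord_vbasis (memvf w)).
apply: eq_bigr => i _; rewrite ffunE.
by rewrite mactZl mact1.
Qed.

Lemma limg_free_map : limg (free_map M) = fullv.
Proof.
apply/eqP; rewrite eqEsubv subvf; apply/subvP => w _.
by rewrite -(free_map_coord w) memv_img ?memvf.
Qed.
End FreeCover.

Section DimensionShift.
Variables (k : fieldType) (A : falgType k).
Implicit Types M N P Q : fdmod A.

Lemma linfun_precompE M N P (d : 'Hom(M, N)) (f : 'Hom(N, P)) :
  linfun (@precomp k A M N P d) f = (f \o d)%VF.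
Proof. by rewrite lfunE. Qed.

Lemma is_hom_comp M N P (f : 'Hom(N, P)) (g : 'Hom(M, N)) :
  is_hom f -> is_hom g -> is_hom (f \o g)%VF.
Proof. by move=> fM gM a v; rewrite !comp_lfunE gM fM. Qed.

Definition ker_incl M N (f : 'Hom(M, N)) (fM : is_hom f) :
  'Hom(submod (ker_submod fM), M) := linfun vsval.

Lemma ker_inclE M N (f : 'Hom(M, N)) (fM : is_hom f) z :
  ker_incl fM z = vsval z.
Proof. by rewrite lfunE. Qed.

Lemma ker_incl_hom M N (f : 'Hom(M, N)) (fM : is_hom f) : is_hom (ker_incl fM).
Proof. by move=> a v; rewrite !ker_inclE. Qed.

Lemma comp_ker_incl M N (f : 'Hom(M, N)) (fM : is_hom f) :
  (f \o ker_incl fM)%VF = 0.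
Proof.
apply/lfunP => z; rewrite comp_lfunE ker_inclE zero_lfunE.
by apply/eqP; rewrite -memv_ker subvsP.
Qed.

Section Degree2.
Variables (M N : fdmod A).
Local Notation S2 := (syzygy (syzygy M)).

Lemma res_dE n : res_d M n =
  (ker_incl (@free_map_hom _ _ (iter n (@syzygy k A) M)) \o
     free_map (iter n.+1 (@syzygy k A) M))%VF.
Proof. by []. Qed.

(** Up to the free cover, 2-cocycles are homomorphisms on the second syzygy,
and the coboundaries are those which extend to the free module that contains
it. *)
Lemma ext_cocycle2 (th : 'Hom(S2, N)) : is_hom th ->
  (th \o free_map S2)%VF \in ext_cocycles M N 2.
Proof.
move=> thM; rewrite memv_cap; apply/andP; split.
  exact/homsP/(is_hom_comp thM)/free_map_hom.
rewrite memv_ker linfun_precompE res_dE comp_lfunA -(comp_lfunA th).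
by rewrite (comp_ker_incl (@free_map_hom _ _ S2)) comp_lfun0r comp_lfun0l.
Qed.

Lemma ext_coboundary2 (th : 'Hom(S2, N)) :
  (th \o free_map S2)%VF \in ext_coboundaries M N 2 ->
  exists2 g : 'Hom(res M 1, N), is_hom g & forall z : S2, th z = g (vsval z).
Proof.
case/memv_imgP => g /homsP gM; rewrite linfun_precompE res_dE => E.
exists g => // z.
have /memv_imgP[x _ ->] : z \in limg (free_map S2) by rewrite limg_free_map
  memvf.
have := congr1 (fun F : 'Hom(_, _) => F x) E.
by rewrite !comp_lfunE ker_inclE.
Qed.

Lemma ext_coboundaries2_sub :
  (ext_coboundaries M N 2 <= ext_cocycles M N 2)%VS.
Proof.
apply/subvP => _ /memv_imgP[g /homsP gM ->].
rewrite linfun_precompE res_dE comp_lfunA.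
exact/ext_cocycle2/(is_hom_comp gM)/ker_incl_hom.
Qed.
End Degree2.
End DimensionShift.

(** * Hochschild cocycles and Ext^2 over the enveloping algebra *)

Definition bilinear_map (k : fieldType) (U V W : lmodType k)
    (f : U -> V -> W) : Prop :=
  (forall v, linear (f^~ v)) /\ (forall u, linear (f u)).

Section Hochschild.
Variables (k : fieldType) (L : falgType k).
Implicit Types f : L -> L -> L.

Definition hoch_cocycle f : Prop :=
  forall a b c, a * f b c - f (a * b) c + f a (b * c) - f a b * c = 0.

Definition hoch_coboundary f : Prop :=
  exists2 g : L -> L, linear g & forall a b,
    f a b = a * g b - g (a * b) + g a * b.

Local Notation E := (env_alg L).
Local Notation "a ⊗ b" := (tens (a : L) (b : opalg L)) (at level 39).
Local Notation LL := (bimodule L).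

(** In the bar resolution, f acts on L (x) L (x) L as p (x) a (x) b |-> f(p,
a) b; here p (x) q in L (x) L^op multiplies 1 (x) a (x) b. *)
Definition bar_pair f (x y : E) : L :=
  tens_lift (fun (p : L) (q : opalg L) =>
    tens_lift (fun (a : L) (b : opalg L) => f p a * (b : L) * (q : L)) y) x.

(** The two error terms of the left linearity of bar_pair have this form. *)
Definition bar_side f (p v : L) (x : E) : L :=
  tens_lift (fun (a : L) (b : opalg L) => f p a * v * (b : L)) x.

Lemma bar_pair_linl f y : linear ((bar_pair f)^~ y).
Proof. exact: tens_lift_linear. Qed.

Lemma bar_pairZl f y c x : bar_pair f (c *: x) y = c *: bar_pair f x y.
Proof. exact: scalable_of_linear (bar_pair_linl f y) c x. Qed.

Lemma bar_side_lin f p v : linear (bar_side f p v).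
Proof. exact: tens_lift_linear. Qed.

Lemma bar_side0 f p x : bar_side f p 0 x = 0.
Proof.
rewrite /bar_side /tens_lift big1 // => i _; rewrite big1 // => j _.
by rewrite mulr0 mul0r scaler0.
Qed.

Section Bilinear.
Variable f : L -> L -> L.
Hypothesis fB : bilinear_map f.

Lemma bar_pair_linr x : linear (bar_pair f x).
Proof.
move=> c y z; rewrite /bar_pair /tens_lift scaler_sumr -big_split /=.
apply: eq_bigr => i _; rewrite scaler_sumr -big_split /=.
apply: eq_bigr => j _.
rewrite -![\sum_(_ < _) _]/(tens_lift (fun (a : L) (b : opalg L) =>
  f _ a * (b : L) * _) _).
by rewrite tens_lift_linear scalerDr !scalerA mulrC.
Qed.

Lemma bar_sideE p v a b : bar_side f p v (a ⊗ b) = f p a * v * b.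
Proof.
apply: tens_liftE => [b'|a'] c x y.
  by rewrite (fB.2 p) !mulrDl -!scalerAl.
by rewrite mulrDr -scalerAr.
Qed.

Lemma bar_pairE p q a b : bar_pair f (p ⊗ q) (a ⊗ b) = f p a * b * q.
Proof.
have inner p' q' : tens_lift (fun (a : L) (b : opalg L) =>
    f p' a * (b : L) * (q' : L)) (a ⊗ b) = f p' a * b * q'.
  apply: tens_liftE => [b'|a'] c x y.
    by rewrite (fB.2 p') !mulrDl -!scalerAl.
  by rewrite mulrDr mulrDl -scalerAr -scalerAl.
rewrite /bar_pair tens_liftE ?inner //.
  by move=> q' c x y; rewrite !inner (fB.1 a) !mulrDl -!scalerAl.
by move=> p' c x y; rewrite !inner mulrDr -scalerAr.
Qed.

Lemma tensM (a b a' b' : L) : (a ⊗ b) * (a' ⊗ b') = (a * a') ⊗ (b' * b) :> E.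
Proof. exact: (tens_mulE (A := L) (B := opalg L)). Qed.

(** The cocycle identity turns the defect of left linearity into one term that
depends on x and y through x * y only, and one that depends on y through its
image in L only. Both vanish on the second syzygy. *)
Lemma bar_pair_actl (fC : hoch_cocycle f) p q (x y : E) :
  bar_pair f ((p ⊗ q) * x) y =
    p * bar_pair f x y * q + bar_side f p 1 (x * y) * q
      - bar_side f p (bimod_act y 1) x * q.
Proof.
move: y; apply: tens_ext => [c y z|c y z|a' b'].
- exact: bar_pair_linr.
- rewrite bar_pair_linr (mulrDr x) -(scalerAr c x) bar_side_lin bimod_act_linl.
  have -> (u v : L) : bar_side f p (c *: u + v) x =
      c *: bar_side f p u x + bar_side f p v x.
    rewrite /bar_side /tens_lift scaler_sumr -big_split /=.
    apply: eq_bigr => i _; rewrite scaler_sumr -big_split /=.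
    apply: eq_bigr => j _.
    by rewrite mulrDr mulrDl -scalerAr -scalerAl scalerDr !scalerA mulrC.
  rewrite (mulrDr p) !mulrDl -!scalerAr -!scalerAl opprD.
  rewrite (addrACA (c *: _)) -scalerDr -scalerN (addrACA (c *: _)).
  by rewrite -scalerDr.
move: x; apply: tens_ext => [c y z|c y z|a b].
- by rewrite (mulrDr (p ⊗ q)) -scalerAr bar_pair_linl.
- rewrite bar_pair_linl (mulrDl _ _ (tens _ _)) -(scalerAl c y) !bar_side_lin.
  rewrite (mulrDr p) !mulrDl -!scalerAr -!scalerAl opprD.
  rewrite (addrACA (c *: _)) -scalerDr -scalerN (addrACA (c *: _)).
  by rewrite -scalerDr.
rewrite !tensM !bar_pairE !bar_sideE bimod_actE !mulr1.
have -> : f (p * a) a' = p * f a a' + f p (a * a') - f p a * a'.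
  rewrite -[LHS]addr0 -(fC p a a') !addrA.
  by rewrite [f (p * a) a' + p * _]addrC addrK.
by rewrite !mulrBl !mulrDl !mulrA.
Qed.

(** The comparison map from the free cover of L to L (x) L, over L. *)
Definition gen_lift (w : free_cover LL) : E :=
  \sum_i w i * ((vbasis {:L})`_i ⊗ 1).

Lemma gen_lift_lin : linear gen_lift.
Proof.
move=> c x y; rewrite /gen_lift scaler_sumr -big_split /=.
by apply: eq_bigr => i _; rewrite !ffunE mulrDl -scalerAl.
Qed.

Lemma gen_lift_act (a : E) w : gen_lift (mact a w) = a * gen_lift w.
Proof. by rewrite /gen_lift mulr_sumr; apply: eq_bigr => i _;
  rewrite ffunE mulrA. Qed.

Lemma gen_lift_act1 w : bimod_act (gen_lift w) 1 = free_map LL w.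
Proof.
rewrite [RHS]lfunE /= /free_fun /gen_lift.
rewrite -[bimod_act _ _]/(mactl (1 : LL) _) linear_sum /=.
apply: eq_bigr => i _; rewrite /mactl [LHS]bimod_actM.
by congr (bimod_act _ _); rewrite bimod_actE !mulr1.
Qed.

Local Notation S1 := (syzygy LL).
(** The comparison map from the free resolution to the bar resolution in
degree 2, followed by f; it is written on the free module that contains the
second syzygy, where it is linear over k only. *)
Definition theta_fun (x : free_cover S1) : L :=
  \sum_j bar_pair f (x j) (gen_lift (vsval (vbasis {:S1})`_j)).

Lemma theta_fun_lin : linear theta_fun.
Proof.
move=> c x y; rewrite /theta_fun scaler_sumr -big_split /=.
by apply: eq_bigr => i _; rewrite !ffunE bar_pair_linl.
Qed.

Local Notation S2 := (syzygy (syzygy LL)).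

(** On a cycle, both error terms of bar_pair_actl vanish. *)
Lemma theta_fun_act (fC : hoch_cocycle f) (x : E) (z : S2) :
  theta_fun (mact x (vsval z)) = bimod_act x (theta_fun (vsval z)).
Proof.
move: x; apply: tens_ext => [c x y|c x y|p q].
- have -> : mact (c *: x + y) (vsval z) =
  c *: mact x (vsval z) + mact y (vsval z).
    exact: mact_linl.
  exact: theta_fun_lin.
- exact: bimod_act_linl.
have ker1 (w : S1) : bimod_act (gen_lift (vsval w)) 1 = 0.
  by rewrite gen_lift_act1; apply/eqP; rewrite -memv_ker subvsP.
have ker2 : \sum_j (vsval z : free_cover S1) j *
    gen_lift (vsval (vbasis {:S1})`_j) = 0.
  have e : free_map S1 (vsval z) = 0 by apply/eqP; rewrite -memv_ker subvsP.
  have [G GE] := linfun_exists gen_lift_lin.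
  pose G1 := (G \o ker_incl (@free_map_hom _ _ LL))%VF.
  have G1E w : G1 w = gen_lift (vsval w) by rewrite comp_lfunE GE ker_inclE.
  have := congr1 G1 e; rewrite linear0 free_mapE linear_sum => e1.
  rewrite -[RHS]e1.
  by apply: eq_bigr => j _; rewrite -gen_lift_act; apply/esym/G1E.
rewrite bimod_actE /theta_fun mulr_sumr mulr_suml.
under eq_bigr => j _.
  rewrite ffunE bar_pair_actl // ker1 bar_side0 mul0r subr0.
  over.
rewrite big_split -[RHS]addr0; congr (_ + _).
rewrite -mulr_suml.
have [G GE] := linfun_exists (bar_side_lin f p 1).
transitivity (G (\sum_j (vsval z : free_cover S1) j *
    gen_lift (vsval (vbasis {:S1})`_j)) * q).
  by rewrite linear_sum; congr (_ * _); apply: eq_bigr => j _; apply/esym/GE.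
by rewrite ker2 linear0 mul0r.
Qed.

Lemma theta_exists : hoch_cocycle f ->
  exists2 th : 'Hom(S2, LL), is_hom th & forall z, th z = theta_fun (vsval z).
Proof.
move=> fC; have [F FE] := linfun_exists theta_fun_lin.
exists (F \o ker_incl (@free_map_hom _ _ S1))%VF => [a z|z].
  by rewrite !comp_lfunE !FE !ker_inclE; apply: theta_fun_act.
by rewrite comp_lfunE FE ker_inclE.
Qed.

(** From here on the comparison map goes from the bar resolution to the free
resolution, on the generators of the bar modules. *)
Definition section_of (w : S1) : free_cover S1 :=
  [ffun j => coord (vbasis {:S1}) j w *: (1 : E)].

Lemma theta_fun_section (x : E) (w : S1) :
  theta_fun (mact x (section_of w)) = bar_pair f x (gen_lift (vsval w)).
Proof.
have [G GE] := linfun_exists gen_lift_lin.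
have [H HE] := linfun_exists (bar_pair_linr x).
pose H1 := (H \o (G \o ker_incl (@free_map_hom _ _ LL)))%VF.
have H1E v : H1 v = bar_pair f x (gen_lift (vsval v)).
  by rewrite !comp_lfunE HE GE ker_inclE.
rewrite -H1E [in RHS](coord_vbasis (memvf w)) linear_sum.
apply: eq_bigr => j _; rewrite linearZ.
transitivity (coord (vbasis {:S1}) j w *:
    bar_pair f x (gen_lift (vsval (vbasis {:S1})`_j))).
  by rewrite !ffunE -scalerAr mulr1; apply: bar_pairZl.
by congr (_ *: _); apply/esym/H1E.
Qed.

Definition one_lift : free_cover LL :=
  [ffun i => coord (vbasis {:L}) i 1 *: (1 : E)].

Lemma gen_lift_one : gen_lift one_lift = 1.
Proof.
transitivity (\sum_i coord (vbasis {:L}) i 1 *: ((vbasis {:L})`_i ⊗ 1)).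
  by apply: eq_bigr => i _; rewrite ffunE -scalerAl mul1r.
rewrite -(linear_lincomb _ _ (tens_linl (A := L) (B := opalg L) 1)).
by rewrite -(coord_vbasis (memvf (1 : L))).
Qed.

(** The generators of the kernel of the product L (x) L -> L; inner_syz lifts
them to the free cover. *)
Definition inner_gen (a : L) : E := a ⊗ 1 - 1 ⊗ a.

Lemma inner_gen_lin : linear inner_gen.
Proof.
move=> c a b; rewrite /inner_gen tens_linl.
have -> : 1 ⊗ (c *: a + b) = c *: (1 ⊗ a) + 1 ⊗ b.
  exact: (tens_linr (A := L) (B := opalg L)).
by rewrite opprD addrACA scalerBr.
Qed.

Lemma inner_gen_ker a : mact (inner_gen a) one_lift \in lker (free_map LL).
Proof.
rewrite memv_ker free_map_hom free_map_coord.
have -> : mact (inner_gen a) (1 : LL) =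
  bimod_act (a ⊗ 1) 1 - bimod_act (1 ⊗ a) 1.
  have := bimod_act_linl (1 : L) (-1) (1 ⊗ a) (a ⊗ 1).
  by rewrite !scaleN1r addrC [- _ + _]addrC.
by rewrite !bimod_actE !mulr1 mul1r subrr.
Qed.

Definition inner_syz a : S1 := Subvs (inner_gen_ker a).

Lemma inner_syz_lin : linear inner_syz.
Proof.
move=> c a b; apply: val_inj; rewrite /= inner_gen_lin.
exact: (mact_linl (f := free_cover LL)).
Qed.

Lemma gen_lift_inner a : gen_lift (vsval (inner_syz a)) = inner_gen a.
Proof. by rewrite gen_lift_act gen_lift_one mulr1. Qed.

Lemma free_map_section (w : S1) : free_map S1 (section_of w) = w.
Proof. exact: free_map_coord. Qed.

Lemma section_of_lin : linear section_of.
Proof.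
move=> c u v; apply/ffunP => i.
by rewrite !ffunE linearP scalerDl scalerA.
Qed.

(** The element of the second syzygy that corresponds to the bar generator 1
(x) a (x) b (x) 1. *)
Definition hoch_chain a b : free_cover S1 :=
  mact (a ⊗ 1) (section_of (inner_syz b)) - section_of (inner_syz (a * b))
    + mact (1 ⊗ b) (section_of (inner_syz a)).

Lemma hoch_chain_ker a b : hoch_chain a b \in lker (free_map S1).
Proof.
have secE x w : free_map S1 (mact x (section_of w)) = mact x w.
  by rewrite free_map_hom free_map_section.
have e : free_map S1 (hoch_chain a b) = mact (a ⊗ 1) (inner_syz b) -
    inner_syz (a * b) + mact (1 ⊗ b) (inner_syz a).
  rewrite /hoch_chain linearD linearB.
  congr (_ - _ + _); [exact: secE|exact: free_map_section|exact: secE].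
rewrite memv_ker e; apply/eqP/val_inj.
transitivity (mact ((a ⊗ 1) * inner_gen b - inner_gen (a * b)
    + (1 ⊗ b) * inner_gen a) one_lift).
  by rewrite mactDl mactDl mactNl !mactM.
rewrite /inner_gen !mulrBr !tensM !mulr1 !mul1r.
by rewrite opprB [_ - _ + (_ - _)]addrC !addrA !subrK subrr mact0l.
Qed.

(** On hoch_chain a b, theta_fun takes the value f(a, b) - a f(1, 1) b, and a
homomorphism g takes the value of the coboundary of a |-> g(section of the
inner syzygy of a). The correction a f(1, 1) b is itself the coboundary of a
|-> a f(1, 1). *)
Lemma theta_coboundary : hoch_cocycle f ->
  (exists2 g : 'Hom(res LL 1, LL), is_hom g &
     forall z : S2, theta_fun (vsval z) = g (vsval z)) ->
  hoch_coboundary f.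
Proof.
move=> fC [g gM gE].
have f1l a : f 1 a = f 1 1 * a.
  by have := fC 1 1 a; rewrite !mul1r subrr add0r => /subr0_eq.
have f1r a : f a 1 = a * f 1 1.
  by have := fC a 1 1; rewrite !mulr1 subrK => /subr0_eq.
pose y a := section_of (inner_syz a).
exists (fun a => g (y a) + a * f 1 1).
  move=> c a b; rewrite /y inner_syz_lin section_of_lin linearP mulrDl
    -scalerAl.
  by rewrite addrACA scalerDr.
move=> a b.
have gab : theta_fun (hoch_chain a b) = g (hoch_chain a b).
  exact: gE (Subvs (hoch_chain_ker a b)).
have gcE : g (hoch_chain a b) = a * g (y b) - g (y (a * b)) + g (y a) * b.
  rewrite /hoch_chain linearD linearB /y.
  have gE1 x w : g (mact x w) = bimod_act x (g w) by exact: gM.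
  have -> : a * g (y b) =
    bimod_act (a ⊗ 1) (g (y b)) by rewrite bimod_actE mulr1.
  have -> : g (y a) * b =
    bimod_act (1 ⊗ b) (g (y a)) by rewrite bimod_actE mul1r.
  by congr (_ - _ + _); exact: gE1.
have bE p q c : bar_pair f (p ⊗ q) (inner_gen c) = f p c * q - f p 1 * c * q.
  have [H HE] := linfun_exists (bar_pair_linr (p ⊗ q)).
  by rewrite -HE /inner_gen linearB /= !HE !bar_pairE mulr1.
have tE : theta_fun (hoch_chain a b) = f a b - a * f 1 1 * b.
  transitivity (bar_pair f (a ⊗ 1) (inner_gen b)
      - bar_pair f 1 (inner_gen (a * b)) + bar_pair f (1 ⊗ b) (inner_gen a)).
    have [G GE] := linfun_exists theta_fun_lin.
    have sE x w : theta_fun (mact x (section_of w)) =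
        bar_pair f x (gen_lift (vsval w)) by exact: theta_fun_section.
    by rewrite -!gen_lift_inner -!sE mact1 -!GE /hoch_chain linearD linearB.
  transitivity (f a b * 1 - f a 1 * b * 1
      - (f 1 (a * b) * 1 - f 1 1 * (a * b) * 1) + (f 1 a * b - f 1 1 * a * b)).
    by congr (_ - _ + _); exact: bE.
  by rewrite !mulr1 (f1l (a * b)) (f1l a) subrr subr0 subrr addr0 f1r.
rewrite {}tE {}gcE in gab; move: gab; rewrite {bE gE gM}.
move: (g (y b)) (g (y a)) (g (y (a * b))) => P S Q.
move/(canRL (subrK _)) => ->.
have regroup (P' Q' S' R F : L) : P' - Q' + S' + F =
  (P' + R) - (Q' + R) + (S' + F).
  by rewrite opprD (addrACA P') subrr addr0 addrA.
by rewrite mulrDr mulrDl !mulrA; exact: regroup.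
Qed.

End Bilinear.

Lemma theta_fun_sum n (f : 'I_n -> L -> L -> L) (c : 'I_n -> k) x :
  theta_fun (fun a b => \sum_i c i *: f i a b) x =
    \sum_i c i *: theta_fun (f i) x.
Proof.
have bE u v : bar_pair (fun a b => \sum_i c i *: f i a b) u v =
    \sum_i c i *: bar_pair (f i) u v.
  rewrite /bar_pair /tens_lift;
    under [RHS]eq_bigr => i _ do rewrite scaler_sumr.
  rewrite [RHS]exchange_big; apply: eq_bigr => p _.
  under [RHS]eq_bigr => i _ do rewrite scaler_sumr.
  rewrite [RHS]exchange_big; apply: eq_bigr => q _.
  under [RHS]eq_bigr => i _ do rewrite scalerA mulrC -scalerA scaler_sumr.
  rewrite -scaler_sumr; congr (_ *: _); rewrite [RHS]exchange_big;
    apply: eq_bigr => a _.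
  under [RHS]eq_bigr => i _ do rewrite scaler_sumr.
  rewrite [RHS]exchange_big; apply: eq_bigr => b _.
  under [RHS]eq_bigr => i _ do rewrite scalerA mulrC -scalerA.
  rewrite -scaler_sumr; congr (_ *: _).
  by rewrite !mulr_suml; apply: eq_bigr => i _; rewrite -!scalerAl.
rewrite /theta_fun; under [RHS]eq_bigr => i _ do rewrite scaler_sumr.
by rewrite [RHS]exchange_big; apply: eq_bigr => j _; exact: bE.
Qed.

(** The homomorphisms given by theta_fun represent the Hochschild classes in
Ext^2, and by theta_coboundary no class is lost. *)
Lemma HH2_lower_bound n (f : 'I_n -> L -> L -> L) :
  (forall i, bilinear_map (f i)) -> (forall i, hoch_cocycle (f i)) ->
  (forall c : 'I_n -> k, hoch_coboundary (fun a b => \sum_i c i *: f i a b) ->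
     forall i, c i = 0) ->
  (n <= HH_dim 2 L)%N.
Proof.
move=> fB fC find.
have /(@choice _ _ _) [th thP] : forall i,
    exists th : 'Hom(syzygy (syzygy LL), LL),
    is_hom th /\ forall z, th z = theta_fun (f i) (vsval z).
  by move=> i; have [th] := theta_exists (fB i) (fC i); exists th.
apply: (dim_quotient_ge (t :=
  fun i => (th i \o free_map (syzygy (syzygy LL)))%VF)).
- exact: ext_coboundaries2_sub.
- by move=> i; apply: ext_cocycle2; case: (thP i).
move=> c; have -> : \sum_i c i *: (th i \o free_map (syzygy (syzygy LL)))%VF =
    ((\sum_i c i *: th i) \o free_map (syzygy (syzygy LL)))%VF.
  apply/lfunP => v; rewrite comp_lfunE !sum_lfunE; apply: eq_bigr => i _.
  by rewrite !scale_lfunE comp_lfunE.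
move=> /ext_coboundary2[g gM gE]; apply: find; apply: theta_coboundary.
- split=> [b|a] d x y; rewrite scaler_sumr -big_split /=; apply: eq_bigr => i _.
    by rewrite (proj1 (fB i)) scalerDr !scalerA mulrC.
  by rewrite (proj2 (fB i)) scalerDr !scalerA mulrC.
- move=> a b d; rewrite mulr_sumr mulr_suml -!sumrB -big_split /= -sumrB.
  rewrite big1 // => i _;
    rewrite -scalerAr -scalerAl -scalerBr -scalerDr -scalerBr.
  by rewrite (fC i) scaler0.
exists g => // z; rewrite theta_fun_sum -gE sum_lfunE; apply: eq_bigr => i _.
by rewrite scale_lfunE (thP i).2.
Qed.
End Hochschild.

(** * Path algebras *)

(** What is used of the path algebra: its product on paths, induction over
linear combinations of paths, and the extension of functions on paths to
linear maps. The path algebra itself is path_alg_model. *)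
Record path_model (k : fieldType) (V : finType) (e : rel V) := PathModel {
  pm_space :> lmodType k;
  pmul : pm_space -> pm_space -> pm_space;
  pone : pm_space;
  pseq : V -> seq V -> pm_space;
  pmulA : associative pmul;
  pmul1x : left_id pone pmul;
  pmulx1 : right_id pone pmul;
  pmul_lin : bilinear_map pmul;
  pmul_seq : forall v s w t, pmul (pseq v s) (pseq w t) =
    if v == last w t then pseq w (t ++ s) else 0;
  pone_sum : pone = \sum_v pseq v [::];
  pseq_out : forall v s, ~~ path e v s -> pseq v s = 0;
  pm_ind : forall P : pm_space -> Prop,
    P 0 -> (forall x y, P x -> P y -> P (x + y)) ->
    (forall c v s, path e v s -> P (c *: pseq v s)) -> forall x, P x;
  pm_ext : forall (W : lmodType k) (g : V -> seq V -> W),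
    {F : {linear pm_space -> W} | forall v s, path e v s ->
      F (pseq v s) = g v s}
}.

Arguments pmul {k V e p} x y.
Arguments pone {k V e p}.
Arguments pseq {k V e p} v s.
Arguments pseq_out {k V e p v s}.
Arguments pm_ext {k V e} p {W} g.

Notation "x ⊙ y" := (pmul x y) (at level 40, left associativity).

Section PathModelTools.
Variables (k : fieldType) (V : finType) (e : rel V) (B : path_model k e).
Local Notation ps := (@pseq k V e B).
Implicit Types (x y z : B) (u v w l : V) (s t : seq V) (c : k).

Lemma pmulDl x y z : (x + y) ⊙ z = x ⊙ z + y ⊙ z.
Proof. by have := (pmul_lin B).1 z 1 x y; rewrite !scale1r. Qed.

Lemma pmulDr x y z : x ⊙ (y + z) = x ⊙ y + x ⊙ z.
Proof. by have := (pmul_lin B).2 x 1 y z; rewrite !scale1r. Qed.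

Lemma pmulZl c x y : (c *: x) ⊙ y = c *: (x ⊙ y).
Proof. exact: scalable_of_linear ((pmul_lin B).1 y) c x. Qed.

Lemma pmulZr c x y : x ⊙ (c *: y) = c *: (x ⊙ y).
Proof. exact: scalable_of_linear ((pmul_lin B).2 x) c y. Qed.

Lemma pmul0x x : 0 ⊙ x = 0.
Proof. by rewrite -[X in X ⊙ _](scale0r 0) pmulZl scale0r. Qed.

Lemma pmulx0 x : x ⊙ 0 = 0.
Proof. by rewrite -[X in _ ⊙ X](scale0r 0) pmulZr scale0r. Qed.

Definition path_coef v s : {linear B -> k^o} :=
  sval (pm_ext B (fun v' s' => ((v' == v) && (s' == s))%:R : k^o)).

Lemma path_coefE v s v' s' : path e v' s' ->
  path_coef v s (ps v' s') = ((v' == v) && (s' == s))%:R.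
Proof. exact: (svalP (pm_ext B _)). Qed.

Lemma path_coefZ v s c x : path_coef v s (c *: x) = c * path_coef v s x.
Proof. exact: linearZ. Qed.

(** The n-th power of the arrow ideal. *)
Inductive deg_ge (n : nat) : B -> Prop :=
| deg_ge0 : deg_ge n 0
| deg_geD x y : deg_ge n x -> deg_ge n y -> deg_ge n (x + y)
| deg_geP c v s : path e v s -> (n <= size s)%N -> deg_ge n (c *: ps v s).

Lemma deg_geM a b x y : deg_ge a x -> deg_ge b y -> deg_ge (a + b) (x ⊙ y).
Proof.
move=> xa yb; elim: xa => {x} [|x x' _ IH _ IH'|c v s vs sa].
- by rewrite pmul0x; apply: deg_ge0.
- by rewrite pmulDl; apply: deg_geD.
elim: yb => {y} [|y y' _ IH _ IH'|d w t wt tb].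
- by rewrite pmulx0; apply: deg_ge0.
- by rewrite pmulDr; apply: deg_geD.
rewrite pmulZl pmulZr scalerA pmul_seq.
case: eqP => [vE|_]; last by rewrite scaler0; apply: deg_ge0.
apply: deg_geP; first by rewrite cat_path wt -vE.
by rewrite size_cat addnC leq_add.
Qed.

Lemma deg_geT x : deg_ge 0 x.
Proof.
by apply: (pm_ind (P := deg_ge 0)) => [|y z|c v s vs];
  [apply: deg_ge0|apply: deg_geD|apply: deg_geP].
Qed.

Lemma deg_geW a b x : (b <= a)%N -> deg_ge a x -> deg_ge b x.
Proof.
move=> ba; elim=> {x} [|x y _ IH _ IH'|c v s vs sa].
- exact: deg_ge0.
- exact: deg_geD.
by apply: deg_geP => //; apply: leq_trans sa.
Qed.

Lemma deg_geZ a c x : deg_ge a x -> deg_ge a (c *: x).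
Proof.
elim=> {x} [|x y _ IH _ IH'|d v s vs sa].
- by rewrite scaler0; apply: deg_ge0.
- by rewrite scalerDr; apply: deg_geD.
by rewrite scalerA; apply: deg_geP.
Qed.

Lemma deg_ge_coef a x v s : deg_ge a x -> (size s < a)%N -> path_coef v s x = 0.
Proof.
elim=> {x} [|x y _ IH _ IH'|d w t wt ta] sa.
- exact: linear0.
- by rewrite linearD IH // IH' // addr0.
rewrite path_coefZ path_coefE //; case: eqP => //= _; last exact: mulr0.
by case: eqP => [ts|_]; rewrite ?mulr0 //; move: ta; rewrite ts leqNgt sa.
Qed.

Lemma deg_ge_const x : exists2 y, deg_ge 1 y &
  x = \sum_v path_coef v [::] x *: ps v [::] + y.
Proof.
pose S x := \sum_v path_coef v [::] x *: ps v [::].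
have SD y z : S (y + z) = S y + S z.
  rewrite /S -big_split; apply: eq_bigr => v _.
  by rewrite linearD; exact: scalerDl.
have S0 : S 0 = 0.
  by rewrite /S big1 // => v _; rewrite linear0 scale0r.
apply: (pm_ind (P := fun x => exists2 y, deg_ge 1 y & x = S x + y)).
- by exists 0; [exact: deg_ge0|rewrite S0 addr0].
- move=> y z [y1 dy ey] [z1 dz ez]; exists (y1 + z1); first exact: deg_geD.
  by rewrite SD; transitivity (S y + y1 + (S z + z1));
    [congr (_ + _)|exact: addrACA].
move=> c v s vs.
have SE : S (c *: ps v s) = if s == [::] then c *: ps v s else 0.
  rewrite /S (bigD1 v) // big1 => [|w wv].
    rewrite path_coefZ path_coefE // eqxx.
    by case: eqP => [->|_]; rewrite ?mulr1 ?mulr0 ?scale0r; exact: addr0.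
  by rewrite path_coefZ path_coefE // eq_sym (negbTE wv) mulr0 scale0r.
case: eqP SE => [s0|/eqP s0] ->.
  by exists 0; [exact: deg_ge0|rewrite addr0].
exists (c *: ps v s); last by rewrite add0r.
by apply: deg_geP => //; case: s s0 {vs}.
Qed.

Lemma idem_mul v w : ps v [::] ⊙ ps w [::] = if v == w then ps v [::] else 0.
Proof. by rewrite pmul_seq /=; case: eqP => [->|]. Qed.

Lemma arrow_idl l w : ps w [::] ⊙ ps l [:: w] = ps l [:: w].
Proof. by rewrite pmul_seq /= eqxx. Qed.

Lemma arrow_idr l w : ps l [:: w] ⊙ ps l [::] = ps l [:: w].
Proof. by rewrite pmul_seq /= eqxx. Qed.

Lemma path_seq_cons u l t : ps l t ⊙ ps u [:: l] = ps u (l :: t).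
Proof. by rewrite pmul_seq /= eqxx. Qed.

Lemma path_seq_rcons v s w : ps (last v s) [:: w] ⊙ ps v s = ps v (rcons s w).
Proof. by rewrite pmul_seq eqxx cats1. Qed.

(** B e_u is the direct sum of k e_u and of the B (u -> l), each of them free
on the arrow: this is the coordinate at u -> l. *)
Definition rstrip u l : {linear B -> B} :=
  sval (pm_ext B (fun v s => if s is l' :: t then
    if (v == u) && (l' == l) then ps l t else 0 else 0)).

Lemma rstripE u l v s : path e v s -> rstrip u l (ps v s) =
  if s is l' :: t then if (v == u) && (l' == l) then ps l t else 0 else 0.
Proof. exact: (svalP (pm_ext B _)). Qed.

Lemma rstripZ u l c x : rstrip u l (c *: x) = c *: rstrip u l x.
Proof. exact: linearZ. Qed.

Lemma rstripD u l x y : rstrip u l (x + y) = rstrip u l x + rstrip u l y.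
Proof. exact: linearD. Qed.

Lemma rstrip_cons x u l v l' t : rstrip u l (x ⊙ ps v (l' :: t)) =
  if (v == u) && (l' == l) && e v l' then x ⊙ ps l t else 0.
Proof.
elim/pm_ind: x => [|x y IHx IHy|c w s ws].
- by rewrite !pmul0x linear0 if_same.
- by rewrite pmulDl rstripD IHx IHy pmulDl; case: ifP; rewrite ?addr0.
rewrite !pmulZl rstripZ pmul_seq.
have [wE|ne] := eqVneq w (last v (l' :: t)); last first.
  rewrite linear0 scaler0; case: ifP => // /andP[/andP[_ /eqP El] _].
  by move: ne; rewrite /= El pmul_seq => /negbTE ->; rewrite scaler0.
have [vt|/negbTE vt] := boolP (path e v (l' :: t)); last first.
  have z: ~~ path e v ((l' :: t) ++ s) by rewrite cat_path vt.
  rewrite (pseq_out z) linear0 scaler0.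
  case: ifP => // /andP[/andP[_ /eqP El] vl].
  move: vt; rewrite /= vl /= El => lt; rewrite [ps l t]pseq_out ?lt //.
  by rewrite pmulx0 scaler0.
have vs : path e v ((l' :: t) ++ s) by rewrite cat_path vt -wE.
rewrite rstripE //; move: vt => /= /andP[-> _]; rewrite andbT.
case: ifP => [/andP[_ /eqP El]|_]; last by rewrite scaler0.
by move: wE; rewrite /= El pmul_seq => <-; rewrite eqxx.
Qed.

Lemma rstrip_id x u l v :
  rstrip u l (x ⊙ ps v [::]) = if v == u then rstrip u l x else 0.
Proof.
elim/pm_ind: x => [|x y IHx IHy|c w s ws].
- by rewrite pmul0x !linear0 if_same.
- by rewrite pmulDl !rstripD IHx IHy; case: ifP; rewrite ?addr0.
rewrite !pmulZl !rstripZ pmul_seq /= (rstripE _ _ ws).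
have [wv|wv] := eqVneq w v; last first.
  rewrite linear0 scaler0; case: eqP => // vu.
  by case: s ws => [|l' t] _; rewrite ?scaler0 // -vu (negbTE wv) scaler0.
rewrite -wv rstripE //; case: eqP => // wu.
by case: s ws => [|l' t] _; rewrite scaler0.
Qed.

Lemma rstrip_arrow x u l l' : rstrip u l (x ⊙ ps u [:: l']) =
  if (l' == l) && e u l then x ⊙ ps l [::] else 0.
Proof. by rewrite rstrip_cons eqxx /=; case: eqP => [->|]. Qed.

(** The coordinate at l -> w in the decomposition of e_w B into k e_w and the
(l -> w) B. *)
Definition lstrip l w : {linear B -> B} :=
  sval (pm_ext B (fun v s => if (s != [::]) && (last v s == w) &&
      (last v (take (size s).-1 s) == l) then ps v (take (size s).-1 s) else
        0)).

Lemma lstripE l w v s : path e v s -> lstrip l w (ps v s) =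
  if (s != [::]) && (last v s == w) &&
      (last v (take (size s).-1 s) == l) then ps v (take (size s).-1 s) else 0.
Proof. exact: (svalP (pm_ext B _)). Qed.

Lemma lstripZ u l c x : lstrip u l (c *: x) = c *: lstrip u l x.
Proof. exact: linearZ. Qed.

Lemma lstripD u l x y : lstrip u l (x + y) = lstrip u l x + lstrip u l y.
Proof. exact: linearD. Qed.

Lemma lstrip_rcons l w v s w' : path e v (rcons s w') ->
  lstrip l w (ps v (rcons s w')) =
  if (w' == w) && (last v s == l) then ps v s else 0.
Proof.
move=> vs; rewrite lstripE // last_rcons size_rcons /=.
by rewrite -cats1 take_size_cat //; case: s {vs}.
Qed.

Lemma lstrip_arrow l w l' w' x : lstrip l w (ps l' [:: w'] ⊙ x) =
  if (l' == l) && (w' == w) && e l' w' then ps l [::] ⊙ x else 0.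
Proof.
elim/pm_ind: x => [|x y IHx IHy|c v s vs].
- by rewrite !pmulx0 linear0 if_same.
- by rewrite !pmulDr lstripD IHx IHy; case: ifP; rewrite ?addr0.
rewrite !pmulZr lstripZ !pmul_seq.
have [lE|ne] := eqVneq l' (last v s); last first.
  rewrite linear0 scaler0; case: eqP => //= El; rewrite -El (negbTE ne).
  by rewrite scaler0 if_same.
rewrite cats1; have [vsw|vsw] := boolP (path e v (rcons s w')); last first.
  move: (vsw); rewrite rcons_path vs -lE /= => /negbTE ->; rewrite andbF.
  by rewrite (pseq_out vsw) linear0 scaler0.
rewrite lstrip_rcons //; move: vsw; rewrite rcons_path -lE => /andP[_ ->].
rewrite andbT andbC; case: ifP => [/andP[/eqP El _]|_]; last by rewrite scaler0.
by rewrite -El eqxx cats0.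
Qed.

Lemma lstrip_mul l w x b : deg_ge 1 x -> lstrip l w (x ⊙ b) = lstrip l w x ⊙ b.
Proof.
move=> dx; elim/pm_ind: b => [|b b' IH IH'|d v t vt].
- by rewrite !pmulx0 linear0.
- by rewrite !pmulDr lstripD IH IH'.
rewrite !pmulZr lstripZ; congr (_ *: _).
elim: dx => {x} [|x y _ IH _ IH'|c u s us s1].
- by rewrite linear0 !pmul0x linear0.
- by rewrite lstripD !pmulDl lstripD IH IH'.
rewrite lstripZ !pmulZl lstripZ; congr (_ *: _).
case/lastP: s us s1 => // s w' us _.
rewrite (lstrip_rcons _ _ us) pmul_seq.
have [uE|ne] := eqVneq u (last v t); last first.
  by case: ifP; rewrite ?pmul0x ?linear0 // pmul_seq (negbTE ne).
have us' : path e v (rcons (t ++ s) w') by rewrite rcons_cat cat_path vt -uE.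
rewrite -rcons_cat lstrip_rcons // last_cat -uE.
by case: ifP => _; rewrite ?pmul0x // pmul_seq uE eqxx.
Qed.

Lemma lstrip_id l w v x :
  lstrip l w (ps v [::] ⊙ x) = if v == w then lstrip l w x else 0.
Proof.
elim/pm_ind: x => [|x y IHx IHy|c u s us].
- by rewrite !pmulx0 linear0 if_same.
- by rewrite !pmulDr !lstripD IHx IHy; case: ifP; rewrite ?addr0.
rewrite !pmulZr !lstripZ pmul_seq cats0.
have [vE|ne] := eqVneq v (last u s); last first.
  rewrite linear0 scaler0; case: eqP => // vw; rewrite lstripE //.
  by rewrite -vw [_ == v]eq_sym (negbTE ne) andbF scaler0.
case: eqP => // vw; rewrite lstripE // -vE.
by move/eqP/negbTE: vw => ->; rewrite andbF scaler0.
Qed.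

Lemma lstrip_sum w x : deg_ge 1 x ->
  ps w [::] ⊙ x = \sum_l ps l [:: w] ⊙ lstrip l w x.
Proof.
elim=> {x} [|x y _ IH _ IH'|c u s us s1].
- by rewrite pmulx0 big1 // => l _; rewrite linear0 pmulx0.
- rewrite pmulDr IH IH' -big_split; apply: eq_bigr => l _.
  by rewrite lstripD pmulDr.
rewrite pmulZr.
under eq_bigr => l _ do rewrite lstripZ pmulZr.
rewrite -scaler_sumr; congr (_ *: _).
case/lastP: s us s1 => // s w' us _.
rewrite pmul_seq last_rcons cats0.
under eq_bigr => l _ do rewrite lstrip_rcons //.
have [ww|ne] := eqVneq w w'; last first.
  by rewrite big1 // => l _; rewrite pmulx0.
rewrite -ww (bigD1 (last u s)) //= big1 => [|l /negbTE ls].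
  by rewrite !eqxx path_seq_rcons addr0.
by rewrite [_ == l]eq_sym ls pmulx0.
Qed.
End PathModelTools.

(** * Quotients of path algebras by mesh relations *)

Definition lker_rel (k : fieldType) (L : falgType k) (I : finType)
  (al p : I -> L) : Prop := \sum_i p i * al i = 0.

(** Global dimension at most 2: the kernel of each map L^I -> L of left
modules is projective. The Q_t generate the kernel and the xi_t are the
coordinates of a dual basis. *)
Definition syz_projective (k : fieldType) (L : falgType k) : Prop :=
  forall (I : finType) (al : I -> L),
  exists (T : finType) (Q : T -> I -> L) (xi : T -> (I -> L) -> L),
  [/\ forall t, lker_rel al (Q t),
      forall t p q, lker_rel al p -> lker_rel al q ->
        xi t (fun i => p i + q i) = xi t p + xi t q,
      forall t a p, lker_rel al p -> xi t (fun i => a * p i) = a * xi t p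
    & forall p, lker_rel al p -> forall i, p i = \sum_t xi t p * Q t i].

Section MeshQuotient.
Variables (k : fieldType) (V : finType) (e : rel V) (B : path_model k e).
Variables (L : falgType k) (mrel : V -> V -> Prop).
Local Notation ps := (@pseq k V e B).
Implicit Types (x y z : B) (u v w l : V) (s t : seq V) (c : k) (a b : L).

Definition mesh_elt j i : B := \sum_(l | e j l && e l i) ps j [:: l; i].

Definition mesh_ideal x : Prop := forall P : B -> Prop,
  P 0 -> (forall y z, P y -> P z -> P (y + z)) ->
  (forall y x z, P x -> P (y ⊙ x ⊙ z)) ->
  (forall j i, mrel j i -> P (mesh_elt j i)) -> P x.

Lemma mesh_idealD x y : mesh_ideal x -> mesh_ideal y -> mesh_ideal (x + y).
Proof. by move=> Ix Iy P P0 PD PM PG;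
  exact: PD (Ix P P0 PD PM PG) (Iy P P0 PD PM PG). Qed.

Lemma mesh_ideal0 : mesh_ideal 0.
Proof. by []. Qed.

Lemma mesh_idealM y x z : mesh_ideal x -> mesh_ideal (y ⊙ x ⊙ z).
Proof. by move=> Ix P P0 PD PM PG; exact: PM (Ix P P0 PD PM PG). Qed.

Lemma mesh_idealMl y x : mesh_ideal x -> mesh_ideal (y ⊙ x).
Proof. by move/(mesh_idealM y pone); rewrite pmulx1. Qed.

Lemma mesh_idealMr x z : mesh_ideal x -> mesh_ideal (x ⊙ z).
Proof. by move/(mesh_idealM pone z); rewrite pmul1x. Qed.

Lemma mesh_idealZ c x : mesh_ideal x -> mesh_ideal (c *: x).
Proof. by move/(mesh_idealMl (c *: pone)); rewrite pmulZl pmul1x. Qed.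

Lemma mesh_elt_deg2 j i : deg_ge 2 (mesh_elt j i).
Proof.
apply: big_ind => [||l /andP[jl li]]; [exact: deg_ge0|exact: deg_geD|].
by rewrite -[ps _ _]scale1r; apply: deg_geP => //=; rewrite jl li.
Qed.

Lemma mesh_ideal_deg2 x : mesh_ideal x -> deg_ge 2 x.
Proof.
apply; [exact: deg_ge0|exact: deg_geD| |move=> j i _; exact: mesh_elt_deg2].
move=> y {}x z dx.
have := deg_geM (deg_geM (deg_geT y) dx) (deg_geT z).
by rewrite addn0.
Qed.

Definition hcomp n : {linear B -> B} :=
  sval (pm_ext B (fun v s => if size s == n then ps v s else 0)).

Lemma hcompE n v s : path e v s ->
  hcomp n (ps v s) = if size s == n then ps v s else 0.
Proof. exact: (svalP (pm_ext B _)). Qed.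

Lemma hcompZ n c x : hcomp n (c *: x) = c *: hcomp n x.
Proof. exact: linearZ. Qed.

Lemma hcompD n x y : hcomp n (x + y) = hcomp n x + hcomp n y.
Proof. exact: linearD. Qed.

Lemma hcomp_mull n v s x : path e v s -> hcomp n (ps v s ⊙ x) =
  if (size s <= n)%N then ps v s ⊙ hcomp (n - size s)%N x else 0.
Proof.
move=> vs; elim/pm_ind: x => [|x y IH IH'|c w t wt].
- by rewrite linear0 !pmulx0 linear0 if_same.
- by rewrite pmulDr !hcompD pmulDr IH IH'; case: ifP; rewrite ?addr0.
rewrite pmulZr !hcompZ pmulZr pmul_seq (hcompE _ wt).
have [vw|ne] := eqVneq v (last w t); last first.
  rewrite linear0 scaler0; case: ifP => // _.
  by case: ifP; rewrite ?pmulx0 ?scaler0 // pmul_seq (negbTE ne) scaler0.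
have wts : path e w (t ++ s) by rewrite cat_path wt -vw.
rewrite hcompE // size_cat; case: leqP => sn; last first.
  by rewrite gtn_eqF ?scaler0 // ltn_addl.
rewrite -(eqn_add2r (size s) _ (n - _)%N) subnK //.
by case: eqP => _; rewrite ?pmulx0 // pmul_seq vw eqxx.
Qed.

Lemma hcomp_mulr n v s x : path e v s -> hcomp n (x ⊙ ps v s) =
  if (size s <= n)%N then hcomp (n - size s)%N x ⊙ ps v s else 0.
Proof.
move=> vs; elim/pm_ind: x => [|x y IH IH'|c w t wt].
- by rewrite linear0 !pmul0x linear0 if_same.
- by rewrite pmulDl !hcompD pmulDl IH IH'; case: ifP; rewrite ?addr0.
rewrite pmulZl !hcompZ pmulZl pmul_seq (hcompE _ wt).
have [vw|ne] := eqVneq w (last v s); last first.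
  rewrite linear0 scaler0; case: ifP => // _.
  by case: ifP; rewrite ?pmul0x ?scaler0 // pmul_seq (negbTE ne) scaler0.
have wts : path e v (s ++ t) by rewrite cat_path vs -vw.
rewrite hcompE // size_cat; case: leqP => sn; last first.
  by rewrite gtn_eqF ?scaler0 // ltn_addr.
rewrite -(eqn_add2r (size s) _ (n - _)%N) subnK // addnC.
by case: eqP => _; rewrite ?pmul0x // pmul_seq vw eqxx.
Qed.

(** The mesh relations are homogeneous of degree 2. *)
Lemma mesh_ideal_hcomp x : mesh_ideal x -> forall n, mesh_ideal (hcomp n x).
Proof.
move=> Ix; apply: (Ix (fun x => forall n, mesh_ideal (hcomp n x))).
- by move=> n; rewrite linear0; apply: mesh_ideal0.
- by move=> y z Iy Iz n; rewrite linearD; apply: mesh_idealD.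
- move=> y {Ix}x z Ix.
  elim/pm_ind: y => [|y y' IH IH'|c v s vs] n.
  + by rewrite !pmul0x linear0; apply: mesh_ideal0.
  + by rewrite !pmulDl linearD; apply: mesh_idealD.
  rewrite !pmulZl hcompZ; apply: mesh_idealZ.
  elim/pm_ind: z => [|z z' IH IH'|d w t wt].
  + by rewrite pmulx0 linear0; apply: mesh_ideal0.
  + by rewrite pmulDr linearD; apply: mesh_idealD.
  rewrite pmulZr hcompZ; apply: mesh_idealZ.
  rewrite hcomp_mulr //; case: ifP => _; last exact: mesh_ideal0.
  rewrite hcomp_mull //; case: ifP => _; last by rewrite pmul0x;
    apply: mesh_ideal0.
  exact: mesh_idealM.
move=> j i ji n.
have -> : hcomp n (mesh_elt j i) = if n == 2%N then mesh_elt j i else 0.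
  rewrite /mesh_elt linear_sum; case: eqP => [->|n2].
    by apply: eq_bigr => l /andP[jl li]; rewrite hcompE //= jl li.
  rewrite big1 // => l /andP[jl li]; rewrite hcompE /= ?jl ?li //.
  by case: eqP => // n2'; case: n2.
by case: eqP => _; [move=> P P0 PD PM PG; apply: PG|exact: mesh_ideal0].
Qed.

Record mesh_pres (phi : {linear B -> L}) : Prop := MeshPres {
  presM : forall x y, phi (x ⊙ y) = phi x * phi y;
  pres1 : phi pone = 1;
  pres_surj : forall a, exists x, phi x = a;
  pres_ker : forall x, phi x = 0 <-> mesh_ideal x
}.

Variable phi : {linear B -> L}.
Hypothesis phiP : mesh_pres phi.

Lemma phiM x y : phi (x ⊙ y) = phi x * phi y. Proof. exact: presM phiP x y. Qed.

(** The n-th power of the ideal J of L. *)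
Definition rad n a : Prop := exists2 x, deg_ge n x & phi x = a.

Lemma rad0 n : rad n 0.
Proof. by exists 0; [exact: deg_ge0|exact: linear0]. Qed.

Lemma radD n a b : rad n a -> rad n b -> rad n (a + b).
Proof. by move=> [x dx <-] [y dy <-]; exists (x + y);
  [exact: deg_geD|exact: linearD]. Qed.

Lemma radZ n c a : rad n a -> rad n (c *: a).
Proof. by move=> [x dx <-]; exists (c *: x);
  [exact: deg_geZ|exact: linearZ]. Qed.

Lemma radN n a : rad n a -> rad n (- a).
Proof. by rewrite -scaleN1r; apply: radZ. Qed.

Lemma rad_sum n (I : Type) (r : seq I) (P : pred I) (F : I -> L) :
  (forall i, P i -> rad n (F i)) -> rad n (\sum_(i <- r | P i) F i).
Proof. by move=> H; apply: big_ind => //; [exact: rad0|exact: radD]. Qed.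

Lemma radM n p a b : rad n a -> rad p b -> rad (n + p) (a * b).
Proof. by move=> [x dx <-] [y dy <-]; exists (x ⊙ y);
  [exact: deg_geM|exact: phiM]. Qed.

Lemma radT a : rad 0 a.
Proof. by have [x <-] := pres_surj phiP a; exists x => //; exact: deg_geT. Qed.

Lemma radMr n a b : rad n a -> rad n (a * b).
Proof. by move=> na; rewrite -[n]addn0; apply: radM => //; exact: radT. Qed.

Lemma radMl n a b : rad n b -> rad n (a * b).
Proof. by move=> nb; apply: (radM (n := 0)) => //; exact: radT. Qed.

Definition idem v : L := phi (ps v [::]).
Definition arr l w : L := phi (ps l [:: w]).

Lemma idemM v w : idem v * idem w = if v == w then idem v else 0.
Proof. by rewrite -phiM idem_mul; case: ifP => // _; exact: linear0. Qed.

Lemma idem_idem v : idem v * idem v = idem v.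
Proof. by rewrite idemM eqxx. Qed.

Lemma sum_idem : \sum_v idem v = 1.
Proof. by rewrite -linear_sum -pone_sum (pres1 phiP). Qed.

Lemma arrl l w : idem w * arr l w = arr l w.
Proof. by rewrite -phiM arrow_idl. Qed.

Lemma arrr l w : arr l w * idem l = arr l w.
Proof. by rewrite -phiM arrow_idr. Qed.

Lemma arr_rad l w : rad 1 (arr l w).
Proof.
exists (ps l [:: w]) => //.
have [lw|lw] := boolP (e l w); last first.
  rewrite pseq_out; first exact: deg_ge0.
  by rewrite /= (negbTE lw).
by rewrite -[ps _ _]scale1r; apply: deg_geP => //=; rewrite lw.
Qed.

(** I lies in degrees at least 2, so that L agrees with B in degrees 0 and 1.
*)
Lemma idem_notin_rad c v : rad 1 (c *: idem v) -> c = 0.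
Proof.
move=> [x dx] E.
have : mesh_ideal (c *: ps v [::] - x).
  by apply/(pres_ker phiP); rewrite linearB linearZ E subrr.
move/mesh_ideal_deg2 => d2; have := deg_ge_coef v (s := [::]) d2 isT.
rewrite linearB path_coefZ (deg_ge_coef _ dx) // path_coefE // !eqxx.
by rewrite mulr1 subr0.
Qed.

Lemma idem_neq0 v : idem v != 0.
Proof.
apply/eqP => v0; have /idem_notin_rad/eqP : rad 1 (1 *: idem v).
  by rewrite v0 scaler0; apply: rad0.
by rewrite oner_eq0.
Qed.

Lemma arrow_notin_rad2 c l w : e l w -> rad 2 (c *: arr l w) -> c = 0.
Proof.
move=> lw [x dx] E.
have : mesh_ideal (c *: ps l [:: w] - x).
  by apply/(pres_ker phiP); rewrite linearB linearZ E subrr.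
move/mesh_ideal_deg2 => d2; have := deg_ge_coef l (s := [:: w]) d2 isT.
rewrite linearB path_coefZ (deg_ge_coef _ dx) // path_coefE /= ?lw // !eqxx.
by rewrite mulr1 subr0.
Qed.

(** There is a path of length 0 from w to v for w = v only, the trivial one.
*)
Lemma local_decomp v w a : exists c,
  rad 1 (idem v * a * idem w - (if v == w then c *: idem v else 0)).
Proof.
have [x <-] := pres_surj phiP a.
have [y dy xE] := deg_ge_const x.
exists (path_coef B v [::] x).
have -> : idem v * phi x * idem w -
   (if v == w then path_coef B v [::] x *: idem v else 0) =
     idem v * phi y * idem w.
  rewrite {1}xE linearD mulrDr mulrDl addrAC linear_sum.
  rewrite mulr_sumr mulr_suml (bigD1 v) //= big1 => [|u uv].
    rewrite addr0 linearZ -scalerAr -scalerAl idem_idem idemM.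
    by case: ifP => _; rewrite ?scaler0 subrr add0r.
  rewrite linearZ -scalerAr -scalerAl idemM eq_sym (negbTE uv).
  by rewrite mul0r scaler0.
by apply/radMr/radMl; exists y.
Qed.

(** If no power of J vanished, there would be a path outside I in each length.
As I is homogeneous, their images would be linearly independent in L. *)
Lemma rad_nilpotent : exists n, forall a, rad n a -> a = 0.
Proof.
have [[n nI]|noI] := EM (exists n, forall v s, path e v s -> size s = n ->
  mesh_ideal (ps v s)).
  exists n => _ [x dx <-]; apply/(pres_ker phiP).
  elim: dx => {x} [|x y _ IH _ IH'|c v s vs ns].
  - exact: mesh_ideal0.
  - exact: mesh_idealD.
  apply: mesh_idealZ.
  move: vs; rewrite -[s](cat_take_drop n) cat_path => /andP[v1 v2].
  have -> : ps v (take n s ++ drop n s) =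
      ps (last v (take n s)) (drop n s) ⊙ ps v (take n s).
    by rewrite pmul_seq eqxx.
  exact: mesh_idealMl (nI _ _ v1 (size_takel ns)).
have /(@choice _ _ _) [p pP] : forall n, exists p : V * seq V,
    [/\ path e p.1 p.2, size p.2 = n & ~ mesh_ideal (ps p.1 p.2)].
  move=> n; apply: contrapT => H; apply: noI; exists n => v s vs sn.
  by apply: contrapT => I; apply: H; exists (v, s).
have := @dim_quotient_ge k L fullv 0%VS (\dim {:L}).+1 (fun i => phi (ps (p
  i).1 (p i).2)).
move=> /(_ (sub0v _) (fun i => memvf _)) H;
  suff: ((\dim {:L}).+1 <= \dim {:L} - \dim (0%VS : {vspace L}))%N.
  by rewrite dimv0 subn0 ltnn.
apply: H => c.
rewrite memv0 => /eqP H i.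
have I : mesh_ideal (\sum_(i < (\dim {:L}).+1) c i *: ps (p i).1 (p i).2).
  apply/(pres_ker phiP); rewrite linear_sum -[RHS]H; apply: eq_bigr => j _.
  exact: linearZ.
have := mesh_ideal_hcomp I i.
have -> : hcomp i (\sum_(i < (\dim {:L}).+1) c i *: ps (p i).1 (p i).2) =
    c i *: ps (p i).1 (p i).2.
  rewrite linear_sum (bigD1 i) //= big1 => [|j ji].
    by rewrite addr0 hcompZ hcompE; case: (pP i) => // _ -> _; rewrite eqxx.
  rewrite hcompZ hcompE; case: (pP j) => // _ -> _.
  by rewrite -val_eqE /= in ji; rewrite (negbTE ji) scaler0.
have [//|ci] := eqVneq (c i) 0.
move/(mesh_idealZ (c i)^-1); rewrite scalerA mulVf // scale1r.
by case: (pP i).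
Qed.

Lemma phi_ker x : mesh_ideal x -> phi x = 0.
Proof. by move/(pres_ker phiP). Qed.

(** An empty mesh sum is the zero element, to which only the value 0 can be
given; the meshes with at least one middle vertex are the true generators. *)
Definition nonempty_mesh j i : bool :=
  `[< mrel j i >] && [exists l, e j l && e l i].

Lemma phi_mesh j i : phi (mesh_elt j i) = \sum_(l | e j l) arr l i * arr j l.
Proof.
rewrite linear_sum [RHS](bigID (e^~ i)) /= [X in _ + X]big1 ?addr0; last first.
  move=> l /andP[_ li]; have -> : arr l i = 0; last by rewrite mul0r.
  by rewrite /arr pseq_out ?linear0 //= (negbTE li).
by apply: eq_bigr => l _; rewrite -phiM path_seq_cons.
Qed.

Lemma mesh_ideal_gen j i : nonempty_mesh j i -> mesh_ideal (mesh_elt j i).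
Proof. by case/andP => /asboolP ji _ P P0 PD PM PG; apply: PG. Qed.

Lemma phi_mesh0 j i : nonempty_mesh j i ->
  \sum_(l | e j l) arr l i * arr j l = 0.
Proof. by move=> ji; rewrite -phi_mesh; exact: phi_ker (mesh_ideal_gen ji). Qed.

Lemma rstrip_mul u l y x : deg_ge 1 x ->
  rstrip B u l (y ⊙ x) = y ⊙ rstrip B u l x.
Proof.
elim=> {x} [|x x' _ IH _ IH'|c v s vs s1].
- by rewrite pmulx0 !linear0 pmulx0.
- by rewrite pmulDr !linearD IH IH' pmulDr.
rewrite pmulZr !rstripZ pmulZr; congr (_ *: _).
case: s vs s1 => // l' t vs _; rewrite rstrip_cons rstripE //.
by move: vs => /= /andP[-> _]; rewrite andbT; case: ifP; rewrite ?pmulx0.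
Qed.

Section Lifting.
Variable c : V -> k.
Definition mesh_val j i : L := if j == i then c i *: idem i else 0.

(** The graph of the B-bimodule map I -> L sought, with value c_i e_i on
mesh(i, i) and 0 on mesh(j, i) for j <> i: the sub-bimodule of B x L generated
by these values. It is single-valued by lift_rel_uniq0. *)
Definition lift_rel x a : Prop := forall P : B -> L -> Prop,
  P 0 0 -> (forall x a y b, P x a -> P y b -> P (x + y) (a + b)) ->
  (forall y x a z, P x a -> P (y ⊙ x ⊙ z) (phi y * a * phi z)) ->
  (forall j i, nonempty_mesh j i -> P (mesh_elt j i) (mesh_val j i)) -> P x a.

Lemma lift_rel0 : lift_rel 0 0.
Proof. by []. Qed.

Lemma lift_relD x a y b : lift_rel x a -> lift_rel y b ->
  lift_rel (x + y) (a + b).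
Proof.
by move=> xa yb P P0 PD PM PG; exact: PD (xa P P0 PD PM PG) (yb P P0 PD PM PG).
Qed.

Lemma lift_relM y x a z : lift_rel x a ->
  lift_rel (y ⊙ x ⊙ z) (phi y * a * phi z).
Proof. by move=> xa P P0 PD PM PG; exact: PM (xa P P0 PD PM PG). Qed.

Lemma lift_rel_gen j i : nonempty_mesh j i ->
  lift_rel (mesh_elt j i) (mesh_val j i).
Proof. by move=> ji P P0 PD PM PG; exact: PG. Qed.

Lemma lift_relMl y x a : lift_rel x a -> lift_rel (y ⊙ x) (phi y * a).
Proof. by move/(lift_relM y pone); rewrite pmulx1 (pres1 phiP) mulr1. Qed.

Lemma lift_relMr x a z : lift_rel x a -> lift_rel (x ⊙ z) (a * phi z).
Proof. by move/(lift_relM pone z); rewrite pmul1x (pres1 phiP) mul1r. Qed.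

Lemma lift_relZ d x a : lift_rel x a -> lift_rel (d *: x) (d *: a).
Proof.
move/(lift_relMl (d *: pone)); rewrite pmulZl pmul1x linearZ.
by rewrite -scalerAl (pres1 phiP) mul1r.
Qed.

Lemma lift_relN x a : lift_rel x a -> lift_rel (- x) (- a).
Proof. by rewrite -!scaleN1r; apply: lift_relZ. Qed.

Lemma lift_rel_sum (I : Type) (r : seq I) (P : pred I)
    (F : I -> B) (G : I -> L) :
  (forall i, P i -> lift_rel (F i) (G i)) ->
  lift_rel (\sum_(i <- r | P i) F i) (\sum_(i <- r | P i) G i).
Proof. by move=> H; apply: (big_ind2 lift_rel lift_rel0 lift_relD). Qed.

Lemma lift_rel_ideal x a : lift_rel x a -> mesh_ideal x.
Proof.
move=> xa; apply: (xa (fun x _ => mesh_ideal x)).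
- exact: mesh_ideal0.
- by move=> y _ z _; exact: mesh_idealD.
- by move=> y {xa}x _ z; exact: mesh_idealM.
by move=> j i; exact: mesh_ideal_gen.
Qed.

Lemma ideal_lift_rel x : mesh_ideal x -> exists a, lift_rel x a.
Proof.
move=> Ix; apply: (Ix (fun x => exists a, lift_rel x a)).
- by exists 0; exact: lift_rel0.
- by move=> y z [a ya] [b zb]; exists (a + b); exact: lift_relD.
- by move=> y {Ix}x z [a xa]; exists (phi y * a * phi z); exact: lift_relM.
move=> j i ji; have [ne|emp] := boolP (nonempty_mesh j i).
  by exists (mesh_val j i); exact: lift_rel_gen.
exists 0; rewrite /mesh_elt big_pred0; first exact: lift_rel0.
move: emp; rewrite /nonempty_mesh asboolT // negb_exists => /forallP H l.
exact/negbTE/H.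
Qed.

(** Modulo the multiples b_w mesh(u, w), the coordinates of x at the arrows u
-> l are again in the domain of lift_rel, and the value of x is recovered from
the values there. *)
Definition split_at u x a : Prop := exists (b : V -> B) (d : V -> L),
  (forall l, e u l ->
     lift_rel (rstrip B u l x
       - \sum_(w | nonempty_mesh u w) b w ⊙ ps l [:: w]) (d l)) /\
  a * idem u = \sum_(w | nonempty_mesh u w) phi (b w) * mesh_val u w +
     \sum_(l | e u l) d l * arr u l.

Lemma split_at0 u : split_at u 0 0.
Proof.
exists (fun=> 0), (fun=> 0); split=> [l ul|].
  rewrite linear0 big1 ?subr0 => [|w _]; last exact: pmul0x.
  exact: lift_rel0.
by rewrite mul0r !big1 ?addr0 // => w _; rewrite ?linear0 mul0r.
Qed.

Lemma split_atD u x a y b : split_at u x a -> split_at u y b ->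
  split_at u (x + y) (a + b).
Proof.
move=> [b1 [d1 [H1 E1]]] [b2 [d2 [H2 E2]]].
exists (fun w => b1 w + b2 w), (fun w => d1 w + d2 w); split=> [l ul|].
  have -> : \sum_(w | nonempty_mesh u w) (b1 w + b2 w) ⊙ ps l [:: w] =
    \sum_(w | nonempty_mesh u w) b1 w ⊙ ps l [:: w] +
      \sum_(w | nonempty_mesh u w) b2 w ⊙ ps l [:: w].
    by rewrite -big_split; apply: eq_bigr => w _; exact: pmulDl.
  by rewrite rstripD opprD addrACA; exact: lift_relD (H1 l ul) (H2 l ul).
rewrite mulrDl E1 E2 addrACA -!big_split; congr (_ + _).
  by apply: eq_bigr => w _; rewrite linearD mulrDl.
by apply: eq_bigr => w _; rewrite mulrDl.
Qed.

Lemma split_atZ u d0 x a : split_at u x a -> split_at u (d0 *: x) (d0 *: a).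
Proof.
move=> [b [d [H E]]]; exists (fun w => d0 *: b w), (fun w => d0 *: d w);
  split=> [l ul|].
  have -> : rstrip B u l (d0 *: x)
    - \sum_(w | nonempty_mesh u w) (d0 *: b w) ⊙ ps l [:: w] =
      d0 *: (rstrip B u l x - \sum_(w | nonempty_mesh u w) b w ⊙ ps l [:: w]).
    rewrite rstripZ scalerBr scaler_sumr; congr (_ - _).
    by apply: eq_bigr => w _; exact: pmulZl.
  exact: lift_relZ (H l ul).
rewrite -scalerAl E scalerDr !scaler_sumr; congr (_ + _).
  by apply: eq_bigr => w _; rewrite linearZ -scalerAl.
by apply: eq_bigr => w _; rewrite -scalerAl.
Qed.

(** Consider a mesh(j, i) b with a path b. If b is trivial, this is a left
multiple of a mesh; if not, stripping the first arrow of b leaves an element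
of I. *)
Lemma lift_rel_split x a : lift_rel x a -> forall u, split_at u x a.
Proof.
move=> xa; suff : lift_rel x a /\ forall u, split_at u x a by case.
apply: (xa (fun x a => lift_rel x a /\ forall u, split_at u x a)).
- by split=> [|u]; [exact: lift_rel0|exact: split_at0].
- move=> y b z d [H1 S1] [H2 S2]; split=> [|u]; first exact: lift_relD.
  exact: split_atD.
- move=> y {xa}x {}a z [xa S]; split=> [|u]; first exact: lift_relM.
  have {}S : split_at u (y ⊙ x) (phi y * a).
    have [b [d [H E]]] := S u.
    exists (fun w => y ⊙ b w), (fun w => phi y * d w); split=> [l ul|].
      rewrite rstrip_mul; last first.
        by apply: (deg_geW (a := 2)) => //;
          exact: mesh_ideal_deg2 (lift_rel_ideal xa).
      have -> : y ⊙ rstrip B u l x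
        - \sum_(w | nonempty_mesh u w) y ⊙ b w ⊙ ps l [:: w] =
          y ⊙ (rstrip B u l x - \sum_(w | nonempty_mesh u w) b w ⊙ ps l [:: w]).
        rewrite -[- (\sum_(w | _) b _ ⊙ _)]scaleN1r pmulDr pmulZr scaleN1r.
        congr (_ - _); rewrite (big_morph (pmul y) (pmulDr y) (pmulx0 y)).
        by apply: eq_bigr => w _; rewrite pmulA.
      exact: lift_relMl (H l ul).
    rewrite -mulrA E mulrDr !mulr_sumr; congr (_ + _).
      by apply: eq_bigr => w _; rewrite phiM mulrA.
    by apply: eq_bigr => w _; rewrite mulrA.
  have {xa} := lift_relMl y xa; move: S.
  move: (y ⊙ x) (phi y * a) => {a y}x a S xa.
  elim/pm_ind: z => [|z z' IH IH'|t v s vs].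
  + by rewrite pmulx0 linear0 mulr0; exact: split_at0.
  + by rewrite pmulDr linearD mulrDr; exact: split_atD.
  rewrite pmulZr linearZ -scalerAr; apply: split_atZ.
  case: s vs => [|l' t'] vs.
    have [->|vu] := eqVneq v u.
      have [b [d [H E]]] := S; exists b, d; split=> [l ul|].
        by rewrite rstrip_id eqxx; exact: H.
      by rewrite -mulrA idem_idem.
    exists (fun=> 0), (fun=> 0); split=> [l ul|].
      rewrite rstrip_id (negbTE vu) big1 ?subr0 => [|w _]; last exact: pmul0x.
      exact: lift_rel0.
    rewrite -mulrA idemM (negbTE vu) mulr0.
    by rewrite !big1 ?addr0 // => w _; rewrite ?linear0 mul0r.
  exists (fun=> 0), (fun l => if (v == u) && (l' == l) then a
    * phi (ps l t') else 0).
  split=> [l ul|].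
    rewrite rstrip_cons big1 ?subr0 => [|w _]; last exact: pmul0x.
    move: vs => /= /andP[-> _]; rewrite andbT; case: ifP => _;
      last exact: lift_rel0.
    exact: lift_relMr.
  rewrite big1 ?add0r => [|w _]; last by rewrite linear0 mul0r.
  rewrite -mulrA -phiM pmul_seq /= eq_sym.
  have [uv|_] := eqVneq u v; last first.
    by rewrite linear0 mulr0 big1 // => l _; rewrite mul0r.
  have ul' : e u l' by move: vs => /= /andP[]; rewrite uv.
  rewrite (bigD1 l') //= eqxx big1 ?addr0; last first.
    by move=> l /andP[_ /negbTE ll']; rewrite [l' == l]eq_sym ll' mul0r.
  by rewrite -mulrA -phiM path_seq_cons.
move=> j i ji; split=> [|u]; first exact: lift_rel_gen.
exists (fun w => if (u == j) && (w == i) then pone else 0), (fun=> 0).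
have [uj|uj] := eqVneq u j; last first.
  split=> [l ul|].
    rewrite big1 ?subr0 => [|w _]; last by rewrite /= pmul0x.
    rewrite /mesh_elt linear_sum big1 => [|l' /andP[jl' l'i]].
      exact: lift_rel0.
    by rewrite /= rstripE /= ?jl' ?l'i // eq_sym (negbTE uj).
  rewrite [X in _ = X + _]big1 => [|w _]; last by rewrite linear0 mul0r.
  rewrite [X in _ = _ + X]big1 => [|w _]; last by rewrite mul0r.
  rewrite addr0.
  rewrite /mesh_val; case: (eqVneq j i) => [<-|_]; last by rewrite mul0r.
  by rewrite -scalerAl idemM eq_sym (negbTE uj) scaler0.
split=> [l ul|].
  have -> : \sum_(w | nonempty_mesh u w) (if true && (w == i) then pone else
    0) ⊙ ps l [:: w] =
      ps l [:: i].
    rewrite (bigD1 i) ?uj //= eqxx big1 ?addr0 ?pmul1x // => w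
      /andP[_ /negbTE ->].
    exact: pmul0x.
  have -> : rstrip B u l (mesh_elt j i) = ps l [:: i].
    rewrite /mesh_elt linear_sum -uj; have [li|li] := boolP (e l i).
      rewrite (bigD1 l) ?ul //= rstripE /= ?ul ?li // !eqxx big1 ?addr0 //.
      move=> l' /andP[/andP[ul' l'i] /negbTE ll'].
      by rewrite rstripE /= ?ul' ?l'i // ll' andbF.
    rewrite pseq_out /= ?(negbTE li) // big1 // => l' /andP[ul' l'i].
    rewrite rstripE /= ?ul' ?l'i // eqxx.
    by case: eqP => // ll'; rewrite -ll' l'i in li.
  by rewrite subrr; exact: lift_rel0.
rewrite [X in _ + X]big1 ?addr0 => [|w _]; last by rewrite mul0r.
rewrite (bigD1 i) ?uj //= eqxx big1 ?addr0; last first.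
  by move=> w /andP[_ /negbTE ->]; rewrite linear0 mul0r.
rewrite (pres1 phiP) mul1r /mesh_val; case: (eqVneq j i) => [<-|_];
  last by rewrite mul0r.
by rewrite -scalerAl idem_idem.
Qed.
End Lifting.

(** The coefficients of mesh(u, w) on the arrows that leave u. *)
Definition mesh_row u w l : L := if e u l then arr l w else 0.

Lemma mesh_row_ker u w : nonempty_mesh u w -> lker_rel (arr u) (mesh_row u w).
Proof.
move=> uw; rewrite /lker_rel -[RHS](phi_mesh0 uw) [RHS]big_mkcond /=.
by apply: eq_bigr => l _; rewrite /mesh_row; case: ifP; rewrite ?mul0r.
Qed.

(** A relation sum_l p_l (u -> l) = 0 in L lifts to an element of I, whose
coordinates at the arrows u -> l are combinations of mesh rows modulo I. *)
Lemma ker_gen u (p : V -> L) : lker_rel (arr u) p ->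
  exists a : V -> L, forall l, e u l ->
    p l * idem l = \sum_(w | nonempty_mesh u w) a w * arr l w.
Proof.
move=> pK; have /(@choice _ _ _) [x xE] l := pres_surj phiP (p l).
pose y := \sum_l x l ⊙ ps u [:: l].
have Iy : mesh_ideal y.
  apply/(pres_ker phiP); rewrite linear_sum -[RHS]pK; apply: eq_bigr => l _.
  by rewrite phiM xE.
have [d yd] := ideal_lift_rel (fun=> 0) Iy.
have [b [d' [H _]]] := lift_rel_split yd u.
exists (fun w => phi (b w)) => l ul.
have := phi_ker (lift_rel_ideal (H l ul)); rewrite linearB => /subr0_eq.
have -> : rstrip B u l y = x l ⊙ ps l [::].
  rewrite linear_sum (bigD1 l) //= big1 ?addr0 => [|l' /negbTE ll'].
    by rewrite rstrip_arrow eqxx ul.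
  by rewrite rstrip_arrow ll'.
rewrite phiM xE => ->; rewrite linear_sum; apply: eq_bigr => w _.
by rewrite phiM.
Qed.

Lemma lker_relM (I : finType) (al p : I -> L) a :
  lker_rel al p -> lker_rel al (fun i => a * p i).
Proof.
rewrite /lker_rel => H; under eq_bigr => i _ do rewrite -mulrA.
by rewrite -mulr_sumr H mulr0.
Qed.

Lemma dual_basis_sum (I J : finType) (al : I -> L) (xi : (I -> L) -> L) :
  (forall p q, lker_rel al p -> lker_rel al q ->
    xi (fun i => p i + q i) = xi p + xi q) ->
  (forall a p, lker_rel al p -> xi (fun i => a * p i) = a * xi p) ->
  forall (P : pred J) (a : J -> L) (p : J -> I -> L),
    (forall j, P j -> lker_rel al (p j)) ->
  xi (fun i => \sum_(j | P j) a j * p j i) = \sum_(j | P j) a j * xi (p j).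
Proof.
move=> xiD xiM P a p pK.
have K0 : lker_rel al (fun=> 0) by rewrite /lker_rel big1 // => i _;
  rewrite mul0r.
have xi0 : xi (fun=> 0) = 0.
  have e0 : (fun i : I => (0 : L) * 0) = (fun=> 0) by apply/funext => i;
    rewrite mul0r.
  by have := xiM 0 _ K0; rewrite e0 mul0r.
have -> : (fun i => \sum_(j | P j) a j * p j i) =
    \big[(fun f g i => f i + g i)/(fun=> 0)]_(j | P j) (fun i => a j * p j i).
  by apply/funext => i; rewrite (big_morph
    (fun f : I -> L => f i) (id1 := 0) (op1 := +%R)).
suff [] : lker_rel al (
    \big[(fun f g i => f i + g i)/(fun=> 0)]_(j | P j) (fun i => a j * p j i))
  /\ xi (
    \big[(fun f g i => f i + g i)/(fun=> 0)]_(j | P j) (fun i => a j * p j i))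
   = \sum_(j | P j) a j * xi (p j) by [].
apply: (big_ind2 (fun f (s : L) => lker_rel al f /\ xi f = s)) => //.
- move=> f s g t [fK fs] [gK gt]; split; last by rewrite xiD // fs gt.
  rewrite /lker_rel; under eq_bigr => i _ do rewrite mulrDl.
  by rewrite big_split /= [X in X + _]fK [X in _ + X]gK addr0.
by move=> j Pj; split; [apply/lker_relM/pK|apply/xiM/pK].
Qed.

(** The mesh rows at u are independent. They generate a projective module, so
that they have an expression through a dual basis whose elements are again
combinations of mesh rows. This gives a matrix G with row w equal to sum_w'
G_ww' row w', and x G = 0 whenever sum_w x_w row w = 0. As the entries of the
rows are arrows, which are independent modulo J^2, G is the identity modulo J;
hence x = x (1 - G) lies in all powers of J. *)
Lemma mesh_exact u (x : V -> L) : syz_projective L ->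
  (forall l, e u l -> \sum_(w | nonempty_mesh u w) x w * arr l w = 0) ->
  forall w, nonempty_mesh u w -> x w * idem w = 0.
Proof.
move=> proj xK; have [T [Q [xi [QK xiD xiM piE]]]] := proj V (arr u).
have /(@choice _ _ _) [a aE] := fun t : T => ker_gen (QK t).
pose G w w' := \sum_t xi t (mesh_row u w) * a t w' * idem w'.
pose N w w' := idem w * ((if w == w' then idem w else 0) - G w w') * idem w'.
have GE w l : nonempty_mesh u w -> e u l ->
    arr l w = \sum_(w' | nonempty_mesh u w') G w w' * arr l w'.
  move=> uw ul; have := piE _ (mesh_row_ker uw) l; rewrite {1}/mesh_row ul.
  move/(congr1 (fun b => b * idem l)); rewrite arrr mulr_suml => {1}->.
  transitivity (\sum_t \sum_(w' | nonempty_mesh u w')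
      xi t (mesh_row u w) * a t w' * idem w' * arr l w').
    apply: eq_bigr => t _; rewrite -mulrA aE // mulr_sumr.
    by apply: eq_bigr => w' _; rewrite -!mulrA arrl.
  by rewrite exchange_big; apply: eq_bigr => w' _; rewrite /G mulr_suml.
have NE w l : nonempty_mesh u w -> e u l ->
    \sum_(w' | nonempty_mesh u w') N w w' * arr l w' = 0.
  move=> uw ul.
  transitivity (idem w * (arr l w
    - \sum_(w' | nonempty_mesh u w') G w w' * arr l w')).
    have {1}-> : arr l w = \sum_(w' | nonempty_mesh u w')
        (if w == w' then idem w else 0) * arr l w'.
      rewrite (bigD1 w) //= eqxx arrl big1 ?addr0 // => w' /andP[_ /negbTE ww'].
      by rewrite eq_sym ww' mul0r.
    rewrite -sumrB mulr_sumr; apply: eq_bigr => w' _.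
    by rewrite -mulrBl mulrA /N -(mulrA _ (idem w')) arrl.
  by rewrite -GE // subrr mulr0.
have Nrad w w' : nonempty_mesh u w -> nonempty_mesh u w' -> rad 1 (N w w').
  move=> uw uw'.
  have dec v : exists c, rad 1 (N w v - (if w == v then c *: idem w else 0)).
    exact: local_decomp.
  have off v : v != w -> rad 1 (N w v).
    by move=> /negbTE vw; have [c] := dec v; rewrite eq_sym vw subr0.
  have [<-|ne] := eqVneq w w'; last by apply: off; rewrite eq_sym.
  have [c] := dec w; rewrite eqxx => Nc.
  (* Compare degree 1 in an entry l -> w of row w that is an arrow. *)
  suff c0 : c = 0 by move: Nc; rewrite c0 scale0r subr0.
  case/andP: (uw) => _ /existsP[l /andP[ul lw]].
  apply: (arrow_notin_rad2 lw).
  have := NE w l uw ul; rewrite (bigD1 w) //= => /eqP.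
  rewrite addr_eq0 => /eqP Nw.
  have -> : c *: arr l w = N w w * arr l w - (N w w - c *: idem w) * arr l w.
    by rewrite mulrBl subKr -scalerAl arrl.
  rewrite {1}Nw -opprD; apply/radN/radD; last exact: radM Nc (arr_rad _ _).
  by apply: rad_sum => v /andP[_ vw]; apply: (radM (n := 1) (p := 1));
    [exact: off|exact: arr_rad].
pose y w := x w * idem w.
have yE w' : nonempty_mesh u w' ->
  y w' = \sum_(w | nonempty_mesh u w) y w * N w w'.
  move=> uw'.
  have yG : \sum_(w | nonempty_mesh u w) y w * G w w' = 0.
    transitivity (\sum_t (\sum_(w | nonempty_mesh u w) y w
      * xi t (mesh_row u w)) * a t w' * idem w').
      under eq_bigr => w _ do rewrite /G mulr_sumr.
      rewrite exchange_big; apply: eq_bigr => t _; rewrite !mulr_suml.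
      by apply: eq_bigr => w _; rewrite !mulrA.
    rewrite big1 // => t _; rewrite -(dual_basis_sum (xiD t) (xiM t));
      last first.
      by move=> w; exact: mesh_row_ker.
    have -> : (fun l => \sum_(w | nonempty_mesh u w) y w * mesh_row u w l) =
      (fun l => 0 * Q t l).
      apply/funext => l; rewrite mul0r /mesh_row.
      case: (boolP (e u l)) => ul; last by rewrite big1 // => w _;
        rewrite mulr0.
      by rewrite -[RHS](xK l ul); apply: eq_bigr => w _; rewrite /y -mulrA arrl.
    by rewrite xiM // !mul0r.
  transitivity (\sum_(w | nonempty_mesh u w) y w *
      ((if w == w' then idem w else 0) - G w w') * idem w').
    under eq_bigr => w _ do rewrite mulrBr mulrBl.
    rewrite sumrB -[X in _ - X]mulr_suml yG mul0r subr0 (bigD1 w') //= eqxx.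
    rewrite -!mulrA !idem_idem big1 ?addr0 // => w /andP[_ /negbTE ->].
    by rewrite /= ?mul0r mulr0 ?mul0r.
  apply: eq_bigr => w _; rewrite /N /y !mulrA.
  by rewrite -(mulrA (x w) (idem w) (idem w)) idem_idem.
have yrad n : forall w, nonempty_mesh u w -> rad n (y w).
  elim: n => [|n IH] w uw; first exact: radT.
  rewrite yE // -addn1; apply: rad_sum => w' uw'.
  by apply: radM; [exact: IH|exact: Nrad].
have [n nil] := rad_nilpotent.
by move=> w uw; exact/nil/yrad.
Qed.

(** Split (0, b) at the vertex u. The coefficients a_w of the mesh rows
satisfy sum_w phi(a_w) (l -> w) = 0 in L, hence lie in I by mesh_exact. They
have values r_w themselves; moving a_w (l -> w) to the other side leaves pairs
(0, d'_l) with b e_u = sum_l d'_l (u -> l). So b is in J, and by iteration in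
all powers of J. *)
Lemma lift_rel_uniq0 (c : V -> k) b : syz_projective L -> lift_rel c 0 b ->
  b = 0.
Proof.
move=> proj; have [n nil] := rad_nilpotent; move=> b0; apply: nil.
elim: n b b0 => [|n IH] b b0; first exact: radT.
rewrite -[b]mulr1 -sum_idem mulr_sumr; apply: rad_sum => u _.
have [a [d [H ->]]] := lift_rel_split b0 u.
have aK w : nonempty_mesh u w -> phi (a w) * idem w = 0.
  apply: (mesh_exact proj (x := fun w => phi (a w))) => l ul.
  have := phi_ker (lift_rel_ideal (H l ul)); rewrite linear0 sub0r linearN.
  move/eqP; rewrite oppr_eq0 linear_sum => /eqP E0; rewrite -[RHS]E0.
  by apply: eq_bigr => w' _; rewrite phiM.
have /(@choice _ _ _) [r rP] w : exists r, nonempty_mesh u w ->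
  lift_rel c (a w ⊙ ps w [::]) r.
  have [uw|_] := boolP (nonempty_mesh u w); last by exists 0.
  have /(ideal_lift_rel c)[r wr] : mesh_ideal (a w ⊙ ps w [::]).
    by apply/(pres_ker phiP); rewrite phiM aK.
  by exists r.
(* The values after the multiples of the meshes are moved into the coordinates. *)
pose d' l := d l + \sum_(w | nonempty_mesh u w) r w * arr l w.
have d'P l : e u l -> lift_rel c 0 (d' l).
  move=> ul; have -> : 0 =
    rstrip B u l 0 - \sum_(w | nonempty_mesh u w) a w ⊙ ps l [:: w]
      + \sum_(w | nonempty_mesh u w) a w ⊙ ps w [::] ⊙ ps l [:: w].
    rewrite linear0 sub0r [X in _
      + X](eq_bigr (fun w => a w ⊙ ps l [:: w])) ?addNr //.
    by move=> w _; rewrite -pmulA arrow_idl.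
  apply: lift_relD (H l ul) _; apply: lift_rel_sum => w uw.
  by apply: lift_relMr; exact: rP.
have -> : \sum_(w | nonempty_mesh u w) phi (a w) * mesh_val c u w
  + \sum_(l | e u l) d l * arr u l
   = \sum_(l | e u l) d' l * arr u l.
  rewrite big1 ?add0r => [|w uw]; last first.
    rewrite /mesh_val; case: (eqVneq u w) => [uw'|_]; last by rewrite mulr0.
    by rewrite -scalerAr aK // scaler0.
  rewrite /d'; under [RHS]eq_bigr => l _ do rewrite mulrDl.
  rewrite big_split -[LHS]addr0; congr (_ + _).
  under [RHS]eq_bigr => l _ do rewrite mulr_suml.
  rewrite exchange_big big1 //= => w uw.
  under eq_bigr => l _ do rewrite -mulrA.
  by rewrite -mulr_sumr phi_mesh0 // mulr0.
rewrite -addn1; apply: rad_sum => l ul.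
by apply: radM; [exact: IH (d'P l ul)|exact: arr_rad].
Qed.

Lemma lift_rel_uniq (c : V -> k) x a b : syz_projective L ->
  lift_rel c x a -> lift_rel c x b -> a = b.
Proof.
move=> proj xa xb; apply/eqP; rewrite -subr_eq0; apply/eqP.
apply: (lift_rel_uniq0 (c := c) proj); rewrite -(subrr x).
exact: lift_relD xa (lift_relN xb).
Qed.

Lemma phi_section : exists s : L -> B, linear s /\ forall a, phi (s a) = a.
Proof.
have /(@choice _ _ _) [t tE] a := pres_surj phiP a.
exists (fun a => \sum_j coord (vbasis {:L}) j a *: t (vbasis {:L})`_j); split.
  move=> d a b; rewrite scaler_sumr -big_split; apply: eq_bigr => j _.
  by rewrite linearP scalerDl scalerA.
move=> a; rewrite linear_sum [RHS](coord_vbasis (memvf a)).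
by apply: eq_bigr => j _; rewrite linearZ tE.
Qed.

(** The cocycles are h(s(a) s(b) - s(ab)), which measure by how much the
section s fails to be multiplicative; see the derivation D in the proof for
their independence. *)
Lemma HH2_mesh (T : {set V}) : syz_projective L ->
  (forall i, i \in T -> nonempty_mesh i i) -> (#|T| <= HH_dim 2 L)%N.
Proof.
move=> proj TP; have [s [s_lin sE]] := phi_section.
pose ind (i : 'I_#|T|) v : k := (v == enum_val i)%:R.
have /(@choice _ _ _) [h hP] (i : 'I_#|T|) : exists h : B -> L,
    forall x, mesh_ideal x -> lift_rel (ind i) x (h x).
  have /(@choice _ _ _) [h hP] x : exists a, mesh_ideal x ->
    lift_rel (ind i) x a.
    have [Ix|] := EM (mesh_ideal x); last by exists 0.
    by have [a xa] := ideal_lift_rel (ind i) Ix; exists a.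
  by exists h.
have hE i x a : lift_rel (ind i) x a -> h i x = a.
  by move=> xa; apply: lift_rel_uniq (hP i x (lift_rel_ideal xa)) xa.
pose dx a b := s a ⊙ s b - s (a * b).
have dxI a b : mesh_ideal (dx a b).
  by apply/(pres_ker phiP); rewrite linearB phiM !sE subrr.
have dxP i a b := hP i _ (dxI a b).
apply: (HH2_lower_bound (f := fun i a b => h i (dx a b))).
- move=> i; split=> [b|a] d a1 a2; apply: hE.
    have -> : dx (d *: a1 + a2) b = d *: dx a1 b + dx a2 b.
      rewrite /dx s_lin mulrDl -scalerAl s_lin pmulDl pmulZl opprD addrACA.
      by rewrite scalerBr.
    by apply: lift_relD => //; exact: lift_relZ.
  have -> : dx a (d *: a1 + a2) = d *: dx a a1 + dx a a2.
    rewrite /dx s_lin mulrDr -scalerAr s_lin pmulDr pmulZr opprD addrACA.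
    by rewrite scalerBr.
  by apply: lift_relD => //; exact: lift_relZ.
- move=> i a b c; apply: (lift_rel_uniq0 (c := ind i) proj).
  have -> : 0 = s a ⊙ dx b c - dx (a * b) c + dx a (b * c) - dx a b ⊙ s c.
    have subl x y z : (x - y) ⊙ z = x ⊙ z - y ⊙ z.
      by rewrite pmulDl -scaleN1r pmulZl scaleN1r.
    have subr x y z : z ⊙ (x - y) = z ⊙ x - z ⊙ y.
      by rewrite pmulDr -scaleN1r pmulZr scaleN1r.
    rewrite /dx subl subr pmulA mulrA.
    move: (s a ⊙ s b ⊙ s c) (s a ⊙ s (b * c)) (s (a * b) ⊙ s c) (s (a * b * c)).
    by move=> x y z t'; rewrite !opprB (addrAC (x - y)) !addrA !subrK subrr.
  have c1 := lift_relMl (s a) (dxP i b c); rewrite sE in c1.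
  have c2 := lift_relMr (s c) (dxP i a b); rewrite sE in c2.
  apply: lift_relD (lift_relN c2); apply: lift_relD => //.
  by apply: lift_relD c1 _; exact: lift_relN.
move=> la [g g_lin gE] i0.
have s0 : s 0 = 0 by have := scalable_of_linear s_lin 0 0; rewrite !scale0r.
have g0 : g 0 = 0 by have := scalable_of_linear g_lin 0 0; rewrite !scale0r.
have sD a b : s (a + b) = s a + s b by have := s_lin 1 a b; rewrite !scale1r.
have gD a b : g (a + b) = g a + g b by have := g_lin 1 a b; rewrite !scale1r.
pose hs x := \sum_i la i *: h i x.
have hsD x y : mesh_ideal x -> mesh_ideal y -> hs (x + y) = hs x + hs y.
  move=> Ix Iy; rewrite /hs -big_split /=; apply: eq_bigr => i _.
  by rewrite -scalerDr; congr (_ *: _); apply: hE; apply: lift_relD; exact: hP.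
have hsMl y x : mesh_ideal x -> hs (y ⊙ x) = phi y * hs x.
  move=> Ix; rewrite /hs mulr_sumr; apply: eq_bigr => i _.
  by rewrite -scalerAr; congr (_ *: _); apply: hE; apply: lift_relMl; exact: hP.
have hsMr x y : mesh_ideal x -> hs (x ⊙ y) = hs x * phi y.
  move=> Ix; rewrite /hs mulr_suml; apply: eq_bigr => i _.
  by rewrite -scalerAl; congr (_ *: _); apply: hE; apply: lift_relMr; exact: hP.
pose r x := x - s (phi x).
have rI x : mesh_ideal (r x) by apply/(pres_ker phiP); rewrite linearB sE subrr.
(* D is a derivation, and it agrees with hs on the ideal. *)
pose D x := hs (r x) + g (phi x).
have DD x y : D (x + y) = D x + D y.
  have -> : D (x + y) = hs (r x + r y) + g (phi x + phi y).
    by rewrite /D /r linearD sD opprD addrACA.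
  by rewrite hsD // gD addrACA.
have D0 : D 0 = 0 by apply: (addrI (D 0)); rewrite -DD !addr0.
have DM x y : D (x ⊙ y) = phi x * D y + D x * phi y.
  have rM : r (x ⊙ y) = x ⊙ r y + (r x ⊙ s (phi y) + dx (phi x) (phi y)).
    rewrite /r /dx phiM addrA addrA; congr (_ - _).
    rewrite pmulDr -[- s (phi y)]scaleN1r pmulZr scaleN1r.
    by rewrite pmulDl -[- s (phi x)]scaleN1r pmulZl scaleN1r !addrA !subrK.
  rewrite /D rM hsD; [|exact: mesh_idealMl|].
    rewrite hsD //; last exact: mesh_idealMr.
    rewrite hsMl // hsMr // sE phiM [hs (dx _ _)]gE.
    rewrite mulrDr mulrDl.
    have regroup (P Q R S U : L) : P + (Q + (R - U + S)) + U =
      (P + R) + (Q + S).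
      by rewrite (addrAC R) !addrA subrK (addrAC P).
    exact: regroup.
  by apply: mesh_idealD => //; exact: mesh_idealMr.
pose j := enum_val i0.
have jj : nonempty_mesh j j by apply: TP; exact: enum_valP.
have Im := mesh_ideal_gen jj.
have Dm : D (mesh_elt j j) = la i0 *: idem j.
  rewrite /D /r (phi_ker Im) s0 g0 subr0 addr0 /hs (bigD1 i0) //= big1.
    rewrite addr0; congr (_ *: _); apply: hE.
    by have := lift_rel_gen (c := ind i0) jj;
      rewrite /mesh_val /ind !eqxx scale1r.
  move=> i ii0; rewrite (_ : h i _ = 0) ?scaler0 //; apply: hE.
  have := lift_rel_gen (c := ind i) jj; rewrite /mesh_val /ind eqxx.
  by rewrite (inj_eq enum_val_inj) eq_sym (negbTE ii0) scale0r.
apply: (@idem_notin_rad (la i0) j); rewrite -Dm /mesh_elt.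
rewrite (big_morph D DD D0); apply: rad_sum => l _.
rewrite -path_seq_cons DM; apply: radD.
  exact/radMr/arr_rad.
exact/radMl/arr_rad.
Qed.

(** If no nonempty mesh ends at w, the elements of I that end at w are sums of
products (l -> w) y with y in I. *)
Lemma lstrip_ideal w x : (forall j, ~~ nonempty_mesh j w) -> mesh_ideal x ->
  forall l, mesh_ideal (lstrip B l w x).
Proof.
move=> now Ix; suff [] : mesh_ideal x /\ forall l,
  mesh_ideal (lstrip B l w x) by [].
apply: (Ix (fun x => mesh_ideal x /\ forall l, mesh_ideal (lstrip B l w x))).
- by split=> [|l]; rewrite ?linear0; exact: mesh_ideal0.
- move=> y z [Iy Hy] [Iz Hz]; split=> [|l]; first exact: mesh_idealD.
  by rewrite lstripD; exact: mesh_idealD.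
- move=> y {Ix}x z [Ix H]; split=> [|l]; first exact: mesh_idealM.
  have d1 : deg_ge 1 x by apply: (deg_geW (a := 2)) => //;
    exact: mesh_ideal_deg2.
  rewrite lstrip_mul; last first.
    by have := deg_geM (deg_geT y) d1.
  apply: mesh_idealMr; elim/pm_ind: y => [|y y' IH IH'|c v s vs].
  + by rewrite pmul0x linear0; exact: mesh_ideal0.
  + by rewrite pmulDl lstripD; exact: mesh_idealD.
  rewrite pmulZl lstripZ; apply: mesh_idealZ.
  case/lastP: s vs => [|s w'] vs.
    by rewrite lstrip_id; case: ifP => _; [exact: H|exact: mesh_ideal0].
  rewrite -path_seq_rcons -pmulA lstrip_arrow; case: ifP => _;
    last exact: mesh_ideal0.
  by do 2 apply: mesh_idealMl.
move=> j i ji; split=> [|l].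
  by move=> P P0 PD PM PG; exact: PG.
have [ne|emp] := boolP (nonempty_mesh j i); last first.
  suff -> : mesh_elt j i = 0 by rewrite linear0; exact: mesh_ideal0.
  rewrite /mesh_elt big_pred0 // => l'.
  move: emp; rewrite /nonempty_mesh asboolT // negb_exists => /forallP H.
  exact/negbTE/H.
suff -> : lstrip B l w (mesh_elt j i) = 0 by exact: mesh_ideal0.
rewrite /mesh_elt linear_sum big1 // => l' /andP[jl' l'i].
have := @lstrip_rcons _ _ _ B l w j [:: l'] i; rewrite /= jl' l'i => -> //.
case: eqP => //= iw; by move: (now j); rewrite -iw ne.
Qed.

Lemma arr0 l w : ~~ e l w -> arr l w = 0.
Proof. by move=> lw; rewrite /arr pseq_out ?linear0 //= (negbTE lw). Qed.

(** The arrows into w are then independent, as in B. *)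
Lemma arrows_into_free w (a : V -> L) : (forall j, ~~ nonempty_mesh j w) ->
  \sum_l arr l w * a l = 0 -> forall l, e l w -> idem l * a l = 0.
Proof.
move=> now H l lw; have /(@choice _ _ _) [x xE] l' := pres_surj phiP (a l').
have Iy : mesh_ideal (\sum_l' ps l' [:: w] ⊙ x l').
  apply/(pres_ker phiP); rewrite linear_sum -[RHS]H; apply: eq_bigr => l' _.
  by rewrite phiM xE.
have := phi_ker (lstrip_ideal now Iy l).
rewrite linear_sum (bigD1 l) //= big1 ?addr0 => [|l' /negbTE ll'].
  by rewrite lstrip_arrow !eqxx lw phiM xE.
by rewrite lstrip_arrow ll'.
Qed.

Lemma rad1_col w a : rad 1 a -> exists b : V -> L,
  idem w * a = \sum_l arr l w * b l.
Proof.
move=> [x dx <-]; exists (fun l => phi (lstrip B l w x)).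
rewrite -phiM lstrip_sum // linear_sum; apply: eq_bigr => l _.
exact: phiM.
Qed.

(** e_v L e_v is local: up to a scalar the element is e_v - t with t
nilpotent, and the inverse is the geometric series. *)
Lemma local_unit v a c : c != 0 -> rad 1 (idem v * a * idem v - c *: idem v) ->
  exists b, idem v * a * idem v * b = idem v.
Proof.
move=> c0 ra; have [n nil] := rad_nilpotent.
set x := idem v * a * idem v in ra *.
pose t := c^-1 *: (c *: idem v - x).
have tr p : rad p (t ^+ p).
  elim: p => [|p IH]; first exact: radT.
  rewrite exprS; apply: (radM (n := 1) (p := p)) => //; apply: radZ.
  by rewrite -opprB; exact: radN.
have tn := nil _ (tr n).
have xE : x = c *:
  (idem v - t) by rewrite /t scalerBr scalerA mulfV // scale1r subKr.
have vt : idem v * t = t.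
  by rewrite /t -scalerAr mulrBr -scalerAr idem_idem /x !mulrA idem_idem.
exists (c^-1 *: ((\sum_(i < n) t ^+ i) * idem v)).
rewrite xE -scalerAr -scalerAl scalerA mulVf // scale1r.
have -> : idem v - t = idem v * (1 - t) by rewrite mulrBr mulr1 vt.
rewrite -mulrA [(1 - t) * _]mulrA.
have -> : (1 - t) * (\sum_(i < n) t ^+ i) = 1.
  by rewrite -opprB mulNr -subrX1 tn sub0r opprK.
by rewrite mul1r idem_idem.
Qed.
End MeshQuotient.

(** * Modules over an algebra of finite representation type *)

Section ModuleTools.
Variables (k : fieldType) (A : falgType k).
Implicit Types M N P C : fdmod A.

Lemma is_hom_id M : is_hom (\1%VF : 'Hom(M, M)).
Proof. by move=> a v; rewrite !id_lfunE. Qed.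

Lemma is_hom0 M N : is_hom (0 : 'Hom(M, N)).
Proof. by move=> a v; rewrite !zero_lfunE mact0r. Qed.

Lemma is_homD M N (f g : 'Hom(M, N)) : is_hom f -> is_hom g -> is_hom (f + g).
Proof. by move=> fM gM a v; rewrite !add_lfunE fM gM mactDr. Qed.

Lemma is_hom_sum M N (I : finType) (f : I -> 'Hom(M, N)) :
  (forall i, is_hom (f i)) -> is_hom (\sum_i f i).
Proof.
move=> fM; apply: (big_ind (@is_hom _ _ M N)) => // [|f1 f2];
  first exact: is_hom0.
exact: is_homD.
Qed.

Lemma limg_submod M N (f : 'Hom(M, N)) : is_hom f -> is_submod (limg f).
Proof.
move=> fM a _ /memv_imgP[v _ ->]; rewrite -fM; exact/memv_img/memvf.
Qed.

Lemma limgP M N (f : 'Hom(M, N)) : limg f = fullv ->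
  forall y, exists x, f x = y.
Proof.
move=> fs y; have /memv_imgP[x _ ->] : y \in limg f by rewrite fs memvf.
by exists x.
Qed.

Lemma limg_surj M N (f : 'Hom(M, N)) : (forall y, exists x, f x = y) ->
  limg f = fullv.
Proof.
move=> fs; apply/eqP; rewrite eqEsubv subvf; apply/subvP => y _.
by have [x <-] := fs y; exact/memv_img/memvf.
Qed.

Lemma hom_factor M N P (q : 'Hom(M, N)) (f : 'Hom(M, P)) :
  is_hom q -> is_hom f -> limg q = fullv -> (lker q <= lker f)%VS ->
  is_hom (f \o q^-1)%VF /\ (f \o q^-1 \o q)%VF = f.
Proof.
move=> qM fM qs qf.
have E v : (f \o q^-1)%VF (q v) = f v.
  rewrite comp_lfunE; apply/eqP; rewrite -subr_eq0 -linearB -memv_ker.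
  apply: (subvP qf); rewrite memv_ker linearB subr_eq0; apply/eqP.
  by apply: limg_lfunVK; rewrite qs memvf.
split; last by apply/lfunP => v; rewrite comp_lfunE E.
move=> a w; have [v <-] := limgP qs w.
by rewrite -qM !E fM.
Qed.

Lemma hom_inv M N (f : 'Hom(M, N)) : is_hom f -> lker f = 0%VS ->
  limg f = fullv ->
  [/\ is_hom (f^-1)%VF, (f \o f^-1)%VF = \1%VF & (f^-1 \o f)%VF = \1%VF].
Proof.
move=> fM f0 fs; have [|h1 h2] := hom_factor fM (@is_hom_id M) fs.
  by rewrite f0 sub0v.
rewrite comp_lfun1l in h1 h2; split => //.
by apply/lfunP => v; rewrite comp_lfunE id_lfunE limg_lfunVK // fs memvf.
Qed.

Section Quotient.
Variables (N : fdmod A) (U : {vspace N}) (sU : is_submod U).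
Let W : {vspace N} := (U^C)%VS.
Let pr : 'End(N) := daddv_pi W U.

Lemma quot_capv : (W :&: U = 0)%VS.
Proof. by rewrite capvC capv_compl. Qed.

Lemma quot_pr_mem v : pr v \in W. Proof. exact: memv_pi. Qed.

Lemma quot_pr_sub v : v - pr v \in U.
Proof.
have vWU : v \in (W + U)%VS by rewrite addvC addv_complf memvf.
have := daddv_pi_add quot_capv vWU; rewrite -/pr => {1}<-.
by rewrite addrC addKr memv_pi.
Qed.

Lemma quot_pr_ker v : v \in U -> pr v = 0.
Proof.
move=> vU; have : pr v \in (W :&: U)%VS.
  by rewrite memv_cap quot_pr_mem -[pr v](subKr v) rpredB ?quot_pr_sub.
by rewrite quot_capv memv0 => /eqP.
Qed.

Lemma quot_pr_id v : v \in W -> pr v = v.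
Proof. by move=> vW; rewrite /pr daddv_pi_id // quot_capv. Qed.

Definition quot_act (a : A) (w : subvs_of W) : subvs_of W :=
  Subvs (quot_pr_mem (mact a (vsval w))).

Fact quot_act_linl w : linear (quot_act^~ w).
Proof. by move=> c x y; apply: val_inj; rewrite /= mact_linl linearP. Qed.

Fact quot_act_linr a : linear (quot_act a).
Proof. by move=> c x y; apply: val_inj; rewrite /= linearP linearP. Qed.

Fact quot_act1 w : quot_act 1 w = w.
Proof. by apply: val_inj; rewrite /= mact1 quot_pr_id ?subvsP. Qed.

Lemma quot_pr_act a v : pr (mact a (pr v)) = pr (mact a v).
Proof.
have vE : v = pr v + (v - pr v) by rewrite addrC subrK.
have k0 : pr (mact a (v - pr v)) = 0.
  by apply: quot_pr_ker; apply: sU; exact: quot_pr_sub.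
by rewrite [in RHS]vE mactDr linearD [X in _ = _ + X]k0 addr0.
Qed.

Fact quot_actM a b w : quot_act (a * b) w = quot_act a (quot_act b w).
Proof. by apply: val_inj; rewrite /= quot_pr_act mactM. Qed.

(** The quotient by U, carried by a linear complement of U. *)
Definition quot_mod : fdmod A := @FdMod k A (subvs_of W) quot_act
  quot_act_linl quot_act_linr quot_act1 quot_actM.

Lemma coker_exists : exists (C : fdmod A) (q : 'Hom(N, C)),
  [/\ is_hom q, limg q = fullv & lker q = U].
Proof.
have qlin : linear (fun v => Subvs (quot_pr_mem v) : quot_mod).
  by move=> c x y; apply: val_inj; rewrite /= linearP.
have [q qE] := linfun_exists qlin.
exists quot_mod, q; split.
- by move=> a v; rewrite !qE; apply: val_inj; rewrite /= quot_pr_act.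
- apply: limg_surj => w; exists (vsval w); rewrite qE; apply: val_inj.
  by rewrite /= quot_pr_id ?subvsP.
apply/vspaceP => v; rewrite memv_ker qE -(inj_eq val_inj) /=.
apply/eqP/idP => [pv|]; last exact: quot_pr_ker.
by have := quot_pr_sub v; rewrite pv subr0.
Qed.
End Quotient.

Section Power.
Variables (M : fdmod A) (I : finType).
Implicit Type x : {ffun I -> M}.

Definition pow_act (a : A) x : {ffun I -> M} := [ffun i => mact a (x i)].

Fact pow_act_linl x : linear (pow_act^~ x).
Proof. by move=> c a b; apply/ffunP=> i; rewrite !ffunE mact_linl. Qed.

Fact pow_act_linr a : linear (pow_act a).
Proof. by move=> c x y; apply/ffunP=> i; rewrite !ffunE linearP. Qed.

Fact pow_act1 x : pow_act 1 x = x.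
Proof. by apply/ffunP=> i; rewrite ffunE mact1. Qed.

Fact pow_actM a b x : pow_act (a * b) x = pow_act a (pow_act b x).
Proof. by apply/ffunP=> i; rewrite !ffunE mactM. Qed.

Definition pow_mod : fdmod A := @FdMod k A {ffun I -> M} pow_act
  pow_act_linl pow_act_linr pow_act1 pow_actM.
End Power.

(** C is a direct summand of a finite power of M. *)
Definition in_add M C : Prop :=
  exists (T : finType) (i : T -> 'Hom(C, M)) (r : T -> 'Hom(M, C)),
  [/\ forall t, is_hom (i t), forall t, is_hom (r t)
    & \sum_t (r t \o i t)%VF = \1%VF].

Lemma in_add_sum M (C1 C2 C : fdmod A) (i1 : 'Hom(C1, C)) (p1 : 'Hom(C, C1))
    (i2 : 'Hom(C2, C)) (p2 : 'Hom(C, C2)) :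
  is_hom i1 -> is_hom p1 -> is_hom i2 -> is_hom p2 ->
  ((i1 \o p1) + (i2 \o p2))%VF = \1%VF -> in_add M C1 -> in_add M C2 ->
    in_add M C.
Proof.
move=> i1M p1M i2M p2M E [T1 [j1 [r1 [j1M r1M E1]]]]
  [T2   [j2 [r2 [j2M r2M E2]]]].
exists (T1 + T2)%type,
  (fun t => match t with inl t => j1 t \o p1 | inr t => j2 t \o p2 end)%VF,
  (fun t => match t with inl t => i1 \o r1 t | inr t => i2 \o r2 t end)%VF;
    split.
- by case=> t; exact: is_hom_comp.
- by case=> t; exact: is_hom_comp.
rewrite big_sumType /= -E; congr (_ + _).
  rewrite -[in RHS](comp_lfun1l p1) -E1; apply/lfunP => v.
  rewrite sum_lfunE !comp_lfunE sum_lfunE linear_sum; apply: eq_bigr => t _.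
  by rewrite !comp_lfunE.
rewrite -[in RHS](comp_lfun1l p2) -E2; apply/lfunP => v.
rewrite sum_lfunE !comp_lfunE sum_lfunE linear_sum; apply: eq_bigr => t _.
by rewrite !comp_lfunE.
Qed.

Lemma submod_proj C (U V : {vspace C}) (sU : is_submod U) (sV : is_submod V) :
  (U + V)%VS = fullv -> (U :&: V)%VS = 0%VS ->
  exists p : 'Hom(C, submod sU), is_hom p /\ forall v,
    vsval (p v) = daddv_pi U V v.
Proof.
move=> UV dUV.
have plin : linear (fun v => Subvs (memv_pi U V v) : submod sU).
  by move=> c x y; apply: val_inj; rewrite /= linearP.
have [p pE] := linfun_exists plin.
have pE' v : vsval (p v) = daddv_pi U V v by rewrite pE.
exists p; split=> // a v; apply: val_inj.
transitivity (mact a (vsval (p v) : C)); last by [].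
rewrite pE' [val _]pE'.
have vE : v = daddv_pi U V v + daddv_pi V U v.
  by rewrite daddv_pi_add // UV memvf.
have dVU : (V :&: U = 0)%VS by rewrite capvC.
have aU : daddv_pi U V (mact a (daddv_pi U V v)) = mact a (daddv_pi U V v).
  by apply: daddv_pi_id => //; apply: (sU a); exact: memv_pi.
have aV : daddv_pi U V (mact a (daddv_pi V U v)) = 0.
  set w := mact a _.
  have wV : w \in V by apply: (sV a); exact: memv_pi.
  have := daddv_pi_add dUV (w := w); rewrite UV memvf => /(_ isT).
  by rewrite (daddv_pi_id dVU) // => /(canRL (addrK _)); rewrite subrr.
by rewrite {1}vE mactDr linearD [X in X + _]aU [X in _ + X]aV addr0.
Qed.

(** By induction on the dimension, C is a direct sum of indecomposables. *)
Lemma in_addP M (m : nat) (X : 'I_m -> fdmod A) :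
  (forall N : fdmod A, indecomposable N -> exists i, mod_iso N (X i)) ->
  is_direct_sum X M -> forall C, in_add M C.
Proof.
move=> Xind [inj [prj [injM prjM pi1 pi0 E]]] C.
have [n] := ubnP (\dim {:C}); elim: n C => // n IH C dC.
have [C0|C0] := eqVneq {:C}%VS 0%VS.
  exists void, (fun=> 0), (fun=> 0); split=> [[]|[]|].
  rewrite big_pred0 => [|[]]; apply/lfunP => v.
  have : v \in {:C}%VS by exact: memvf.
  by rewrite C0 memv0 => /eqP ->; rewrite !linear0.
have [iC|nC] := EM (indecomposable C).
  have [j [f [fM f0 fs]]] := Xind C iC.
  have [gM fg gf] := hom_inv fM f0 fs.
  exists unit, (fun=> inj j \o f)%VF, (fun=> f^-1 \o prj j)%VF; split.
  - by move=> _; exact: is_hom_comp.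
  - by move=> _; exact: is_hom_comp.
  rewrite big_const card_unit /= addr0 comp_lfunA -(comp_lfunA _ (prj j)) pi1.
  by rewrite comp_lfun1r.
have [U [V [sU sV UV dUV [U0 V0]]]] : exists U V : {vspace C},
    [/\ is_submod U, is_submod V, (U + V)%VS = fullv, (U :&: V)%VS = 0%VS
      & U != 0%VS /\ V != 0%VS].
  apply: contrapT => H; apply: nC; split.
    exists (vpick {:C}%VS); by rewrite vpick0.
  move=> U V sU sV UV dUV; have [->|U0] := eqVneq U 0%VS; first by left.
  by have [->|V0] := eqVneq V 0%VS; [right|case: H; exists U, V].
have dimUV : \dim {:C} = (\dim U + \dim V)%N by rewrite -UV dimv_disjoint_sum.
have dU : (0 < \dim U)%N by rewrite lt0n dimv_eq0.
have dV : (0 < \dim V)%N by rewrite lt0n dimv_eq0.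
have dsub (S : {vspace C}) (sS : is_submod S) : \dim {:submod sS} = \dim S.
  by rewrite dimvf.
have [p1 [p1M p1E]] := submod_proj sU sV UV dUV.
have [p2 [p2M p2E]] : exists p : 'Hom(C, submod sV), is_hom p /\
    forall v, vsval (p v) = daddv_pi V U v.
  by apply: submod_proj; rewrite 1?addvC 1?capvC.
have incl (S : {vspace C}) (sS : is_submod S) : exists2 i : 'Hom(submod sS, C),
    is_hom i & forall v, i v = vsval v.
  have vlin : linear (fun v : submod sS => vsval v : C) by move=> c x y;
    rewrite linearP.
  by have [i iE] := linfun_exists vlin; exists i => // a v; rewrite !iE.
have [i1 i1M i1E] := incl U sU; have [i2 i2M i2E] := incl V sV.
apply: (in_add_sum i1M p1M i2M p2M).
- apply/lfunP => v; rewrite add_lfunE !comp_lfunE i1E i2E p1E p2E id_lfunE.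
  by rewrite daddv_pi_add // UV memvf.
- apply: IH; rewrite dsub; rewrite ltnS in dC; apply: leq_trans dC;
    rewrite dimUV.
  by rewrite -addn1 leq_add2l.
- apply: IH; rewrite dsub; rewrite ltnS in dC; apply: leq_trans dC;
    rewrite dimUV.
  by rewrite -add1n leq_add2r.
Qed.
End ModuleTools.

(** * The Auslander algebra has global dimension at most 2 *)

Section EndAlgebra.
Variables (k : fieldType) (A : falgType k) (M : fdmod A) (L : falgType k).
Implicit Types (a b : L) (C : fdmod A).

Record end_pres (psi : 'Hom(L, 'Hom(M, M))) : Prop := EndPres {
  end_ker : lker psi = 0%VS;
  end_img : limg psi = homs M M;
  end_one : psi 1 = \1%VF;
  end_mul : forall a b, psi (a * b) = (psi a \o psi b)%VF
}.

Variable psi : 'Hom(L, 'Hom(M, M)).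
Hypothesis psiP : end_pres psi.

Lemma end_hom a : is_hom (psi a).
Proof. by apply/homsP; rewrite -(end_img psiP) memv_img ?memvf. Qed.

Lemma end_invK (f : 'Hom(M, M)) : is_hom f -> psi ((psi^-1)%VF f) = f.
Proof. by move/homsP => fM; apply: limg_lfunVK; rewrite (end_img psiP). Qed.

Lemma end_inj : injective psi.
Proof.
move=> a b ab; apply/eqP; rewrite -subr_eq0 -memv0 -(end_ker psiP) memv_ker.
by rewrite linearB /= ab subrr.
Qed.

Section SyzygyProjective.
Variables (I : finType) (al : I -> L).

Definition tuple_fun (v : M) : pow_mod M I := [ffun i => psi (al i) v].

Definition row_fun (p : I -> L) (x : pow_mod M I) : M := \sum_i psi (p i) (x i).

Lemma tuple_fun_linear : linear tuple_fun.
Proof. by move=> c x y; apply/ffunP => i; rewrite !ffunE linearP. Qed.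

Lemma row_fun_linear p : linear (row_fun p).
Proof.
move=> c x y; rewrite /row_fun scaler_sumr -big_split /=; apply: eq_bigr => i _.
by rewrite !ffunE linearP.
Qed.

Definition in_fun (i : I) (v : M) : pow_mod M I :=
  [ffun j => if j == i then v else 0].

Lemma in_fun_linear i : linear (in_fun i).
Proof.
move=> c x y; apply/ffunP => j; rewrite !ffunE; case: eqP => // _.
by rewrite scaler0 addr0.
Qed.
End SyzygyProjective.

(** A tuple alpha in L^I is a map F from M to M^I, and p in L^I is in the
kernel if and only if the map M^I -> M that it defines factors through the
cokernel C of F. A decomposition of the identity of C through copies of M is
then a dual basis of the kernel. *)
Lemma end_syz_projective : (forall C, in_add M C) -> syz_projective L.
Proof.
move=> addM I al.
have [F FE] := linfun_exists (tuple_fun_linear al).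
have FM : is_hom F.
  by move=> a v; rewrite !FE; apply/ffunP => i; rewrite !ffunE end_hom.
have [R RE] := choice (fun p => linfun_exists (row_fun_linear (I := I) p)).
have RM p : is_hom (R p).
  move=> a x; rewrite !RE /row_fun linear_sum; apply: eq_bigr => i _.
  by rewrite ffunE end_hom.
have [J JE] := choice (fun i : I => linfun_exists (in_fun_linear i)).
have JM i : is_hom (J i).
  move=> a v; rewrite !JE; apply/ffunP => j; rewrite !ffunE.
  by case: eqP => // _; rewrite mact0r.
have RJ p i : (R p \o J i)%VF = psi (p i).
  apply/lfunP => v; rewrite comp_lfunE RE JE /row_fun (bigD1 i) //= big1.
    by rewrite ffunE eqxx addr0.
  by move=> j /negbTE ji; rewrite ffunE ji linear0.
have FJ : F = (\sum_i (J i \o psi (al i)))%VF.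
  apply/lfunP => v; rewrite sum_lfunE FE; apply/ffunP => i;
    rewrite ffunE sum_ffunE.
  rewrite (bigD1 i) //= big1 => [|j /negbTE ji].
    by rewrite comp_lfunE JE ffunE eqxx addr0.
  by rewrite comp_lfunE JE ffunE eq_sym ji.
have [C [q [qM qs qk]]] := coker_exists (limg_submod FM).
have [T [i [r [iM rM ri]]]] := addM C.
pose p' p := (R p \o q^-1)%VF.
have p'P p : lker_rel al p -> is_hom (p' p) /\ (p' p \o q)%VF = R p.
  move=> pK; apply: hom_factor => //; rewrite qk;
    apply/subvP => _ /memv_imgP[v _ ->].
  rewrite memv_ker RE /row_fun FE.
  under eq_bigr => j _ do rewrite ffunE -comp_lfunE -(end_mul psiP).
  by rewrite -sum_lfunE -linear_sum pK linear0 zero_lfunE.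
have qF : (q \o F)%VF = 0.
  apply/lfunP => v; rewrite comp_lfunE zero_lfunE; apply/eqP.
  by rewrite -memv_ker qk memv_img ?memvf.
pose Q t j := (psi^-1)%VF (i t \o q \o J j)%VF.
pose xi t p := (psi^-1)%VF (p' p \o r t)%VF.
have QE t j : psi (Q t j) = (i t \o q \o J j)%VF.
  by apply: end_invK; apply: is_hom_comp => //; exact: is_hom_comp.
have xiE t p : lker_rel al p -> psi (xi t p) = (p' p \o r t)%VF.
  by case/p'P => pM _; apply: end_invK; exact: is_hom_comp.
exists T, Q, xi; split.
- move=> t; apply: end_inj; rewrite linear0 linear_sum.
  transitivity ((i t \o q) \o F)%VF; last by rewrite -comp_lfunA qF comp_lfun0r.
  rewrite FJ; apply/lfunP => v; rewrite comp_lfunE !sum_lfunE linear_sum.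
  apply: eq_bigr => j _.
  have e : psi (Q t j * al j) v = (i t \o q)%VF ((J j \o psi (al j))%VF v).
    by rewrite (end_mul psiP) QE !comp_lfunE.
  exact: e.
- move=> t p p2 _ _; rewrite /xi -linearD; congr ((psi^-1)%VF _).
  apply/lfunP => v; rewrite add_lfunE !comp_lfunE !RE /row_fun -big_split.
  by apply: eq_bigr => j _; rewrite linearD add_lfunE.
- move=> t a p pK; apply: end_inj; rewrite (end_mul psiP) !xiE //;
  last exact: lker_relM.
  apply/lfunP => v; rewrite !comp_lfunE !RE /row_fun linear_sum.
  by apply: eq_bigr => j _; rewrite (end_mul psiP) comp_lfunE.
move=> p pK j; apply: end_inj; rewrite linear_sum.
transitivity ((p' p \o ((\sum_t (r t \o i t)%VF) \o q)) \o J j)%VF.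
  by rewrite ri comp_lfun1l (p'P p pK).2 RJ.
apply/lfunP => v; rewrite !comp_lfunE !sum_lfunE -[R p _]comp_lfunE linear_sum.
apply: eq_bigr => t _.
have e : p' p ((r t \o i t)%VF (q (J j v))) = psi (xi t p * Q t j) v.
  by rewrite (end_mul psiP) xiE // QE !comp_lfunE.
exact: e.
Qed.
End EndAlgebra.

(** * Nonprojective modules and nonempty meshes *)

Lemma fun_choice (T U : Type) (P : T -> U -> Prop) :
  (forall x, exists y, P x y) -> exists f, forall x, P x (f x).
Proof. by move/choice => [f fP]; exists f. Qed.

Section ProjectiveTools.
Variables (k : fieldType) (A : falgType k).
Implicit Types M N P Q : fdmod A.

Lemma projective_retract P Q (i : 'Hom(Q, P)) (p : 'Hom(P, Q)) :
  is_hom i -> is_hom p -> (p \o i)%VF = \1%VF -> projective P -> projective Q.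
Proof.
move=> iM pM pi Pproj M N g f gM gs fM.
have [h hM E] := Pproj M N g (f \o p)%VF gM gs (is_hom_comp fM pM).
exists (h \o i)%VF; first exact: is_hom_comp.
by rewrite comp_lfunA E -comp_lfunA pi comp_lfun1r.
Qed.

Lemma free_projective n : projective (free_mod A n).
Proof.
move=> M N g f gM gs fM.
pose d i : free_mod A n := [ffun j => if j == i then 1 else 0].
have [m mE] := choice (fun i : 'I_n => limgP gs (f (d i))).
have hlin : linear (fun x : free_mod A n => \sum_i mact (x i) (m i)).
  move=> c x y; rewrite scaler_sumr -big_split; apply: eq_bigr => i _.
  by rewrite !ffunE mactDl mactZl.
have [h hE] := linfun_exists hlin.
have hM : is_hom h.
  move=> a x; rewrite !hE linear_sum; apply: eq_bigr => i _.
  by rewrite ffunE mactM.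
exists h => //; apply/lfunP => x; rewrite comp_lfunE hE linear_sum.
have {2}-> : x = \sum_i mact (x i) (d i).
  apply/ffunP => j; rewrite sum_ffunE (bigD1 j) //= big1 => [|i /negbTE ij].
    by rewrite !ffunE eqxx mulr1 addr0.
  by rewrite !ffunE eq_sym ij mulr0.
rewrite linear_sum; apply: eq_bigr => i _.
have e : g (mact (x i) (m i)) = f (mact (x i) (d i)) by rewrite gM fM mE.
exact: e.
Qed.

Lemma retract_indecomposable M N (f : 'Hom(N, M)) (g : 'Hom(M, N)) :
  is_hom f -> is_hom g -> (g \o f)%VF = \1%VF -> (exists y : N, y != 0) ->
  indecomposable M -> (f \o g)%VF = \1%VF.
Proof.
move=> fM gM gf [y y0] [_ indM].
have gfE v : g (f v) = v by rewrite -comp_lfunE gf id_lfunE.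
have [||f0|g0] := indM (limg f) (lker g) (limg_submod fM) (ker_submod gM).
- apply/eqP; rewrite eqEsubv subvf; apply/subvP => v _.
  rewrite -[v](subrK (f (g v))) addrC; apply: memv_add.
    exact/memv_img/memvf.
  by rewrite memv_ker linearB /= gfE subrr.
- apply/eqP; rewrite -subv0; apply/subvP => v; rewrite memv_cap => /andP[].
  case/memv_imgP => u _ ->; rewrite memv_ker gfE => /eqP ->.
  by rewrite linear0 mem0v.
- have : f y \in limg f by exact/memv_img/memvf.
  rewrite f0 memv0 => /eqP fy; case/eqP: y0.
  by rewrite -(gfE y) fy linear0.
apply/lfunP => v; rewrite comp_lfunE id_lfunE; apply/eqP; rewrite -subr_eq0.
by rewrite -memv0 -g0 memv_ker linearB /= gfE subrr.
Qed.

Lemma idem_split M (f : 'Hom(M, M)) : is_hom f -> (f \o f)%VF = f ->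
  exists (Y : fdmod A) (io : 'Hom(Y, M)) (rh : 'Hom(M, Y)),
    [/\ is_hom io, is_hom rh, (rh \o io)%VF = \1%VF & (io \o rh)%VF = f].
Proof.
move=> fM ff; pose Y := submod (limg_submod fM).
have fmem v : f v \in limg f by exact/memv_img/memvf.
have rlin : linear (fun v => Subvs (fmem v) : Y).
  by move=> c x y; apply: val_inj; rewrite /= linearP.
have ilin : linear (fun v : Y => vsval v : M) by move=> c x y; rewrite linearP.
have [rh rE] := linfun_exists rlin; have [io iE] := linfun_exists ilin.
exists Y, io, rh; split.
- by move=> a v; rewrite !iE.
- by move=> a v; rewrite !rE; apply: val_inj; rewrite /= fM.
- apply/lfunP => v; rewrite comp_lfunE rE id_lfunE; apply: val_inj;
  rewrite /= iE.
  have /memv_imgP[u _ ->] := subvsP v.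
  by rewrite -[in RHS]ff comp_lfunE.
by apply/lfunP => v; rewrite comp_lfunE iE rE.
Qed.
End ProjectiveTools.

Section Projectives.
Variables (k : fieldType) (m : nat) (e : rel 'I_m) (B : path_model k e).
Variables (L : falgType k) (mrel : 'I_m -> 'I_m -> Prop) (phi :
  {linear B -> L}).
Hypothesis phiP : mesh_pres mrel phi.
Variables (A : falgType k) (M : fdmod A) (psi : 'Hom(L, 'Hom(M, M))).
Hypothesis psiP : end_pres psi.
Local Notation idem := (idem phi).
Local Notation arr := (arr phi).
Local Notation rad := (rad phi).

Section Vertex.
Variables (v : 'I_m) (Y : fdmod A) (io : 'Hom(Y, M)) (rh : 'Hom(M, Y)).
Hypotheses (ioM : is_hom io) (rhM : is_hom rh).
Hypotheses (rhio : (rh \o io)%VF = \1%VF) (iorh : (io \o rh)%VF = psi (idem v)).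

Lemma psi_idem_io y : psi (idem v) (io y) = io y.
Proof. by rewrite -iorh comp_lfunE -[rh (io y)]comp_lfunE rhio id_lfunE. Qed.

Lemma rh_psi_idem x : rh (psi (idem v) x) = rh x.
Proof. by rewrite -iorh comp_lfunE -[rh (io _)]comp_lfunE rhio id_lfunE. Qed.

Lemma psi_mul a b x : psi (a * b) x = psi a (psi b x).
Proof. by rewrite (end_mul psiP) comp_lfunE. Qed.

(** Suppose that Y, the image of e_v, is not projective, so that its free
cover g : F -> Y does not split. Since e_v L e_v is local, the maps M -> F ->
Y all lie in J, so that g factors through the arrows into v as g = sum_l (l ->
v) G_l. These arrows being independent, the kernel of g is contained in that
of each G_l, and the G_l factor through g. This writes e_v as a combination of
arrows, which is absurd because e_v is not in J. *)
Lemma proj_of_no_mesh : (forall C, in_add M C) ->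
  (forall j, ~~ nonempty_mesh e mrel j v) -> projective Y.
Proof.
move=> addM now; apply: contrapT => nproj.
pose g := free_map Y; have gM : is_hom g by exact: free_map_hom.
have gs : limg g = fullv by exact: limg_free_map.
have nsplit (s : 'Hom(Y, free_cover Y)) : is_hom s -> (g \o s)%VF = \1%VF ->
  False.
  move=> sM gs1; apply: nproj.
  exact: (projective_retract sM gM gs1 (@free_projective _ _ _)).
have [T [i [r [iM rM ri]]]] := addM (free_cover Y).
have riE x : \sum_t r t (i t x) = x.
  rewrite -[RHS](id_lfunE) -ri sum_lfunE; apply: eq_bigr => t _.
  by rewrite comp_lfunE.
have [y yE] : exists y : T -> L, forall t, psi (y t) = (io \o (g \o r t))%VF.
  suff /fun_choice : forall t, exists y, psi y = (io \o (g \o r t))%VF by [].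
  move=> t; exists ((psi^-1)%VF (io \o (g \o r t))%VF); apply: (end_invK psiP).
  exact: is_hom_comp ioM (is_hom_comp gM (rM t)).
have yv t : idem v * y t = y t.
  apply: (end_inj psiP); apply/lfunP => x; rewrite psi_mul yE !comp_lfunE.
  exact: psi_idem_io.
have yrad t : rad 1 (y t).
  rewrite -[y t]mulr1 -(sum_idem phiP) mulr_sumr; apply: rad_sum => u _.
  have [c] := local_decomp phiP v u (y t); rewrite yv.
  case: (eqVneq v u) => [<-|_]; last by rewrite subr0.
  have [->|c0] := eqVneq c 0; first by rewrite scale0r subr0.
  rewrite -{1}(yv t) => /(local_unit phiP c0) [z]; rewrite yv => zE.
  case: (nsplit (r t \o (psi (idem v * z) \o io))%VF).
    exact: is_hom_comp (rM t) (is_hom_comp (end_hom psiP _) ioM).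
  apply/lfunP => w; rewrite !comp_lfunE id_lfunE.
  have e1 x : g (r t x) = rh (psi (y t) x).
    by rewrite yE !comp_lfunE -[rh (io _)]comp_lfunE rhio id_lfunE.
  by rewrite e1 -psi_mul mulrA zE rh_psi_idem -comp_lfunE rhio id_lfunE.
have [b bE] := fun_choice (fun t => rad1_col phiP v (yrad t)).
pose G l : 'Hom(free_cover Y, M) := (\sum_t (psi (idem l * b t l) \o i t))%VF.
have GE l x : G l x = \sum_t psi (idem l * b t l) (i t x).
  by rewrite sum_lfunE; apply: eq_bigr => t _; rewrite comp_lfunE.
have GM l : is_hom (G l).
  by apply: is_hom_sum => t; exact: is_hom_comp (end_hom psiP _) (iM t).
have idG l x : psi (idem l) (G l x) = G l x.
  rewrite !GE linear_sum; apply: eq_bigr => t _.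
  have e1 z : psi (idem l) (psi (idem l * b t l) z) = psi (idem l * b t l) z.
    by rewrite -psi_mul mulrA (idem_idem phiP).
  exact: e1.
have arrG x : \sum_l psi (arr l v) (G l x) = io (g x).
  transitivity (\sum_t io (g (r t (i t x)))); last first.
    by rewrite -[in RHS](riE x) !linear_sum.
  transitivity (\sum_t \sum_l psi (arr l v * b t l) (i t x)).
    rewrite exchange_big; apply: eq_bigr => l _; rewrite GE linear_sum.
    apply: eq_bigr => t _.
    have e1 z : psi (arr l v) (psi (idem l * b t l) z) =
      psi (arr l v * b t l) z.
      by rewrite -psi_mul mulrA (arrr phiP).
    exact: e1.
  apply: eq_bigr => t _.
  have -> : io (g (r t (i t x))) = psi (y t) (i t x) by rewrite yE !comp_lfunE.
  by rewrite -yv bE linear_sum sum_lfunE.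
have kerG l : e l v -> (lker g <= lker (G l))%VS.
  move=> lv; apply/subvP => x xg.
  pose N := submod (ker_submod gM);
    pose inc : 'Hom(N, free_cover Y) := ker_incl gM.
  have incM : is_hom inc by exact: ker_incl_hom.
  have [T' [i' [r' [i'M r'M ri']]]] := addM N.
  have [a aE] : exists a : T' -> 'I_m -> L,
      forall t l, psi (a t l) = (G l \o (inc \o r' t))%VF.
    suff H t : exists a, forall l, psi (a l) = (G l \o (inc \o r' t))%VF.
      exact: (fun_choice H).
    suff /fun_choice : forall l, exists a,
      psi a = (G l \o (inc \o r' t))%VF by [].
    move=> l'.
    exists ((psi^-1)%VF (G l' \o (inc \o r' t))%VF); apply: (end_invK psiP).
    exact: is_hom_comp (GM l') (is_hom_comp incM (r'M t)).
  have aK t : \sum_l' arr l' v * a t l' = 0.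
    apply: (end_inj psiP); rewrite linear0 linear_sum; apply/lfunP => z.
    rewrite sum_lfunE zero_lfunE.
    transitivity (\sum_l' psi (arr l' v) (G l' (inc (r' t z)))).
      apply: eq_bigr => l' _.
      have e1 : psi (arr l' v * a t l') z =
        psi (arr l' v) (G l' (inc (r' t z))).
        by rewrite psi_mul aE !comp_lfunE.
      exact: e1.
    rewrite arrG; have -> : g (inc (r' t z)) = 0; last exact: linear0.
    by rewrite -comp_lfunE comp_ker_incl zero_lfunE.
  have G0 t z : G l (inc (r' t z)) = 0.
    have := arrows_into_free phiP now (aK t) lv.
    move/(congr1 psi)/lfunP/(_ z);
      rewrite linear0 zero_lfunE psi_mul aE !comp_lfunE.
    by rewrite idG.
  have GI0 : (G l \o inc)%VF = 0.
    rewrite -[LHS]comp_lfun1r -ri'; apply/lfunP => z.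
    rewrite comp_lfunE sum_lfunE zero_lfunE linear_sum big1 // => t _.
    have e1 : (G l \o inc)%VF ((r' t \o i' t)%VF z) = 0.
      by rewrite !comp_lfunE G0.
    exact: e1.
  have xN : x = inc (Subvs xg) by rewrite ker_inclE.
  by rewrite memv_ker xN -comp_lfunE GI0 zero_lfunE.
pose ga l := (G l \o g^-1)%VF.
have gaP l : e l v -> is_hom (ga l) /\ (ga l \o g)%VF = G l.
  by move=> lv; apply: hom_factor => //; exact: kerG.
have [d dE] : exists d : 'I_m -> L,
    forall l, e l v -> psi (d l) = (ga l \o rh)%VF.
  suff /fun_choice : forall l, exists a, e l v -> psi a = (ga l \o rh)%VF by [].
  move=> l; have [lv|_] := boolP (e l v); last by exists 0.
  exists ((psi^-1)%VF (ga l \o rh)%VF) => _; apply: (end_invK psiP).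
  exact: is_hom_comp (gaP l lv).1 rhM.
have dv : \sum_l arr l v * d l = idem v.
  apply: (end_inj psiP); rewrite linear_sum; apply/lfunP => z;
    rewrite sum_lfunE.
  have [x gx] := limgP gs (rh z).
  rewrite -iorh comp_lfunE -gx -arrG; apply: eq_bigr => l _.
  have [lv|lv] := boolP (e l v); last first.
    have p0 : psi 0 = 0 by exact: linear0.
    have e0 : psi (arr l v * d l) z = psi (arr l v) (G l x).
      by rewrite (arr0 phi lv) mul0r p0 !zero_lfunE.
    exact: e0.
  have e1 : psi (arr l v * d l) z = psi (arr l v) (G l x).
    by rewrite psi_mul dE // comp_lfunE -gx -[ga l (g x)]comp_lfunE
      (gaP l lv).2.
  exact: e1.
have /(idem_notin_rad phiP)/eqP : rad 1 (1 *: idem v).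
  rewrite scale1r -dv; apply: rad_sum => l _.
  by apply: (radMr phiP); exact: arr_rad.
by rewrite oner_eq0.
Qed.
End Vertex.

Section Count.
Variable X : 'I_m -> fdmod A.
Hypotheses (Xind : is_ind X) (MX : is_direct_sum X M).

(** The identity of M is the sum of the projections on the X_i; as e_v L e_v
is local, e_v factors invertibly through one of them, and X_i is
indecomposable. *)
Lemma vertex_split v : exists i (io : 'Hom(X i, M)) (rh : 'Hom(M, X i)),
  [/\ is_hom io, is_hom rh,
    (rh \o io)%VF = \1%VF & (io \o rh)%VF = psi (idem v)].
Proof.
have [inj [prj [injM prjM _ _ sum1]]] := MX.
have [|Y [io [rh [ioM rhM rhio iorh]]]] := idem_split (end_hom psiP (idem v)).
  by rewrite -(end_mul psiP) (idem_idem phiP).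
have [z zE] : exists z : 'I_m -> L, forall i, psi (z i) = (inj i \o prj i)%VF.
  suff /fun_choice : forall i, exists a, psi a = (inj i \o prj i)%VF by [].
  move=> i; exists ((psi^-1)%VF (inj i \o prj i)%VF).
  apply: (end_invK psiP); exact: is_hom_comp (injM i) (prjM i).
have z1 : \sum_i z i = 1.
  apply: (end_inj psiP); rewrite (end_one psiP) linear_sum -sum1.
  by apply: eq_bigr => i _; exact: zE.
have [c cP] : exists c : 'I_m -> k,
    forall i, rad 1 (idem v * z i * idem v - c i *: idem v).
  suff /fun_choice : forall i, exists d,
    rad 1 (idem v * z i * idem v - d *: idem v) by [].
  by move=> i; have [d] := local_decomp phiP v v (z i); rewrite eqxx; exists d.
have [i ci] : exists i, c i != 0.
  apply: contrapT => c0; have /(idem_notin_rad phiP)/eqP : rad 1 (1 *: idem v).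
    have -> : 1 *: idem v = \sum_i (idem v * z i * idem v).
      by rewrite -mulr_suml -mulr_sumr z1 mulr1 (idem_idem phiP) scale1r.
    apply: rad_sum => i _; have := cP i.
    have [->|ci] := eqVneq (c i) 0; first by rewrite scale0r subr0.
    by case: c0; exists i.
  by rewrite oner_eq0.
have [b bE] := local_unit phiP ci (cP i).
pose f := (prj i \o (psi (idem v * b) \o io))%VF; pose g := (rh \o inj i)%VF.
have fM : is_hom f by exact: is_hom_comp (prjM i)
  (is_hom_comp (end_hom psiP _) ioM).
have gM : is_hom g by exact: is_hom_comp rhM (injM i).
have gf : (g \o f)%VF = \1%VF.
  apply/lfunP => y; rewrite !comp_lfunE id_lfunE.
  have -> u : rh (inj i (prj i u)) = rh (psi (idem v * z i) u).
    rewrite psi_mul zE (rh_psi_idem rhio iorh) comp_lfunE.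
    by [].
  by rewrite -psi_mul mulrA bE (rh_psi_idem rhio iorh) -comp_lfunE rhio
    id_lfunE.
have Y0 : exists y : Y, y != 0.
  apply: contrapT => noy; case/eqP: (idem_neq0 phiP v); apply: (end_inj psiP).
  rewrite -iorh linear0; apply/lfunP => x; rewrite comp_lfunE zero_lfunE.
  have [->|rx] := eqVneq (rh x) 0; first exact: linear0.
  by case: noy; exists (rh x).
have fg := retract_indecomposable fM gM gf Y0 (let: And3 H _ _ := Xind in H i).
exists i, (io \o g)%VF, (f \o rh)%VF; split.
- exact: is_hom_comp.
- exact: is_hom_comp.
- by rewrite comp_lfunA -(comp_lfunA f) rhio comp_lfun1r.
by rewrite comp_lfunA -(comp_lfunA io) gf comp_lfun1r.
Qed.

(** For v <> v' all maps between the images of e_v and e_v' are in J, hence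
not invertible. *)
Lemma vertex_split_inj v v' i (io io' : 'Hom(X i, M)) (rh rh' : 'Hom(M, X i)) :
  is_hom io -> is_hom rh -> is_hom io' -> is_hom rh' ->
  (rh \o io)%VF = \1%VF -> (rh' \o io')%VF = \1%VF ->
  (io \o rh)%VF = psi (idem v) -> (io' \o rh')%VF = psi (idem v') -> v = v'.
Proof.
move=> ioM rhM ioM' rhM' rio rio' ior ior'.
apply/eqP; apply: contraT => vv'.
pose p := (psi^-1)%VF (io' \o rh)%VF; pose p' := (psi^-1)%VF (io \o rh')%VF.
have pE : psi p = (io' \o rh)%VF by apply: (end_invK psiP);
  exact: is_hom_comp ioM' rhM.
have pE' : psi p' = (io \o rh')%VF by apply: (end_invK psiP);
  exact: is_hom_comp ioM rhM'.
have pp : idem v' * p * idem v = p.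
  apply: (end_inj psiP); rewrite !(end_mul psiP) pE -ior -ior'.
  by rewrite !comp_lfunA -(comp_lfunA io') rio' comp_lfun1r -(comp_lfunA io')
    rio comp_lfun1r.
have prad : rad 1 p.
  have [c] := local_decomp phiP v' v p.
  by rewrite eq_sym (negbTE vv') subr0 pp.
have p'p : p' * p = idem v.
  apply: (end_inj psiP);
    rewrite (end_mul psiP) pE pE' comp_lfunA -(comp_lfunA io) rio'.
  by rewrite comp_lfun1r.
have /(idem_notin_rad phiP)/eqP : rad 1 (1 *: idem v).
  by rewrite scale1r -p'p; apply: (radMl phiP).
by rewrite oner_eq0.
Qed.

(** Let s be the permutation of the vertices for which the image of e_v is
X_(s v). Then X_(s v) not projective implies that a nonempty mesh ends at v,
which implies that X_v is not projective. The first and the last condition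
hold for the same number of vertices, so that they are equivalent. *)
Lemma nonprojective_has_mesh : (forall C, in_add M C) ->
  (forall j i, mrel j i -> ~ projective (X i)) ->
  forall i, ~ projective (X i) -> exists j, nonempty_mesh e mrel j i.
Proof.
move=> addM mrelP.
have [s sP] := fun_choice vertex_split.
have s_inj : injective s.
  move=> v v' sv; have := sP v; have := sP v'; rewrite -sv.
  move=> [io' [rh' [h1 h2 h3 h4]]] [io [rh [g1 g2 g3 g4]]].
  exact: vertex_split_inj g1 g2 h1 h2 g3 h3 g4 h4.
pose N := [set i | `[< ~ projective (X i) >]].
pose S := [set i | [exists j, nonempty_mesh e mrel j i]].
have NS : s @^-1: N \subset S.
  apply/subsetP => v; rewrite !inE => /asboolP np.
  apply: contrapT => /negP; rewrite negb_exists => /forallP now; apply: np.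
  have [io [rh [h1 h2 h3 h4]]] := sP v.
  exact: proj_of_no_mesh h1 h2 h3 h4 addM now.
have SN : S \subset N.
  apply/subsetP => i; rewrite !inE => /existsP[j /andP[/asboolP ji _]].
  exact/asboolP/(mrelP j).
(* s is injective on a finite set, hence a permutation. *)
have cN : #|s @^-1: N| = #|N| by apply: on_card_preimset;
  exact/onW_bij/injF_bij.
have SE : S = N.
  by apply/eqP; rewrite eqEcard SN -cN subset_leq_card.
move=> i np; have : i \in S by rewrite SE inE; exact/asboolP.
by rewrite inE => /existsP.
Qed.
End Count.
End Projectives.

(** * Uniqueness of the Auslander-Reiten translate *)

Section Translate.
Variables (k : fieldType) (A : falgType k).
Implicit Types M N P Q R : fdmod A.

Lemma star_mapE P Q (f : 'Hom(P, Q)) (u : star Q) : is_hom f ->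
  vsval (star_map f u) = (vsval u \o f)%VF :> 'Hom(P, regular A).
Proof.
move=> fM; have H : (vsval u \o f)%VF \in homs P (regular A).
  apply/homsP; apply: is_hom_comp => //; apply/homsP; exact: subvsP.
by rewrite /star_map !comp_lfunE !lfunE /= vsprojK // lfunE.
Qed.

Lemma star_map_hom P Q (f : 'Hom(P, Q)) : is_hom f -> is_hom (star_map f).
Proof.
move=> fM a u; apply: val_inj.
transitivity (vsval (mact a u) \o f)%VF; first exact: star_mapE.
transitivity ((amulr (a : A) :
  'Hom(regular A, regular A)) \o vsval (star_map f u))%VF => //.
by rewrite star_mapE // comp_lfunA.
Qed.

Lemma star_map_comp P Q R (f : 'Hom(P, Q)) (g : 'Hom(Q, R)) (u : star R) :
  is_hom f -> is_hom g -> star_map f (star_map g u) = star_map (g \o f)%VF u.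
Proof.
move=> fM gM; apply: val_inj.
transitivity (vsval (star_map g u) \o f)%VF; first exact: star_mapE.
transitivity (vsval u \o (g \o f))%VF; first by rewrite star_mapE ?comp_lfunA.
exact/esym/star_mapE/is_hom_comp.
Qed.

Lemma dual_precomp (T T' : fdmod (opalg A)) (t : 'Hom(T', T)) :
  is_hom t -> limg t = fullv ->
  exists h : 'Hom(dual T, dual T'), is_hom h /\ lker h = 0%VS.
Proof.
move=> tM ts.
have hlin : linear (fun u : dual T => (u \o t)%VF : dual T').
  by move=> c u v; apply/lfunP => x;
    rewrite !comp_lfunE !add_lfunE !scale_lfunE !comp_lfunE.
have [h hE] := linfun_exists hlin; exists h; split.
  have actE a (S : fdmod (opalg A)) (w : 'Hom(S, k^o)) y :
      dual_act a w y = w (mact (a : opalg A) y).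
    by rewrite /dual_act comp_lfunE lfunE.
  move=> a u; rewrite !hE; apply/lfunP => x.
  transitivity (u (mact (a : opalg A) (t x))).
    by rewrite comp_lfunE; exact: actE.
  by rewrite -tM -comp_lfunE; apply/esym; exact: actE.
apply/eqP; rewrite -subv0; apply/subvP => u;
  rewrite memv_ker hE memv0 => /eqP ut.
apply/eqP/lfunP => y; have [x <-] := limgP ts y.
by rewrite zero_lfunE -comp_lfunE ut zero_lfunE.
Qed.

Lemma projective_lift P Q N (f : 'Hom(Q, N)) (h : 'Hom(P, N)) :
  projective P -> is_hom f -> is_hom h -> (limg h <= limg f)%VS ->
  exists2 a : 'Hom(P, Q), is_hom a & (f \o a)%VF = h.
Proof.
move=> Pp fM hM hf; pose S := submod (limg_submod fM).
have fmem v : f v \in limg f by exact/memv_img/memvf.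
have hmem v : h v \in limg f by apply: (subvP hf); exact/memv_img/memvf.
have flin : linear (fun v => Subvs (fmem v) : S).
  by move=> c x y; apply: val_inj; rewrite /= linearP.
have hlin : linear (fun v => Subvs (hmem v) : S).
  by move=> c x y; apply: val_inj; rewrite /= linearP.
have [f' f'E] := linfun_exists flin; have [h' h'E] := linfun_exists hlin.
have f'M : is_hom f' by move=> a v; rewrite !f'E; apply: val_inj; rewrite /= fM.
have h'M : is_hom h' by move=> a v; rewrite !h'E; apply: val_inj; rewrite /= hM.
have f's : limg f' = fullv.
  apply: limg_surj => y; have /memv_imgP[x _ xE] := subvsP y.
  by exists x; rewrite f'E; apply: val_inj; rewrite /= xE.
have [a aM aE] := Pp _ _ f' h' f'M f's h'M; exists a => //.
apply/lfunP => v; rewrite comp_lfunE.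
have := congr1 (fun F : 'Hom(P, S) => vsval (F v)) aE.
by rewrite comp_lfunE f'E h'E.
Qed.

(** The source of a projective cover is the only submodule that maps onto the
image. *)
Lemma cover_surj P M (W : {vspace M}) (f : 'Hom(P, M)) (b : 'Hom(P, P)) :
  proj_cover_of f W -> is_hom b -> (limg f <= limg (f \o b)%VF)%VS ->
    limg b = fullv.
Proof.
move=> [_ fM _ fmin] bM fb; apply: fmin; first exact: limg_submod.
apply/eqP; rewrite eqEsubv subvf; apply/subvP => x _.
have : f x \in limg (f \o b)%VF by apply: (subvP fb); exact/memv_img/memvf.
case/memv_imgP => y _; rewrite comp_lfunE => fE.
rewrite -[x](subrK (b y)) addrC; apply: memv_add; first exact/memv_img/memvf.
by rewrite memv_ker linearB /= fE subrr.
Qed.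

Lemma surj_inj P (b : 'Hom(P, P)) : limg b = fullv -> lker b = 0%VS.
Proof.
move=> bs; have := limg_ker_dim b fullv; rewrite capfv bs => /eqP.
by rewrite -[X in _ == X]add0n eqn_add2r dimv_eq0 => /eqP.
Qed.

(** The identity of M lifts to maps a_i : P_i -> P_i' and b_i : P_i' -> P_i of
the presentations. By minimality b1 a1 is invertible, so that Hom(a1, A) is
onto and induces a surjection T' -> T. *)
Lemma tau_mono M (P1 P0 P1' P0' : fdmod A)
    (f : 'Hom(P1, P0)) (g : 'Hom(P0, M)) (f' : 'Hom(P1', P0'))
    (g' : 'Hom(P0', M))
    (T T' : fdmod (opalg A)) (q : 'Hom(star P1, T)) (q' : 'Hom(star P1', T')) :
  min_presentation f g -> min_presentation f' g' ->
  is_coker (star_map f) q -> is_coker (star_map f') q' ->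
  exists h : 'Hom(dual T, dual T'), is_hom h /\ lker h = 0%VS.
Proof.
move=> [cg cf] [cg' cf'] [qM qs qk] [q'M q's q'k].
have [P0p gM gs _] := cg; have [P1p fM fs _] := cf.
have [P0p' gM' gs' _] := cg'; have [P1p' fM' fs' _] := cf'.
have [a0 a0M a0E] := projective_lift P0p gM' gM (subv_trans (subvf _)
  (eq_ind _ (fun W => (fullv <= W)%VS) (subvv _) _ (esym gs'))).
have [b0 b0M b0E] := projective_lift P0p' gM gM' (subv_trans (subvf _)
  (eq_ind _ (fun W => (fullv <= W)%VS) (subvv _) _ (esym gs))).
have gf0 : (g \o f)%VF = 0.
  apply/lfunP => x; rewrite comp_lfunE zero_lfunE; apply/eqP.
  by rewrite -memv_ker -fs; exact/memv_img/memvf.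
have gf0' : (g' \o f')%VF = 0.
  apply/lfunP => x; rewrite comp_lfunE zero_lfunE; apply/eqP.
  by rewrite -memv_ker -fs'; exact/memv_img/memvf.
have [|a1 a1M a1E] := projective_lift
  (h := (a0 \o f)%VF) P1p fM' (is_hom_comp a0M fM).
  rewrite fs'; apply/subvP => _ /memv_imgP[x _ ->].
  by rewrite memv_ker -comp_lfunE comp_lfunA a0E gf0 zero_lfunE.
have [|b1 b1M b1E] := projective_lift
  (h := (b0 \o f')%VF) P1p' fM (is_hom_comp b0M fM').
  rewrite fs; apply/subvP => _ /memv_imgP[x _ ->].
  by rewrite memv_ker -comp_lfunE comp_lfunA b0E gf0' zero_lfunE.
have gba : (g \o (b0 \o a0))%VF = g by rewrite comp_lfunA b0E a0E.
have ba0s : limg (b0 \o a0)%VF = fullv.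
  by apply: cover_surj cg (is_hom_comp b0M a0M) _; rewrite gba subvv.
have ba0k := surj_inj ba0s.
have [c0M c01 c02] := hom_inv (is_hom_comp b0M a0M) ba0k ba0s.
have fba : (f \o (b1 \o a1))%VF = ((b0 \o a0) \o f)%VF.
  by rewrite comp_lfunA b1E -comp_lfunA a1E comp_lfunA.
have ba1s : limg (b1 \o a1)%VF = fullv.
  apply: cover_surj cf (is_hom_comp b1M a1M) _; rewrite fba.
  rewrite {1}fs; apply/subvP => x xg.
  pose y := (b0 \o a0)^-1%VF x.
  have xE : x = (b0 \o a0)%VF y by rewrite /y -[RHS]comp_lfunE c01 id_lfunE.
  have : y \in lker g by rewrite memv_ker -gba comp_lfunE -xE -memv_ker.
  rewrite -fs => /memv_imgP[z _ zE].
  by rewrite xE zE -comp_lfunE; exact/memv_img/memvf.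
have ba1k := surj_inj ba1s.
have [c1M c11 c12] := hom_inv (is_hom_comp b1M a1M) ba1k ba1s.
set c := ((b1 \o a1)^-1)%VF in c1M c11 c12.
have saM := star_map_hom a1M.
have qaM : is_hom (q \o star_map a1)%VF by exact: is_hom_comp.
have [|tM tE] := hom_factor q'M qaM q's.
  rewrite q'k; apply/subvP => _ /memv_imgP[u _ ->].
  rewrite memv_ker comp_lfunE star_map_comp // a1E -star_map_comp // -memv_ker
    qk.
  exact/memv_img/memvf.
apply: dual_precomp tM _; apply: limg_surj => y.
have [u uE] := limgP qs y.
exists (q' (star_map (b1) (star_map c u))).
rewrite -comp_lfunE tE comp_lfunE -uE; congr (q _).
rewrite star_map_comp // star_map_comp //; last exact: is_hom_comp.
apply: val_inj; transitivity (vsval u \o (c \o (b1 \o a1)))%VF.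
  by apply: star_mapE; rewrite c12; exact: is_hom_id.
by rewrite c12 comp_lfun1r.
Qed.

Lemma mono_mono_iso N N' (f : 'Hom(N, N')) (g : 'Hom(N', N)) :
  is_hom f -> lker f = 0%VS -> lker g = 0%VS -> mod_iso N N'.
Proof.
move=> fM f0 g0; exists f; split=> //; apply/eqP; rewrite eqEdim subvf.
have df := limg_ker_dim f fullv; have dg := limg_ker_dim g fullv.
rewrite f0 capv0 dimv0 add0n in df; rewrite g0 capv0 dimv0 add0n in dg.
by rewrite df -dg dimvS ?subvf.
Qed.

Lemma is_tau_uniq M N N' : is_tau M N -> is_tau M N' -> mod_iso N N'.
Proof.
move=> [P1 [P0 [f [g [T [q [mp ck [i [iM i0 is_]]]]]]]]].
move=> [P1' [P0' [f' [g' [T' [q' [mp' ck' [j [jM j0 js]]]]]]]]].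
have [h [hM h0]] := tau_mono mp mp' ck ck'.
have [h' [h'M h'0]] := tau_mono mp' mp ck' ck.
have [i'M ii' i'i] := hom_inv iM i0 is_.
have [j'M jj' j'j] := hom_inv jM j0 js.
have ker_comp (U V W : fdmod A) (x : 'Hom(V, W)) (y : 'Hom(U, V)) :
    lker x = 0%VS -> lker y = 0%VS -> lker (x \o y)%VF = 0%VS.
  move=> x0 y0; apply/eqP; rewrite -subv0; apply/subvP => u.
  by rewrite memv_ker comp_lfunE -memv_ker x0 memv0 -memv_ker y0.
have ker_inv (U V : fdmod A) (x : 'Hom(U, V)) (y : 'Hom(V, U)) :
    (y \o x)%VF = \1%VF -> lker x = 0%VS.
  move=> yx; apply/eqP; rewrite -subv0; apply/subvP => u;
    rewrite memv_ker memv0.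
  by move=> /eqP xu; rewrite -[u](id_lfunE) -yx comp_lfunE xu linear0.
apply: (@mono_mono_iso _ _ (j^-1 \o (h \o i))%VF (i^-1 \o (h' \o j))%VF).
- exact: is_hom_comp j'M (is_hom_comp hM iM).
- exact: ker_comp _ _ _ _ _ (ker_inv _ _ _ _ jj') (ker_comp _ _ _ _ _ h0 i0).
exact: ker_comp _ _ _ _ _ (ker_inv _ _ _ _ ii') (ker_comp _ _ _ _ _ h'0 j0).
Qed.

(** In a minimal presentation of a projective module, P1 = 0. *)
Lemma is_tau_projective M N : is_tau M N -> projective M -> forall v : N, v = 0.
Proof.
move=> [P1 [P0 [f [g [T [q [[cg cf] [qM qs qk] [i [iM i0 _]]]]]]]]] Mp.
have [P0p gM gs gmin] := cg; have [P1p fM fs fmin] := cf.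
have [h hM hE] := Mp _ _ g \1%VF gM gs (@is_hom_id _ _ M).
have hs : limg h = fullv.
  apply: gmin; first exact: limg_submod.
  apply/eqP; rewrite eqEsubv subvf; apply/subvP => x _.
  rewrite -[x](subrK (h (g x))) addrC; apply: memv_add;
    first exact/memv_img/memvf.
  by rewrite memv_ker linearB /= -[g (h (g x))]comp_lfunE hE id_lfunE subrr.
have g0 x : g x = 0 -> x = 0.
  have [y <-] := limgP hs x.
  by rewrite -comp_lfunE hE id_lfunE => ->; exact: linear0.
have f0 x : f x = 0.
  by apply: g0; apply/eqP; rewrite -memv_ker -fs; exact/memv_img/memvf.
have P10 : fullv = 0%VS :> {vspace P1}.
  apply/esym; apply: fmin; first by move=> a v; rewrite !memv0 => /eqP ->;
    rewrite mact0r.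
  rewrite add0v; apply/eqP; rewrite eqEsubv subvf; apply/subvP => x _.
  by rewrite memv_ker f0.
have P1z (x : P1) : x = 0 by apply/eqP; rewrite -memv0 -P10 memvf.
have star0 (u : star P1) : u = 0.
  by apply: val_inj; apply/lfunP => x; rewrite (P1z x) !linear0.
have T0 (y : T) : y = 0 by have [u <-] := limgP qs y; rewrite (star0 u) linear0.
move=> v; apply/eqP; rewrite -memv0 -i0 memv_ker; apply/eqP/lfunP => y.
by rewrite (T0 y) !linear0.
Qed.
End Translate.

(** * The mesh algebra of the Auslander-Reiten quiver *)

Lemma malgUZ (k : fieldType) (K : choiceType) (d : k) (p : K) :
  << d *g p >> = d *: << p >> :> {malg k[K]}.
Proof. by apply/malgP => q; rewrite mcoeffZ !mcoeffU mulr_natr. Qed.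

Section PathAlgModel.
Variables (k : fieldType) (V : finType) (e : rel V).

Lemma path_alg_ind (P : path_alg k e -> Prop) :
  P 0 -> (forall x y, P x -> P y -> P (x + y)) ->
  (forall c v s, path e v s -> P (c *: path_seq k e v s)) -> forall x, P x.
Proof.
move=> P0 PD Pp x.
have PU (d : k) (p : qpath e) : P << d *g p >>.
  rewrite malgUZ; case: p => [[v s] vs].
  have := Pp d v s vs.
  by rewrite /path_seq (insubT (fun p => path e p.1 p.2) vs).
rewrite (monalgE x).
elim: (enum_fset (msupp x)) => [|p r IHr]; first by rewrite big_nil.
by rewrite big_cons; apply: PD; [exact: PU|exact: IHr].
Qed.

Lemma path_seq_out v s : ~~ path e v s -> path_seq k e v s = 0.
Proof. by move=> vs; rewrite /path_seq insubF //=; apply: negbTE. Qed.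

Lemma path_lift_seq (W : lmodType k) (g : V -> seq V -> W) v s : path e v s ->
  path_lift (fun p : qpath e => g (val p).1 (val p).2) (path_seq k e v s) =
    g v s.
Proof.
move=> vs; pose vs' : path e (v, s).1 (v, s).2 := vs.
rewrite /path_seq (insubT (fun p => path e p.1 p.2) vs').
exact: path_liftE.
Qed.

Lemma path_alg_extend (W : lmodType k) (g : V -> seq V -> W) :
  {F : {linear path_alg k e -> W} |
    forall v s, path e v s -> F (path_seq k e v s) = g v s}.
Proof.
pose f := path_lift (fun p : qpath e => g (val p).1 (val p).2).
pose mf := GRing.isLinear.Build k (path_alg k e) W *:%R f (path_lift_linear _).
by exists (HB.pack_for {linear path_alg k e -> W} f mf) => v s;
  exact: path_lift_seq.
Qed.

Definition path_alg_model : path_model k e := {|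
  pm_space := path_alg k e;
  pmulA := @path_mulA k V e;
  pmul1x := @path_1mul k V e;
  pmulx1 := @path_mul1 k V e;
  pmul_lin := conj (@path_mul_linl k V e) (@path_mul_linr k V e);
  pmul_seq := @path_mul_seq k V e;
  pone_sum := erefl;
  pseq_out := path_seq_out;
  pm_ind := path_alg_ind;
  pm_ext := path_alg_extend
|}.
End PathAlgModel.

Theorem corollary4p9 (k : fieldType) (A : falgType k)
    (m : nat) (X : 'I_m -> fdmod A) (L : falgType k) :
  is_ind X -> is_auslander_algebra X L -> is_standard X L ->
  (#|tau_fixed X| <= HH_dim 2 L)%N.
Proof.
move=> Xind [M [psi [MX psi0 psi_img psi1 psiM]]]
  [phi0 [phiZ phi_surj phi_ker]].
have psiP : end_pres psi by [].
have [Xi Xiso Xall] := Xind.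
have addM : forall C, in_add M C by exact: in_addP Xall MX.
pose B := path_alg_model k (ar_arrow X).
pose mrel j i := ~ projective (X i) /\ is_tau (X i) (X j).
have phi_lin : linear (phi0 : B -> L).
  by move=> c x y; rewrite rmorphD /= phiZ.
pose phi : {linear B -> L} := HB.pack_for {linear B -> L} (phi0 : B -> L)
  (GRing.isLinear.Build k B L *:%R (phi0 : B -> L) phi_lin).
have phiP : mesh_pres mrel phi.
  split.
  - by move=> x y; exact: (rmorphM phi0).
  - exact: (rmorph1 phi0).
  - exact: phi_surj.
  move=> x; split=> [/phi_ker xI P P0 PD PM PG|xI].
    apply: (xI P P0 PD PM).
    by move=> y [i [j [np t ->]]]; exact: PG.
  apply/phi_ker => I I0 ID IM IG; apply: (xI I I0 ID IM).
  by move=> j i [np t]; apply: IG; exists i, j.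
apply: (HH2_mesh phiP (end_syz_projective psiP addM)) => i.
rewrite inE => /asboolP ti.
have np : ~ projective (X i).
  move=> Pi; have [[v v0] _] := Xi i.
  by case/eqP: v0; exact: is_tau_projective ti Pi v.
have [j ji] := nonprojective_has_mesh phiP psiP Xind MX addM
  (fun j i H => H.1) np.
have /andP[/asboolP[_ tj] _] := ji.
by rewrite {1}(Xiso i j (is_tau_uniq ti tj)).
Qed.
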